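(* Let $G$ be a locally finite connected graph. Then the following are equivalent: (i) $G$ is $2$-connected and contains neither $K^4$ nor $K_{2,3}$ as a minor; (ii) $|G|$ has a Hamilton circle $C$ and there exists a topological embedding of $|G|$ into a closed disk such that $C$ is mapped onto the boundary of the disk. Furthermore, if (i) and (ii) hold, then $|G|$ has a unique Hamilton circle.
   Context: All graphs are simple. For a locally finite connected graph $G$, an end is an equivalence class of rays of $G$, two rays being equivalent if no finite vertex set separates them. $|G|$ is the Freudenthal compactification of $G$: $G$ as a 1-complex together with its ends, where for every finite $S\subseteq V(G)$ and end $\omega$, the component $C$ of $G-S$ containing tails of all rays of $\omega$, together with the ends whose rays have tails in $C$ and the inner points of edges between $S$ and $C$, forms an open neighbourhood of $\omega$. A circle in $|G|$ is a homeomorphic image of $S^1$ in $|G|$; a Hamilton circle is a circle in $|G|$ containing all vertices of $G$. *)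

(* Defs.v *)
From HB Require Import structures.
From mathcomp Require Import all_boot all_order all_algebra.
From mathcomp Require Import all_classical all_reals all_analysis.
From mathcomp Require Import Rstruct Rstruct_topology.
From Stdlib Require Import Rdefinitions.
Set Implicit Arguments. Unset Strict Implicit. Unset Printing Implicit Defensive.
Import Order.TTheory GRing.Theory Num.Theory.
Local Open Scope classical_set_scope.
Local Open Scope ring_scope.

(* A graph is given by a vertex type, an edge type and the two ends of each
   edge.  Each edge carries an (arbitrary, irrelevant) orientation, which is
   only used to parametrise its inner points by the open interval (0,1).
   Simplicity is the predicate [simple] below. *)
Record graph := Graph { gV : Type; gE : Type; src : gE -> gV; tgt : gE -> gV }.

Definition adj (G : graph) (u v : gV G) : Prop :=
  exists x : gE G, (src x = u /\ tgt x = v) \/ (src x = v /\ tgt x = u).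

Definition simple (G : graph) : Prop :=
  (forall x : gE G, src x <> tgt x) /\
  (forall x y : gE G, (src x = src y /\ tgt x = tgt y) \/
                      (src x = tgt y /\ tgt x = src y) -> x = y).

Definition locally_finite (G : graph) : Prop :=
  forall v : gV G, finite_set [set x : gE G | src x = v \/ tgt x = v].

Inductive conn (G : graph) (A : set (gV G)) : gV G -> gV G -> Prop :=
| conn_refl v : A v -> conn A v v
| conn_step u v w : conn A u v -> A w -> adj v w -> conn A u w.

Definition connected_graph (G : graph) : Prop :=
  (exists v : gV G, True) /\ forall u v : gV G, conn setT u v.

Definition two_connected (G : graph) : Prop :=
  (exists a b c : gV G, a <> b /\ b <> c /\ a <> c) /\
  forall v : gV G, forall a b : gV G, a <> v -> b <> v ->
    conn [set x | x <> v] a b.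

Definition has_minor (G : graph) (n : nat) (H : 'I_n -> 'I_n -> bool) : Prop :=
  exists B : 'I_n -> set (gV G),
    (forall i, B i !=set0) /\
    (forall i j, i != j -> B i `&` B j = set0) /\
    (forall i u v, B i u -> B i v -> conn (B i) u v) /\
    (forall i j, H i j -> exists u v, B i u /\ B j v /\ adj u v).

Definition K4 : 'I_4 -> 'I_4 -> bool := fun i j => i != j.
Definition K23 : 'I_5 -> 'I_5 -> bool :=
  fun i j => ltn i 2 != ltn j 2.

Definition ray (G : graph) (r : nat -> gV G) : Prop :=
  injective r /\ forall n, adj (r n) (r n.+1).

Definition tail_avoids (G : graph) (S : set (gV G)) (r : nat -> gV G) N :=
  forall k, leq N k -> ~ S (r k).

Definition ray_equiv (G : graph) (r1 r2 : nat -> gV G) : Prop :=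
  forall S : set (gV G), finite_set S -> exists N M,
    tail_avoids S r1 N /\ tail_avoids S r2 M /\ conn (~` S) (r1 N) (r2 M).

Definition gend (G : graph) :=
  {E : set (nat -> gV G) | exists r, ray r /\ E = [set r' | ray r' /\ ray_equiv r r']}.

Inductive gpt (G : graph) :=
| PV of gV G
| PE of gE G & {t : R | 0 < t < 1}
| PEnd of gend G.

Definition edge_map (G : graph) (x : gE G) (t : R) : gpt G :=
  match insub t with
  | Some s => PE x s
  | None => if t <= 0 then PV (src x) else PV (tgt x)
  end.

(* open sets of G viewed as a 1-complex (sets of non-end points whose
   preimage under every characteristic map is open in [0,1]) *)
Definition complex_open (G : graph) (O : set (gpt G)) : Prop :=
  (forall w, ~ O (PEnd w)) /\
  forall (x : gE G) (t : R), 0 <= t <= 1 -> O (edge_map x t) ->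
    exists2 e : R, 0 < e & forall s : R, 0 <= s <= 1 -> `|s - t| < e ->
      O (edge_map x s).

(* the component of G - S containing tails of all rays of w *)
Definition comp_of (G : graph) (S : set (gV G)) (w : gend G) : set (gV G) :=
  [set v | exists r, proj1_sig w r /\ exists N,
             tail_avoids S r N /\ conn (~` S) (r N) v].

(* C together with its edges, the ends whose rays have tails in C, and the
   inner points of the S--C edges *)
Definition Chat (G : graph) (S : set (gV G)) (w : gend G) : set (gpt G) :=
  let C := comp_of S w in
  fun p => match p with
  | PV v => C v
  | PE x _ => (C (src x) \/ S (src x)) /\ (C (tgt x) \/ S (tgt x)) /\
              (C (src x) \/ C (tgt x))
  | PEnd w' => forall r, proj1_sig w' r -> exists N, forall k, leq N k -> C (r k)
  end.

Definition subbasic (G : graph) (A : set (gpt G)) : Prop :=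
  complex_open A \/
  exists S w, finite_set S /\ A = Chat S w.

HB.instance Definition _ (G : graph) := gen_eqMixin (gpt G).
HB.instance Definition _ (G : graph) := gen_choiceMixin (gpt G).
HB.instance Definition _ (G : graph) :=
  @isSubBaseTopological.Build (gpt G) (set (gpt G)) (@subbasic G) id.

Definition sphere (c : R * R) (r : R) : set (R * R) :=
  [set p | (p.1 - c.1) ^+ 2 + (p.2 - c.2) ^+ 2 = r ^+ 2].
Definition disk (c : R * R) (r : R) : set (R * R) :=
  [set p | (p.1 - c.1) ^+ 2 + (p.2 - c.2) ^+ 2 <= r ^+ 2].
Definition S1 : set (R * R) := sphere (0, 0) 1.

Definition embedding_on {X Y : topologicalType} (A : set X) (f : X -> Y) : Prop :=
  {within A, continuous f} /\ set_inj A f /\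
  forall U : set X, open U -> exists W : set Y, open W /\ f @` (A `&` U) = f @` A `&` W.

Definition circle (G : graph) (C : set (gpt G)) : Prop :=
  exists f : R * R -> gpt G, embedding_on S1 f /\ C = f @` S1.

Definition hamilton_circle (G : graph) (C : set (gpt G)) : Prop :=
  circle C /\ forall v : gV G, C (PV v).

(* Main.v *)
(** Forbidding the minors is forced by the disk: two paths in a closed disk whose ends
    alternate on the boundary meet, so, the vertices lying on the boundary circle, two disjoint
    connected vertex sets never alternate there, whereas the branch sets of a K4 or K_{2,3}
    minor would.  2-connectedness follows because a circle minus a point is connected.

    Conversely, 2-connectedness and the absence of K_{2,3} put every finite vertex set on a
    cycle, and the absence of K4 makes the chords of that cycle non-crossing.  An ultrafilter on
    the cycles through a fixed vertex turns their vertex orders into one linear order of all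
    vertices in which edges do not cross and every vertex is adjacent to its neighbours in the
    order.  The ends are exactly the gaps of this order.  A summable positive weight on the
    vertices places vertices and ends on a half circle; consecutive vertices are joined along
    the circle, the least and the greatest vertex along the opposite half circle, and all other
    edges are straight chords.  As |G| is compact, this is an embedding, and its preimage of the
    boundary is a Hamilton circle.

    Any Hamilton circle avoids the chords: the ends of a chord would cut it into two connected
    pieces, which cannot cover the chord and both of its sides.  Hence it lies in the boundary
    circle, and a circle properly contained in a circle does not exist. *)
From Stdlib Require Import Rdefinitions.
Require Import Defs.
From HB Require Import structures.
From mathcomp Require Import all_boot all_order all_algebra finmap.
From mathcomp Require Import all_classical all_reals all_analysis.
From mathcomp Require Import Rstruct Rstruct_topology.
From mathcomp Require Import ring lra zify.
Set Implicit Arguments. Unset Strict Implicit. Unset Printing Implicit Defensive.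
Import Order.TTheory GRing.Theory Num.Theory numFieldNormedType.Exports.
Local Open Scope classical_set_scope.
Local Open Scope ring_scope.
(* Without this, terms of expected type [R] are parsed in Stdlib's [R_scope]. *)
Bind Scope ring_scope with R.
Arguments edge_map {G} x t%_ring_scope.

(** Cycles through larger and larger finite vertex sets come with arbitrary orientations; an
    ultrafilter picks a consistent order without any need to compare them. Local finiteness keeps
    the limit discrete: the next vertex on a cycle is one of finitely many neighbours, so it is
    constant on almost all cycles. The limit order has gaps, and 2-connectedness is used a second
    time to show that edges across a gap shrink to it, so that their end pairs [p], [q] cut off
    small neighbourhoods of the end. Positions have to be injective and continuous at ends: the
    weight of the initial segment achieves both, since consecutive vertices keep a positive distance
    while initial segments near a gap agree on ever larger finite sets. For the converse, only
    single edges are treated as curves: a sign change along a walk reduces two alternating branch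
    sets to two alternating edges, and that such curves meet is shown by counting mod 2 on a grid
    instead of by the Jordan curve theorem. *)

HB.instance Definition _ (G : graph) := gen_eqMixin (gV G).
HB.instance Definition _ (G : graph) := gen_choiceMixin (gV G).
HB.instance Definition _ (G : graph) := gen_eqMixin (gE G).
HB.instance Definition _ (G : graph) := gen_choiceMixin (gE G).

(** * Connectivity *)

Section Connectivity.
Variable G : graph.
Implicit Types (A B : set (gV G)) (u v w : gV G).

Lemma adj_sym u v : adj u v -> adj v u.
Proof. by case=> x []; exists x; [right|left]. Qed.

Lemma adj_edge (x : gE G) : adj (src x) (tgt x).
Proof. by exists x; left. Qed.

Lemma conn_l A u v : conn A u v -> A u.
Proof. by elim. Qed.

Lemma conn_r A u v : conn A u v -> A v.
Proof. by case. Qed.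

Lemma conn_trans A u v w : conn A u v -> conn A v w -> conn A u w.
Proof.
move=> uv vw; elim: vw uv => // {}v b c _ IH Ac bc uv.
exact: conn_step (IH uv) Ac bc.
Qed.

Lemma conn_adj A u v : A u -> A v -> adj u v -> conn A u v.
Proof. by move=> Au Av; apply: conn_step Av; exact: conn_refl. Qed.

Lemma conn_sym A u v : conn A u v -> conn A v u.
Proof.
elim=> [w Aw|a b c ab IH Ac bc]; first exact: conn_refl.
by apply: conn_trans IH; apply: conn_adj => //; [exact: conn_r ab|exact: adj_sym].
Qed.

Lemma conn_sub A B u v : A `<=` B -> conn A u v -> conn B u v.
Proof.
move=> AB; elim=> [w /AB Bw|a b c _ IH /AB Bc bc]; first exact: conn_refl.
exact: conn_step IH Bc bc.
Qed.

Lemma conn_closed A (D : set (gV G)) u v :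
  (forall a b, D a -> A b -> adj a b -> D b) -> conn A u v -> D u -> D v.
Proof. by move=> cl; elim=> // a b c _ IH Ac bc /IH Db; exact: cl bc. Qed.

Definition adjb : rel (gV G) := fun u v => `[< adj u v >].

Lemma adjb_sym : symmetric adjb.
Proof. by move=> u v; apply/asboolP/asboolP => /adj_sym. Qed.

Lemma path_conn u (p : seq (gV G)) v : path adjb u p -> v \in u :: p ->
  conn [set` u :: p] u v.
Proof.
elim/last_ind: p v => [|p w IH] v.
  by rewrite inE => _ /eqP ->; apply: conn_refl; rewrite /= inE.
rewrite rcons_path => /andP[pp lw]; rewrite -rcons_cons mem_rcons inE.
have sub : [set` u :: p] `<=` [set` rcons (u :: p) w].
  by move=> z zp; rewrite /mkset mem_rcons inE [z \in u :: p]zp orbT.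
case/predU1P => [->|vp]; last exact: conn_sub sub (IH _ pp vp).
apply: (@conn_step _ _ _ (last u p)).
- by apply: conn_sub sub _; apply: IH => //; exact: mem_last.
- by rewrite /mkset mem_rcons inE eqxx.
- exact/asboolP.
Qed.

Lemma path_conn2 u (p : seq (gV G)) v w : path adjb u p ->
  v \in u :: p -> w \in u :: p -> conn [set` u :: p] v w.
Proof.
move=> pp vp wp; apply: conn_trans (path_conn pp wp).
by apply: conn_sym; exact: path_conn.
Qed.

Lemma conn_path A u v : conn A u v ->
  exists p, [/\ path adjb u p, last u p = v, uniq (u :: p)
             & forall w, w \in u :: p -> A w].
Proof.
have suff_walk : (exists p, [/\ path adjb u p, last u p = v
               & forall w, w \in u :: p -> A w]) -> exists p,
   [/\ path adjb u p, last u p = v, uniq (u :: p) & forall w, w \in u :: p -> A w].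
  case=> p [pp lp Ap]; case/shortenP: pp lp => p' pp' up' sub lp'.
  exists p'; split=> // w; rewrite inE => /predU1P[->|/sub wp].
    by apply: Ap; rewrite mem_head.
  by apply: Ap; rewrite inE wp orbT.
move=> uv; apply: suff_walk; elim: uv => [w Aw|a b c _ [p [pp lp Ap]] Ac bc].
  by exists [::]; split=> // z; rewrite inE => /eqP->.
exists (rcons p c); split=> [||w]; last first.
- by rewrite -rcons_cons mem_rcons inE => /predU1P[->|/Ap].
- by rewrite last_rcons.
- by rewrite rcons_path pp lp; apply/asboolP.
Qed.

End Connectivity.

Section LocallyFinite.
Variable G : graph.
Hypothesis lfG : locally_finite G.

Lemma neighbours_seq (v : gV G) : exists s : seq (gV G), forall u, adj v u -> u \in s.
Proof.
have /finite_seqP [s hs] := lfG v.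
exists ([seq src x | x <- s] ++ [seq tgt x | x <- s]) => u [x hx].
have xs : x \in s.
  have : [set` s] x by rewrite -hs /=; case: hx => -[]; [left|right].
  by [].
by rewrite mem_cat; case: hx => [[_ <-]|[<- _]]; rewrite map_f ?orbT.
Qed.

End LocallyFinite.

Lemma ray_avoids (G : graph) (r : nat -> gV G) (S : set (gV G)) :
  injective r -> finite_set S -> exists N, tail_avoids S r N.
Proof.
move=> ri /finite_seqP [s ->]; elim: s => [|v s [N hN]]; first by exists 0%N.
have [[k rk]|nk] := pselect (exists k, r k = v).
  exists (maxn N k.+1) => j; rewrite geq_max => /andP[Nj kj] /=.
  rewrite inE => /predU1P[rj|]; last exact: hN.
  by move: kj; rewrite (ri j k) ?ltnn // rj rk.
exists N => j Nj /=; rewrite inE => /predU1P[rj|]; last exact: hN.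
by apply: nk; exists j.
Qed.

Lemma ray_stays (G : graph) (r : nat -> gV G) (S D : set (gV G)) N k :
  (forall n, adj (r n) (r n.+1)) -> tail_avoids S r N ->
  (forall a b, D a -> ~ S b -> adj a b -> D b) -> (N <= k)%N -> D (r N) -> D (r k).
Proof.
move=> radj av cl Nk DN; elim: k Nk => [|k IH]; first by rewrite leqn0 => /eqP <-.
rewrite leq_eqVlt => /predU1P[<- //|Nk].
by apply: cl (radj k); [exact: IH|apply: av; exact: ltnW].
Qed.

Lemma ray_conn (G : graph) (r : nat -> gV G) (S : set (gV G)) N k :
  (forall n, adj (r n) (r n.+1)) -> tail_avoids S r N -> (N <= k)%N ->
  conn (~` S) (r N) (r k).
Proof.
move=> radj av Nk; apply: (ray_stays radj av _ Nk).
- by move=> a b ca Sb ab; exact: conn_step ca Sb ab.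
- by apply: conn_refl; exact: av.
Qed.

(** * Topology of the end compactification *)

Section Topology.
Variable G : graph.
Implicit Types (S D : set (gV G)) (w : gend G) (x : gE G).

Lemma subbasic_open (A : set (gpt G)) : subbasic A -> open A.
Proof.
move=> sA; exists [set A]; last first.
  by rewrite predeqE => ?; split=> [[_ ->]|] //; exists A.
move=> _ ->; exists [fset A]%fset.
  by move=> ?; rewrite inE inE => /eqP->.
by rewrite predeqE=> ?; split=> [|??]; [apply|]; rewrite /= inE // =>/eqP->.
Qed.

Lemma complex_open_open (A : set (gpt G)) : complex_open A -> open A.
Proof. by move=> cA; apply: subbasic_open; left. Qed.

Lemma Chat_open S w : finite_set S -> open (Chat S w).
Proof. by move=> fS; apply: subbasic_open; right; exists S, w. Qed.

Lemma cvg_subbasic (F : set_system (gpt G)) (p : gpt G) : Filter F ->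
  (forall A, subbasic A -> A p -> F A) -> F --> p.
Proof.
move=> FF sub A; rewrite nbhsE => -[_ [[B sB <-] [C BC Cp] sUBA]].
rewrite nbhs_filterE; apply: filterS sUBA _; apply: (@filterS _ _ _ C).
  by move=> ? ?; exists C.
have /sB [D sD IDeC] := BC; rewrite -IDeC; apply: filter_bigI => E DE.
by apply: sub; [have /sD := DE; rewrite inE|move: Cp; rewrite -IDeC => /(_ _ DE)].
Qed.

Lemma edge_map0 x : edge_map x 0 = PV (src x).
Proof. by rewrite /edge_map insubF ?ltxx ?lexx. Qed.

Lemma edge_map1 x : edge_map x 1 = PV (tgt x).
Proof. by rewrite /edge_map insubF ?ltxx ?andbF // ler10. Qed.

Lemma edge_map_le0 x t : t <= 0 -> edge_map x t = PV (src x).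
Proof. by move=> t0; rewrite /edge_map insubF ?t0 // ltNge t0. Qed.

Lemma edge_map_ge1 x t : 1 <= t -> edge_map x t = PV (tgt x).
Proof.
move=> t1; rewrite /edge_map insubF; last by rewrite [t < 1]ltNge t1 andbF.
by rewrite leNgt (lt_le_trans ltr01 t1).
Qed.

Lemma edge_map_in x t (h : 0 < t < 1) : edge_map x t = PE x (exist _ t h).
Proof.
rewrite /edge_map; case: insubP => [u _ ut|]; last by rewrite h.
by congr PE; apply: val_inj.
Qed.

Variant edge_map_spec x t : gpt G -> Prop :=
| EdgeSrc of t <= 0 : edge_map_spec x t (PV (src x))
| EdgeTgt of 1 <= t : edge_map_spec x t (PV (tgt x))
| EdgeIn (h : 0 < t < 1) : edge_map_spec x t (PE x (exist _ t h)).

Lemma edge_mapP x t : edge_map_spec x t (edge_map x t).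
Proof.
case: (leP t 0) => t0; first by rewrite edge_map_le0 //; constructor.
case: (leP 1 t) => t1; first by rewrite edge_map_ge1 //; constructor.
have h : 0 < t < 1 by rewrite t0.
by rewrite (edge_map_in x h); constructor.
Qed.

Lemma edge_map_val x (t : {t : R | 0 < t < 1}) : edge_map x (sval t) = PE x t.
Proof. by case: t => t h; rewrite /= (edge_map_in x h). Qed.

(** Sets open in the 1-complex contain no ends, so openness at vertices and inner edge points is
    tested on this part of [A], and ends are treated separately. *)
Definition nonend (A : set (gpt G)) : set (gpt G) :=
  [set p | A p /\ forall w, p <> PEnd w].

Lemma star_open D (A : set (gpt G)) : (forall w, ~ A (PEnd w)) ->
  (forall v, A (PV v) -> D v) ->
  (forall v, D v -> A (PV v)) ->
  (forall x t, A (PE x t) <-> D (src x) \/ D (tgt x)) -> complex_open A.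
Proof.
move=> nA AD DA hE; split=> // x t /andP[t0 t1].
case: edge_mapP => [t0' /AD Ds|t1' /AD Dt|h /hE Ax].
- have {t1 t0 t0'}-> : t = 0 by apply/eqP; rewrite eq_le t0' t0.
  exists 1 => // s /andP[s0 s1]; rewrite subr0 ger0_norm // => s1'.
  case: edge_mapP => [_|s1''|h]; [exact: DA|lra|by apply/hE; left].
- have {t1 t0 t1'}-> : t = 1 by apply/eqP; rewrite eq_le t1' t1.
  exists 1 => // s /andP[s0 s1]; rewrite ler0_norm ?subr_le0 // => s1'.
  case: edge_mapP => [s0'|_|h]; [lra|exact: DA|by apply/hE; right].
- have tpos : 0 < Num.min t (1 - t) by rewrite lt_min subr_gt0.
  exists (Num.min t (1 - t)) => // s /andP[s0 s1].
  rewrite lt_min !ltr_norml => /andP[/andP[h1 h2] /andP[h3 h4]].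
  by case: edge_mapP => [s0'|s1'|h']; [lra|lra|exact/hE].
Qed.

End Topology.

(** * Components of [G - S], ends, and the two sides of a finite separator *)

Section Ends.
Variable G : graph.
Implicit Types (S D : set (gV G)) (w : gend G) (x : gE G) (r : nat -> gV G).

Lemma ray_equiv_refl r : ray r -> ray_equiv r r.
Proof.
move=> [ri _] S fS; have [N av] := ray_avoids ri fS.
by exists N, N; split=> //; split=> //; apply: conn_refl; exact: av.
Qed.

Lemma end_rays w : exists r0, [/\ ray r0, sval w r0 &
  forall r, sval w r <-> ray r /\ ray_equiv r0 r].
Proof.
have [r0 [rr0 ->]] := proj2_sig w; exists r0; split => //=.
by split=> //; exact: ray_equiv_refl.
Qed.

Lemma ray_conn2 r S N M : ray r -> tail_avoids S r N -> tail_avoids S r M ->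
  conn (~` S) (r N) (r M).
Proof.
move=> [_ ra] aN aM; case: (leqP N M) => [|/ltnW] NM; first exact: ray_conn.
by apply: conn_sym; exact: ray_conn.
Qed.

Lemma comp_of_notS S w v : comp_of S w v -> ~ S v.
Proof. by case=> r [_ [N [_ /conn_r]]]. Qed.

Lemma comp_of_closed S w a b : comp_of S w a -> ~ S b -> adj a b -> comp_of S w b.
Proof.
by case=> r [wr [N [av c]]] Sb ab; exists r; split=> //; exists N; split=> //;
  exact: conn_step c Sb ab.
Qed.

Lemma comp_of_conn S w u v : finite_set S -> comp_of S w u -> comp_of S w v ->
  conn (~` S) u v.
Proof.
move=> fS [r1 [wr1 [N1 [a1 c1]]]] [r2 [wr2 [N2 [a2 c2]]]].
have [r0 [rr0 _ hw]] := end_rays w.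
have [rr1 /(_ S fS) [n1 [m1 [b1 [d1 e1]]]]] := (hw r1).1 wr1.
have [rr2 /(_ S fS) [n2 [m2 [b2 [d2 e2]]]]] := (hw r2).1 wr2.
apply: (conn_trans (conn_sym c1)); apply: conn_trans c2.
apply: (conn_trans (ray_conn2 rr1 a1 d1)); apply: conn_trans (ray_conn2 rr2 d2 a2).
by apply: (conn_trans (conn_sym e1)); apply: conn_trans e2; exact: ray_conn2.
Qed.

Lemma comp_of_ray S w r N k : sval w r -> tail_avoids S r N ->
  (N <= k)%N -> comp_of S w (r k).
Proof.
move=> wr av Nk; exists r; split=> //; exists N; split=> //.
have [r0 [_ _ hw]] := end_rays w.
by have [[_ ra] _] := (hw r).1 wr; exact: ray_conn.
Qed.

Lemma comp_of_evt S w r : finite_set S -> sval w r ->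
  exists N, forall k, (N <= k)%N -> comp_of S w (r k).
Proof.
move=> fS wr; have [r0 [_ _ hw]] := end_rays w.
have [[ri _] _] := (hw r).1 wr.
have [N av] := ray_avoids ri fS.
by exists N => k; exact: comp_of_ray.
Qed.

Lemma comp_of_nonempty S w : finite_set S -> exists v, comp_of S w v.
Proof.
move=> fS; have [r0 [_ wr0 _]] := end_rays w.
by have [N h] := comp_of_evt fS wr0; exists (r0 N); exact: h.
Qed.

Lemma Chat_end S w : finite_set S -> Chat S w (PEnd w).
Proof. by move=> fS r wr; exact: comp_of_evt. Qed.

Lemma Chat_complex S w : complex_open (nonend (Chat S w)).
Proof.
apply: (@star_open _ (comp_of S w)).
- by move=> w' [_ /(_ w')].
- by move=> v [].
- by move=> v Cv; split.
- move=> x t; split=> [[[_ [_ ?]] _] //|h]; split=> //; split; last split=> //.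
    case: (pselect (S (src x))) => [|nS]; first by right.
    by left; case: h => // /comp_of_closed; apply => //; apply/adj_sym/adj_edge.
  case: (pselect (S (tgt x))) => [|nS]; first by right.
  by left; case: h => // /comp_of_closed; apply => //; exact: adj_edge.
Qed.

(** [edge_map] is constant beyond 0 and 1, so an edge becomes a path defined on all of [R]. It never
    takes an end as value, hence a basic neighbourhood [Chat] may be replaced by its part
    [nonend]. *)
Lemma edge_map_continuous x : continuous (edge_map x : R -> gpt G).
Proof.
move=> t; apply: cvg_subbasic => A sA At.
have [A' [cA' sub A't]] : exists A', [/\ complex_open A', A' `<=` A & A' (edge_map x t)].
  case: sA => [cA|[S [w [fS eA]]]]; first by exists A; split.
  exists (nonend A); split=> [||]; [by rewrite eA; exact: Chat_complex|by move=> p []|].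
  by split=> // w'; case: edge_mapP.
change (\forall s \near t, A (edge_map x s)).
have [_ hA] := cA'.
case: (ltrP t 0) => t0.
  near=> s; apply: sub; have s0 : s < 0 by near: s; exact: lt_nbhsl.
  by rewrite edge_map_le0 ?ltW // -(edge_map_le0 x (ltW t0)).
case: (ltrP 1 t) => t1.
  near=> s; apply: sub; have s1 : 1 < s by near: s; exact: lt_nbhsr.
  by rewrite edge_map_ge1 ?ltW // -(edge_map_ge1 x (ltW t1)).
have t01 : 0 <= t <= 1 by rewrite t0.
have [e e0 he] := hA x t t01 A't.
near=> s; have st : `|s - t| < e by rewrite distrC; near: s; exact: nbhsx_ballx.
apply: sub; case: (ltrP s 0) => s0.
  rewrite edge_map_le0 ?ltW // -edge_map0; apply: he; first by rewrite lexx ler01.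
  apply: le_lt_trans st; rewrite sub0r normrN ger0_norm // ltr0_norm ?subr_lt0 ?(lt_le_trans s0) //.
  by rewrite opprB lerDl oppr_ge0 ltW.
case: (ltrP 1 s) => s1.
  rewrite edge_map_ge1 ?ltW // -edge_map1; apply: he; first by rewrite lexx ler01.
  have ts : t <= s := le_trans t1 (ltW s1).
  by apply: le_lt_trans st; rewrite !ger0_norm ?subr_ge0 // lerD2r ltW.
by apply: he => //; rewrite s0.
Unshelve. all: by end_near. Qed.

(** The part of |G| that belongs to a union [D] of components of [G - S]. The inner points of edges
    from [D] to [S] are included to make it open. *)
Definition side S D : set (gpt G) := fun p =>
  match p with
  | PV v => D v
  | PE x _ => D (src x) \/ D (tgt x)
  | PEnd w => comp_of S w `<=` D
  end.

Definition component_union S D : Prop :=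
  (forall a, D a -> ~ S a) /\ (forall a b, D a -> ~ S b -> adj a b -> D b).

Lemma component_unionC S D : component_union S D ->
  component_union S [set a | ~ S a /\ ~ D a].
Proof.
move=> [h1 h2]; split=> [a []//|a b [Sa Da] Sb ab]; split=> // Db.
by apply: Da; apply: h2 Db Sa _; exact: adj_sym.
Qed.

Lemma component_union_conn S D u v : component_union S D ->
  conn (~` S) u v -> D u -> D v.
Proof. by move=> [_ h]; apply: conn_closed. Qed.

Lemma side_open S D : finite_set S -> component_union S D -> open (side S D).
Proof.
move=> fS DS; rewrite openE => p Dp.
have nend_open : complex_open (nonend (side S D)).
  apply: (@star_open _ D); [by move=> w [_ /(_ w)]|by move=> v []|by move=> v ?; split|].
  by move=> x t; split=> [[]|].
have sub_nbhs B : open B -> B p -> B `<=` side S D -> nbhs p (side S D).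
  by move=> oB Bp sB; rewrite nbhsE; exists B.
case: p Dp sub_nbhs => [v|x t|w] Dp sub_nbhs.
- by apply: (sub_nbhs (nonend (side S D))); [exact: complex_open_open|split|move=> ? []].
- by apply: (sub_nbhs (nonend (side S D))); [exact: complex_open_open|split|move=> ? []].
- apply: (sub_nbhs (Chat S w)); [exact: Chat_open|exact: Chat_end|].
  case=> [v|x t [_ [_]]|w' hw' v [r [wr [N [av c]]]]] /=; first exact: Dp.
    by case=> /Dp; [left|right].
  have [M hM] := hw' r wr.
  have /hM/Dp DM := leq_maxr N M.
  apply: (component_union_conn DS) DM; apply: conn_trans c; apply: conn_sym.
  have [r0 [_ _ hw]] := end_rays w'.
  by have [[_ ra] _] := (hw r).1 wr; apply: ray_conn => //; exact: leq_maxl.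
Qed.

(** The component of an end is connected in [G - S], so it lies in [D] or misses it. Only [S] itself
    and the edges inside [S] are left over. *)
Lemma side_cover S D p : finite_set S -> component_union S D ->
  [\/ side S D p, side S [set a | ~ S a /\ ~ D a] p,
      exists2 v, S v & p = PV v |
      exists x t, [/\ p = PE x t, S (src x) & S (tgt x)]].
Proof.
move=> fS DS; have DSC := component_unionC DS.
have dich v : S v \/ (D v \/ (~ S v /\ ~ D v)).
  by have [?|?] := pselect (S v); [left|have [?|?] := pselect (D v); right; [left|right]].
case: p => [v|x t|w].
- by case: (dich v) => [Sv|[Dv|Dv]]; [apply: Or43; exists v|apply: Or41|apply: Or42].
- case: (dich (src x)) => [Ss|[Dv|Dv]]; [|by apply: Or41; left|by apply: Or42; left].
  case: (dich (tgt x)) => [St|[Dv|Dv]]; [|by apply: Or41; right|by apply: Or42; right].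
  by apply: Or44; exists x, t.
- have [v Cv] := comp_of_nonempty w fS.
  case: (dich v) => [Sv|[Dv|Dv]]; first by case: (comp_of_notS Cv).
  + by apply: Or41 => u Cu; exact: component_union_conn DS (comp_of_conn fS Cv Cu) Dv.
  + by apply: Or42 => u Cu; exact: component_union_conn DSC (comp_of_conn fS Cv Cu) Dv.
Qed.

Lemma side_disjoint S D p : finite_set S -> component_union S D ->
  side S D p -> ~ side S [set a | ~ S a /\ ~ D a] p.
Proof.
move=> fS [DS cD]; case: p => [v|x t|w] /=.
- by move=> Dv [].
- case=> Dx [[nS nD]|[nS nD]] //; apply: nD; apply: cD Dx nS _; first exact: adj_edge.
  exact/adj_sym/adj_edge.
- by have [v Cv] := comp_of_nonempty w fS => /(_ v Cv) Dv /(_ v Cv) [].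
Qed.

End Ends.

Lemma connected_split (T : topologicalType) (A U V : set T) :
  connected A -> open U -> open V -> A `<=` U `|` V ->
  (forall p, A p -> U p -> ~ V p) -> (exists2 p, A p & U p) -> A `<=` U.
Proof.
move=> cA oU oV AUV dUV [p Ap Up].
have <- : A `&` U = A; last by move=> ? [].
apply: cA; first by exists p.
- by exists U.
- exists (~` V); first exact: open_closedC.
  apply/seteqP; split=> q [Aq]; last by move=> nV; split=> //; case: (AUV q Aq).
  by move=> Uq; split=> //; exact: dUV.
Qed.

(** * Points on a circle *)

(** Twice the signed area of the triangle [abc]. *)
Definition orient (a b c : R * R) : R :=
  (b.1 - a.1) * (c.2 - a.2) - (b.2 - a.2) * (c.1 - a.1).

(** The last two points lie strictly on opposite sides of the line through the first two; for
    distinct points of one circle this says that the pairs alternate. *)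
Definition separates (a c b d : R * R) : Prop := orient a c b * orient a c d < 0.

Definition sqdist (a b : R * R) : R := (b.1 - a.1) ^+ 2 + (b.2 - a.2) ^+ 2.

Lemma sqdist_gt0 a b : a <> b -> 0 < sqdist a b.
Proof.
move=> ab; rewrite lt_neqAle addr_ge0 ?sqr_ge0 // andbT eq_sym.
apply/negP; rewrite paddr_eq0 ?sqr_ge0 // !sqrf_eq0 !subr_eq0 => /andP[/eqP h1 /eqP h2].
by apply: ab; rewrite [a]surjective_pairing [b]surjective_pairing h1 h2.
Qed.

Section CirclePoints.
Variables (o : R * R) (rho : R).
Implicit Types a b c d : R * R.
Local Notation Sph := (sphere o rho).

Lemma orient_neq0 a b c : Sph a -> Sph b -> Sph c ->
  a <> b -> b <> c -> a <> c -> orient a b c != 0.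
Proof.
move=> Sa Sb Sc ab bc ac; apply/negP => /eqP D0.
have pab := sqdist_gt0 ab; have pac := sqdist_gt0 ac; have := sqdist_gt0 bc.
suff -> : sqdist b c = 0 by rewrite ltxx.
(* For parallel [p = b - a] and [q = c - a] one has [P q = k p]. Inserted in the circle equations
   [e1], [e2] this gives [P Q = k P], and also [k ^ 2 = P Q]; together [P Q (P + Q - 2 k) = 0],
   whose last factor is the squared distance of [b] and [c]. *)
have h : sqdist a b * sqdist a c * sqdist b c = 0.
  move: Sa Sb Sc D0; rewrite /sphere /orient /sqdist /=.
  move=> Sa Sb Sc D0.
  have e1 : 2 * ((a.1 - o.1) * (b.1 - a.1) + (a.2 - o.2) * (b.2 - a.2)) =
            - ((b.1 - a.1) ^+ 2 + (b.2 - a.2) ^+ 2).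
    by transitivity ((b.1 - o.1) ^+ 2 + (b.2 - o.2) ^+ 2 - ((a.1 - o.1) ^+ 2 + (a.2 - o.2) ^+ 2)
       - ((b.1 - a.1) ^+ 2 + (b.2 - a.2) ^+ 2)); [ring|rewrite Sa Sb subrr sub0r].
  have e2 : 2 * ((a.1 - o.1) * (c.1 - a.1) + (a.2 - o.2) * (c.2 - a.2)) =
            - ((c.1 - a.1) ^+ 2 + (c.2 - a.2) ^+ 2).
    by transitivity ((c.1 - o.1) ^+ 2 + (c.2 - o.2) ^+ 2 - ((a.1 - o.1) ^+ 2 + (a.2 - o.2) ^+ 2)
       - ((c.1 - a.1) ^+ 2 + (c.2 - a.2) ^+ 2)); [ring|rewrite Sa Sc subrr sub0r].
  move: e1 e2 D0 {Sa Sb Sc}.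
  set A1 := a.1 - o.1; set A2 := a.2 - o.2.
  have -> : c.1 - b.1 = (c.1 - a.1) - (b.1 - a.1) by ring.
  have -> : c.2 - b.2 = (c.2 - a.2) - (b.2 - a.2) by ring.
  set p1 := b.1 - a.1; set p2 := b.2 - a.2; set q1 := c.1 - a.1; set q2 := c.2 - a.2.
  move=> e1 e2 D0.
  have f1 : (p1 ^+ 2 + p2 ^+ 2) * q1 = (p1 * q1 + p2 * q2) * p1 - (p1 * q2 - p2 * q1) * p2 by ring.
  have f2 : (p1 ^+ 2 + p2 ^+ 2) * q2 = (p1 * q1 + p2 * q2) * p2 + (p1 * q2 - p2 * q1) * p1 by ring.
  rewrite D0 mul0r subr0 in f1; rewrite D0 mul0r addr0 in f2.
  set P := p1 ^+ 2 + p2 ^+ 2 in e1 f1 f2 *; set Q := q1 ^+ 2 + q2 ^+ 2 in e2 *.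
  set k := p1 * q1 + p2 * q2 in f1 f2.
  have h1 : P * Q = k * P.
    have -> : k * P = - (k * - P) by ring.
    rewrite -e1; have -> : P * Q = - (P * - Q) by ring.
    rewrite -e2; congr (- _).
    have -> : P * (2 * (A1 * q1 + A2 * q2)) = 2 * (A1 * (P * q1) + A2 * (P * q2)) by ring.
    by rewrite f1 f2; ring.
  have h2 : k ^+ 2 = P * Q.
    have -> : P * Q = k ^+ 2 + (p1 * q2 - p2 * q1) ^+ 2 by rewrite /P /Q /k; ring.
    by rewrite D0 expr0n addr0.
  have -> : (q1 - p1) ^+ 2 + (q2 - p2) ^+ 2 = P + Q - 2 * k by rewrite /P /Q /k; ring.
  have -> : P * Q * (P + Q - 2 * k) = P * (P * Q) + (P * Q) * Q - 2 * k * (P * Q) by ring.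
  have h3 : P * Q * Q = k * k ^+ 2 by rewrite {1}h1 -mulrA -h2.
  rewrite h3 -h2; have -> : P * k ^+ 2 = k * (k * P) by ring.
  by rewrite -h1 -h2; ring.
move: h => /eqP; rewrite !mulf_eq0 (gt_eqF pab) (gt_eqF pac) /= => /eqP //.
Qed.

(* The affine dependence of four points, evaluated on the squared distance to one of them. *)
Lemma circle_dependence a b c d : Sph a -> Sph b -> Sph c -> Sph d ->
  - orient a c d * sqdist a b + orient a b d * sqdist a c - orient a b c * sqdist a d = 0.
Proof.
rewrite /sphere /orient /sqdist /=.
move=> Sa Sb Sc Sd.
have key p1 p2 : (p1 - o.1) ^+ 2 + (p2 - o.2) ^+ 2 = rho ^+ 2 ->
   (p1 - a.1) ^+ 2 + (p2 - a.2) ^+ 2 = - (2 * ((p1 - a.1) * (a.1 - o.1) + (p2 - a.2) * (a.2 - o.2))).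
  move=> Sp; transitivity ((p1 - o.1) ^+ 2 + (p2 - o.2) ^+ 2 - ((a.1 - o.1) ^+ 2 + (a.2 - o.2) ^+ 2)
     - (2 * ((p1 - a.1) * (a.1 - o.1) + (p2 - a.2) * (a.2 - o.2)))); first ring.
  by rewrite Sp Sa; ring.
by rewrite (key b.1 b.2) // (key c.1 c.2) // (key d.1 d.2) //; ring.
Qed.

(** Coefficients of one sign at [b], [c], [d] would make [a] a convex combination of them, which a
    point of the same circle cannot be. *)
Lemma orient_mixed a b c d : Sph a -> Sph b -> Sph c -> Sph d ->
  a <> b -> a <> c -> a <> d ->
  0 < - orient a c d -> 0 < orient a b d -> 0 < - orient a b c -> False.
Proof.
move=> Sa Sb Sc Sd ab ac ad h1 h2 h3.
have := circle_dependence Sa Sb Sc Sd.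
have p1 := mulr_gt0 h1 (sqdist_gt0 ab); have p2 := mulr_gt0 h2 (sqdist_gt0 ac).
have p3 := mulr_gt0 h3 (sqdist_gt0 ad); lra.
Qed.

Lemma orient_mixedN a b c d : Sph a -> Sph b -> Sph c -> Sph d ->
  a <> b -> a <> c -> a <> d ->
  - orient a c d < 0 -> orient a b d < 0 -> - orient a b c < 0 -> False.
Proof.
move=> Sa Sb Sc Sd ab ac ad h1 h2 h3.
have := circle_dependence Sa Sb Sc Sd.
have q1 : 0 < orient a c d * sqdist a b by apply: mulr_gt0; [lra|exact: sqdist_gt0].
have q2 : 0 < - orient a b d * sqdist a c by apply: mulr_gt0; [lra|exact: sqdist_gt0].
have q3 : 0 < orient a b c * sqdist a d by apply: mulr_gt0; [lra|exact: sqdist_gt0].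
lra.
Qed.

Lemma mul_lt0P (x y : R) : x * y < 0 -> (x < 0 /\ 0 < y) \/ (0 < x /\ y < 0).
Proof.
case: (ltrgt0P x) => [x0|x0|->]; last by rewrite mul0r ltxx.
- by rewrite pmulr_rlt0 //; right.
- by rewrite nmulr_rlt0 //; left.
Qed.

(** If the line [ac] separates [b] from [d] but the line [bd] does not separate [a] from [c], then
    [a] or [c] lies inside the triangle of the other three, contrary to [orient_mixed] or
    [orient_mixedN] at that point. *)
Lemma separates_sym a b c d : Sph a -> Sph b -> Sph c -> Sph d ->
  a <> b -> a <> c -> a <> d -> b <> c -> b <> d -> c <> d ->
  separates a c b d -> separates b d a c.
Proof.
move=> Sa Sb Sc Sd ab ac ad bc bd cd.
have nbcd := orient_neq0 Sb Sc Sd bc cd bd.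
have nabd := orient_neq0 Sa Sb Sd ab bd ad.
have ba := not_eq_sym ab; have ca := not_eq_sym ac; have da := not_eq_sym ad.
have cb := not_eq_sym bc; have db := not_eq_sym bd; have dc := not_eq_sym cd.
have A1 := orient_mixed Sa Sb Sc Sd ab ac ad.
have A2 := orient_mixedN Sa Sb Sc Sd ab ac ad.
have C1 := orient_mixed Sc Sb Sa Sd cb ca cd.
have C2 := orient_mixedN Sc Sb Sa Sd cb ca cd.
move: A1 A2 C1 C2 nbcd nabd; rewrite /separates.
have -> : orient c a d = - orient a c d by rewrite /orient; ring.
have -> : orient c b d = - orient b c d by rewrite /orient; ring.
have -> : orient c b a = - orient a b c by rewrite /orient; ring.
have -> : orient a c b = - orient a b c by rewrite /orient; ring.
have -> : orient b d a = orient a b d by rewrite /orient; ring.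
have -> : orient b d c = - orient b c d by rewrite /orient; ring.
move: (orient a b c) (orient a b d) (orient a c d) (orient b c d) => u v x y.
move=> A1 A2 C1 C2 ny nv /mul_lt0P h; rewrite mulrN oppr_lt0.
case: (ltrgt0P v) nv => // hv _; case: (ltrgt0P y) ny => // hy _.
- exact: mulr_gt0.
- by exfalso; case: h => -[h1 h2]; [apply: C2|apply: A1]; lra.
- by exfalso; case: h => -[h1 h2]; [apply: A2|apply: C1]; lra.
- by rewrite nmulr_rgt0.
Qed.

(** The three products that define the three separations multiply to minus a nonzero square, so one
    of them is negative. *)
Lemma separates_exists a b c d : Sph a -> Sph b -> Sph c -> Sph d ->
  a <> b -> a <> c -> a <> d -> b <> c -> b <> d -> c <> d ->
  [\/ separates a b c d, separates a c b d | separates a d b c].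
Proof.
move=> Sa Sb Sc Sd ab ac ad bc bd cd.
have := orient_neq0 Sa Sb Sc ab bc ac.
have := orient_neq0 Sa Sb Sd ab bd ad.
have := orient_neq0 Sa Sc Sd ac cd ad.
rewrite /separates.
have -> : orient a c b = - orient a b c by rewrite /orient; ring.
have -> : orient a d b = - orient a b d by rewrite /orient; ring.
have -> : orient a d c = - orient a c d by rewrite /orient; ring.
move: (orient a b c) (orient a b d) (orient a c d) => u v x.
case: (ltrgt0P x) => // hx _; case: (ltrgt0P v) => // hv _; case: (ltrgt0P u) => // hu _;
 first [by apply: Or31; nra|by apply: Or32; nra|by apply: Or33; nra].
Qed.

End CirclePoints.

Section RealContinuity.
Variables (T : topologicalType) (f g : T -> R).
Hypotheses (cf : continuous f) (cg : continuous g).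

Lemma continuous_funD : continuous (fun z => f z + g z).
Proof. by move=> z; apply: (@continuousD R R^o T f g); [exact: cf|exact: cg]. Qed.

Lemma continuous_funB : continuous (fun z => f z - g z).
Proof. by move=> z; apply: (@continuousB R R^o T f g); [exact: cf|exact: cg]. Qed.

Lemma continuous_funM : continuous (fun z => f z * g z).
Proof. by move=> z; apply: (@continuousM R T f g); [exact: cf|exact: cg]. Qed.

Lemma continuous_pair : continuous (fun z => (f z, g z)).
Proof. by move=> z; exact: (cvg_pair (@cf z) (@cg z)). Qed.

Lemma continuous_funcomp (h : R -> R) : continuous h -> continuous (fun z => h (f z)).
Proof. by move=> ch z; apply: continuous_comp; [exact: cf|exact: ch]. Qed.

End RealContinuity.

Lemma continuous_const (T : topologicalType) (c : R) : continuous (fun _ : T => c).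
Proof. exact: cst_continuous. Qed.

(** * Crossing paths in a disk *)

(** A winding number mod 2. [Y] stands for the sign of the ordinate and [X] for that of the
    abscissa, so [H] and [V] count crossings of the positive x-axis along grid edges; each inner
    edge belongs to two cells and cancels. *)
Lemma grid_parity (Y X : nat -> nat -> bool) (n : nat) :
  let H i j := (Y i j (+) Y i.+1 j) && X i j in
  let V i j := (Y i j (+) Y i j.+1) && X i j in
  (forall i j, (i < n)%N -> (j < n)%N ->
     H i j (+) V i.+1 j (+) H i j.+1 (+) V i j = false) ->
  \big[addb/false]_(i < n) H i 0 (+) \big[addb/false]_(i < n) H i n =
  \big[addb/false]_(j < n) V 0 j (+) \big[addb/false]_(j < n) V n j.
Proof.
move=> H V cell.
have aux1 (A B v0 vk vk1 a b : bool) : A (+) B = v0 (+) vk ->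
    a (+) vk1 (+) b (+) vk = false -> (A (+) a) (+) (B (+) b) = v0 (+) vk1.
  by case: A; case: B; case: v0; case: vk; case: vk1; case: a; case: b.
have aux2 (A B D E F v0 vn : bool) : A (+) B = D (+) E -> B (+) F = v0 (+) vn ->
    A (+) F = (D (+) v0) (+) (E (+) vn).
  by case: A; case: B; case: D; case: E; case: F; case: v0; case: vn.
have row j : (j < n)%N -> \big[addb/false]_(i < n) H i j (+)
    \big[addb/false]_(i < n) H i j.+1 = V 0 j (+) V n j.
  move=> jn; suff : forall k, (k <= n)%N -> \big[addb/false]_(i < k) H i j (+)
    \big[addb/false]_(i < k) H i j.+1 = V 0 j (+) V k j by move/(_ n (leqnn n)).
  elim=> [|k IH] kn; first by rewrite !big_ord0 !addbb.
  by rewrite !big_ord_recr; exact: aux1 (IH (ltnW kn)) (cell k j kn jn).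
suff : forall k, (k <= n)%N -> \big[addb/false]_(i < n) H i 0 (+)
    \big[addb/false]_(i < n) H i k =
  \big[addb/false]_(j < k) V 0 j (+) \big[addb/false]_(j < k) V n j by move/(_ n (leqnn n)).
elim=> [|k IH] kn; first by rewrite !big_ord0 !addbb.
rewrite !big_ord_recr; exact: aux2 (IH (ltnW kn)) (row k kn).
Qed.

(** Both vectors lie in a common open coordinate half-plane. If the ordinate changes sign, the
    abscissa therefore keeps its sign, which is why reading [X] at one end of a grid edge
    suffices. *)
Definition same_side (x y x' y' : R) :=
  [\/ 0 < x /\ 0 < x', x < 0 /\ x' < 0, 0 < y /\ 0 < y' | y < 0 /\ y' < 0].

(** On the x-axis the half-plane reads [p x > 0], so a segment inside it crosses the axis on the
    side given by the sign of [p]. Up to a positive factor, [x2 * y1 + x1 * - y2] is the abscissa of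
    the crossing. *)
Lemma halfplane_crossing (p k x1 y1 x2 y2 : R) : same_side x1 y1 x2 y2 ->
  0 < p * x1 + k * y1 -> 0 < p * x2 + k * y2 -> 0 <= y1 -> y2 < 0 ->
  (0 < x1) = (0 < p) /\ (0 < x2) = (0 < p).
Proof.
move=> ss h1 h2 y10 y20.
have det : 0 < p * (x2 * y1 + x1 * - y2).
  have -> : p * (x2 * y1 + x1 * - y2) =
    (p * x1 + k * y1) * - y2 + (p * x2 + k * y2) * y1 by ring.
  by apply: ltr_wpDr; [apply: mulr_ge0 => //; exact: ltW|apply: mulr_gt0 => //; rewrite oppr_gt0].
case: ss => -[a1 a2].
- have d0 : 0 < x2 * y1 + x1 * - y2.
    by apply: ltr_wpDl; [apply: mulr_ge0 => //; exact: ltW|apply: mulr_gt0 => //; rewrite oppr_gt0].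
  by move: det; rewrite a1 a2 pmulr_lgt0 // => ->.
- have d0 : x2 * y1 + x1 * - y2 < 0.
    by apply: ltr_wnDl; [apply: mulr_le0_ge0 => //; exact: ltW|rewrite nmulr_rlt0 // oppr_gt0].
  by move: det; rewrite (lt_gtF a1) (lt_gtF a2) nmulr_lgt0 // => /lt_gtF ->.
- by move: a2; rewrite (lt_gtF y20).
- by move: y10; rewrite leNgt a1.
Qed.

Lemma same_side_sym x y x' y' : same_side x y x' y' -> same_side x' y' x y.
Proof. by case=> -[? ?]; [apply: Or41|apply: Or42|apply: Or43|apply: Or44]. Qed.

(* A path in the half-plane [p x + k y > 0] meets the positive x-axis, counted mod 2,
   according to the sides of its ends if that ray lies in the half-plane and never otherwise. *)
Lemma halfplane_parity (x y : nat -> R) (p k : R) (n : nat) :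
  (forall j, (j < n)%N -> same_side (x j) (y j) (x j.+1) (y j.+1)) ->
  (forall j, 0 < p * x j + k * y j) ->
  \big[addb/false]_(j < n) (((0 <= y j) (+) (0 <= y j.+1)) && (0 < x j)) =
  (0 < p) && ((0 <= y 0%N) (+) (0 <= y n)).
Proof.
move=> ss hp; elim: n ss => [|n IH] ss; first by rewrite big_ord0 addbb andbF.
rewrite big_ord_recr /= IH; last by move=> j jn; apply: ss; exact: ltnW.
suff -> : ((0 <= y n) (+) (0 <= y n.+1)) && (0 < x n) =
          (0 < p) && ((0 <= y n) (+) (0 <= y n.+1)).
  by case: (0 < p) => //=; rewrite -addbA (addbA (0 <= y n)) addbb.
have ssn := ss n (leqnn _).
case: (lerP 0 (y n)) => hy1; case: (lerP 0 (y n.+1)) => hy2 //=; rewrite ?andbF // andbT.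
- by have [-> _] := halfplane_crossing ssn (hp n) (hp n.+1) hy1 hy2.
- by have [_ ->] := halfplane_crossing (same_side_sym ssn) (hp n.+1) (hp n) hy2 hy1.
Qed.

Definition box (n : nat) (z : R * R) : set (R * R) :=
  [set z' | `|z'.1 - z.1| <= n.+1%:R^-1 /\ `|z'.2 - z.2| <= n.+1%:R^-1].

Lemma near_box (U : set (R * R)) (z0 : R * R) : open U -> U z0 ->
  \forall z \near z0 & n \near \oo, box n z `<=` U.
Proof.
move=> oU Uz0; have /nbhs_ballP [e /= e0 he] : nbhs z0 U by exact: open_nbhs_nbhs.
have e20 : 0 < e / 2 by apply: divr_gt0.
near=> z n => z' [h1 h2]; apply: he.
have [z1 z2] : ball z0 (e / 2) z by near: z; exact: nbhsx_ballx.
have hn : n.+1%:R^-1 < e / 2 by near: n; exact: near_infty_natSinv_lt (PosNum e20).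
move: z1 z2; rewrite /ball /= => z1 z2; split => /=.
- change (`|z0.1 - z'.1| < e); have -> : z0.1 - z'.1 = (z0.1 - z.1) - (z'.1 - z.1) by ring.
  apply: le_lt_trans (ler_normB _ _) _; rewrite [e]splitr.
  by apply: ltrD => //; apply: le_lt_trans hn.
- change (`|z0.2 - z'.2| < e); have -> : z0.2 - z'.2 = (z0.2 - z.2) - (z'.2 - z.2) by ring.
  apply: le_lt_trans (ler_normB _ _) _; rewrite [e]splitr.
  by apply: ltrD => //; apply: le_lt_trans hn.
Unshelve. all: by end_near. Qed.

(** A Lebesgue number: near each point one coordinate keeps its sign, and compactness of the square
    makes the size uniform. This fixes the mesh of the grid. *)
Lemma box_same_side (X Y : R * R -> R) : continuous X -> continuous Y ->
  (forall z, X z <> 0 \/ Y z <> 0) ->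
  exists n, forall s t, 0 <= s <= 1 -> 0 <= t <= 1 ->
    [\/ forall z, box n (s, t) z -> 0 < X z, forall z, box n (s, t) z -> X z < 0,
        forall z, box n (s, t) z -> 0 < Y z | forall z, box n (s, t) z -> Y z < 0].
Proof.
move=> cX cY nz.
have : compact (`[(0 : R), 1]%classic `*` `[(0 : R), 1]%classic).
  by apply: compact_setX; exact: segment_compact.
move=> /compact_near_coveringP.
pose P (n : nat) z :=
    [\/ forall z', box n z z' -> 0 < X z', forall z', box n z z' -> X z' < 0,
        forall z', box n z z' -> 0 < Y z' | forall z', box n z z' -> Y z' < 0].
move=> /(_ nat \oo P _) []; last first.
  move=> n _ /(_ n (leqnn n)) hn; exists n => s t s01 t01.
  by apply: hn; split; rewrite /= in_itv.
move=> z0 _.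
have opos (Z : R * R -> R) : continuous Z -> open [set z | 0 < Z z].
  by move=> cZ; apply: (@open_comp _ _ Z [set x | 0 < x]) => [z _|]; [exact: cZ|exact: open_gt].
have oneg (Z : R * R -> R) : continuous Z -> open [set z | Z z < 0].
  by move=> cZ; apply: (@open_comp _ _ Z [set x | x < 0]) => [z _|]; [exact: cZ|exact: open_lt].
case: (nz z0) => /eqP; case: ltrgt0P => // h _.
- by apply: filterS (near_box (opos X cX) h) => -[z n] /= sub; apply: Or41 => z1 /sub.
- by apply: filterS (near_box (oneg X cX) h) => -[z n] /= sub; apply: Or42 => z1 /sub.
- by apply: filterS (near_box (opos Y cY) h) => -[z n] /= sub; apply: Or43 => z1 /sub.
- by apply: filterS (near_box (oneg Y cY) h) => -[z n] /= sub; apply: Or44 => z1 /sub.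
Qed.

(** The tangent at [a] supports the disk and touches it only in [a]. *)
Lemma disk_supporting (o : R * R) (rho : R) (a b : R * R) : sphere o rho a -> disk o rho b ->
  a <> b -> 0 < (a.1 - o.1) * (a.1 - b.1) + (a.2 - o.2) * (a.2 - b.2).
Proof.
rewrite /sphere /disk /= => Sa Db ab; have := sqdist_gt0 ab; rewrite /sqdist => h.
have -> : (a.1 - o.1) * (a.1 - b.1) + (a.2 - o.2) * (a.2 - b.2) =
  ((((a.1 - o.1) ^+ 2 + (a.2 - o.2) ^+ 2) - ((b.1 - o.1) ^+ 2 + (b.2 - o.2) ^+ 2)) +
   ((b.1 - a.1) ^+ 2 + (b.2 - a.2) ^+ 2)) / 2 by field.
rewrite Sa; apply: divr_gt0 => //; lra.
Qed.

Lemma disk_supportingN (o : R * R) (rho : R) (a b : R * R) : sphere o rho a -> disk o rho b ->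
  a <> b -> 0 < - (a.1 - o.1) * (b.1 - a.1) + - (a.2 - o.2) * (b.2 - a.2).
Proof.
move=> Sa Db ab; have := disk_supporting Sa Db ab.
by rewrite -[a.1 - b.1]opprB -[a.2 - b.2]opprB !mulrN !mulNr.
Qed.

Section Crossing.
Variables (f h : R -> R * R) (o : R * R) (rho : R).
Hypotheses (cf : continuous f) (ch : continuous h).
Hypotheses (Df : forall t, disk o rho (f t)) (Dh : forall t, disk o rho (h t)).
Hypotheses (S0 : sphere o rho (f 0)) (S1 : sphere o rho (f 1)).
Hypotheses (T0 : sphere o rho (h 0)) (T1 : sphere o rho (h 1)).
Hypothesis sep : separates (f 0) (f 1) (h 0) (h 1).
Hypothesis disj : forall s t, f s <> h t.

(** [(X, Y)] is, up to scaling, the vector [f s - h t] in the frame whose positive x-axis points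
    along [f 0 - f 1]. For disjoint paths it never vanishes, so its winding around the parameter
    square is even; the four sides are shown to give an odd count. *)
Let u1 := (f 0).1 - (f 1).1.
Let u2 := (f 0).2 - (f 1).2.
Let X (z : R * R) := u1 * ((f z.1).1 - (h z.2).1) + u2 * ((f z.1).2 - (h z.2).2).
Let Y (z : R * R) := u1 * ((f z.1).2 - (h z.2).2) - u2 * ((f z.1).1 - (h z.2).1).

Let f01 : f 0 <> f 1.
Proof.
by move=> e; move: sep; rewrite /separates /orient e !subrr !mul0r subrr mul0r ltxx.
Qed.

Let u_gt0 : 0 < u1 ^+ 2 + u2 ^+ 2.
Proof. by have := sqdist_gt0 (not_eq_sym f01). Qed.

Let XY_neq0 z : X z <> 0 \/ Y z <> 0.
Proof.
have [X0|] := eqVneq (X z) 0; last by move/eqP; left.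
have [Y0|] := eqVneq (Y z) 0; last by move/eqP; right.
exfalso; apply: (@disj z.1 z.2).
have e1 : (u1 ^+ 2 + u2 ^+ 2) * ((f z.1).1 - (h z.2).1) = 0.
  by transitivity (u1 * X z - u2 * Y z); [rewrite /X /Y; ring|rewrite X0 Y0; ring].
have e2 : (u1 ^+ 2 + u2 ^+ 2) * ((f z.1).2 - (h z.2).2) = 0.
  by transitivity (u2 * X z + u1 * Y z); [rewrite /X /Y; ring|rewrite X0 Y0; ring].
move/eqP: e1; rewrite mulf_eq0 gt_eqF //= subr_eq0 => /eqP e1.
move/eqP: e2; rewrite mulf_eq0 gt_eqF //= subr_eq0 => /eqP e2.
by rewrite [f _]surjective_pairing [h _]surjective_pairing e1 e2.
Qed.

Let coords_continuous :
  [/\ continuous (fun z : R * R => (f z.1).1), continuous (fun z : R * R => (f z.1).2),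
      continuous (fun z : R * R => (h z.2).1) & continuous (fun z : R * R => (h z.2).2)].
Proof.
have cf1 : continuous (fun z : R * R => f z.1).
  by move=> z; apply: continuous_comp; [exact: cvg_fst|exact: cf].
have ch1 : continuous (fun z : R * R => h z.2).
  by move=> z; apply: continuous_comp; [exact: cvg_snd|exact: ch].
split=> z.
- by apply: (@continuous_comp _ _ _ (fun z : R * R => f z.1) fst); [exact: cf1|exact: cvg_fst].
- by apply: (@continuous_comp _ _ _ (fun z : R * R => f z.1) snd); [exact: cf1|exact: cvg_snd].
- by apply: (@continuous_comp _ _ _ (fun z : R * R => h z.2) fst); [exact: ch1|exact: cvg_fst].
- by apply: (@continuous_comp _ _ _ (fun z : R * R => h z.2) snd); [exact: ch1|exact: cvg_snd].
Qed.

Let X_continuous : continuous X.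
Proof.
have [c1 c2 c3 c4] := coords_continuous; rewrite /X.
apply: continuous_funD; apply: continuous_funM; try exact: continuous_const.
- exact: continuous_funB.
- exact: continuous_funB.
Qed.

Let Y_continuous : continuous Y.
Proof.
have [c1 c2 c3 c4] := coords_continuous; rewrite /Y.
apply: continuous_funB; apply: continuous_funM; try exact: continuous_const.
- exact: continuous_funB.
- exact: continuous_funB.
Qed.

Lemma crossing_paths : False.
Proof.
have [m hm] := box_same_side X_continuous Y_continuous XY_neq0.
pose n := m.+1; pose pt (i j : nat) : R * R := (i%:R / n%:R, j%:R / n%:R).
have n0 : 0 < n%:R :> R by rewrite ltr0n.
have in01 i : (i <= n)%N -> 0 <= (i%:R / n%:R : R) <= 1.
  by move=> ile; rewrite divr_ge0 ?ler0n //= ler_pdivrMr // mul1r ler_nat.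
have step i : `|(i.+1%:R / n%:R : R) - i%:R / n%:R| <= n%:R^-1.
  by rewrite -mulrBl -natrB // subSnn mul1r ger0_norm // invr_ge0 ltW.
have here (r : R) : `|r - r| <= n%:R^-1 by rewrite subrr normr0 invr_ge0 ltW.
have inbox i j i' j' : (i' == i) || (i' == i.+1) -> (j' == j) || (j' == j.+1) ->
    box m (i%:R / n%:R, j%:R / n%:R) (pt i' j').
  by move=> hi hj; split=> /=; [case/orP: hi|case/orP: hj] => /eqP ->.
have ss i j i' j' : (i <= n)%N -> (j <= n)%N ->
    (i' == i) || (i' == i.+1) -> (j' == j) || (j' == j.+1) ->
    same_side (X (pt i j)) (Y (pt i j)) (X (pt i' j')) (Y (pt i' j')).
  move=> il jl hi hj; have b1 := inbox i j i' j' hi hj.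
  have b2 : box m (i%:R / n%:R, j%:R / n%:R) (pt i j) by apply: inbox; rewrite eqxx.
  by case: (hm _ _ (in01 i il) (in01 j jl)) => hh;
    [apply: Or41|apply: Or42|apply: Or43|apply: Or44]; split; exact: hh.
have := @grid_parity (fun i j => 0 <= Y (pt i j)) (fun i j => 0 < X (pt i j)) n.
have pt0 : 0%:R / n%:R = 0 :> R by rewrite mul0r.
have pt1 : n%:R / n%:R = 1 :> R by rewrite divff // gt_eqF.
(* Rewrites the half-plane with normal [(n1, n2)] in the frame of [X] and [Y]. *)
have proj (n1 n2 : R) z : 0 < n1 * ((f z.1).1 - (h z.2).1) + n2 * ((f z.1).2 - (h z.2).2) ->
    0 < (n1 * u1 + n2 * u2) * X z + (u1 * n2 - u2 * n1) * Y z.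
  move=> h0; have -> : (n1 * u1 + n2 * u2) * X z + (u1 * n2 - u2 * n1) * Y z =
    (u1 ^+ 2 + u2 ^+ 2) * (n1 * ((f z.1).1 - (h z.2).1) + n2 * ((f z.1).2 - (h z.2).2)).
    by rewrite /X /Y; ring.
  exact: mulr_gt0.
(* [Y] has the same value at both corners of this side, since [f 0 - f 1] is horizontal in the
   frame; the count is even whichever half-plane the side lies in. The side [t = 1] is alike. *)
have bottom : \big[addb/false]_(i < n) (((0 <= Y (pt i 0)) (+) (0 <= Y (pt i.+1 0))) && (0 < X (pt i 0))) = false.
  rewrite (@halfplane_parity (fun i => X (pt i 0)) (fun i => Y (pt i 0))
     (- ((h 0).1 - o.1) * u1 + - ((h 0).2 - o.2) * u2)
     (u1 * - ((h 0).2 - o.2) - u2 * - ((h 0).1 - o.1))).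
  - suff -> : Y (pt 0 0) = Y (pt n 0) by rewrite addbb andbF.
    by rewrite /Y /pt /= pt0 pt1 /u1 /u2; ring.
  - by move=> j jn; apply: (ss j 0%N); rewrite ?eqxx ?orbT // ltnW.
  - move=> j; apply: proj; rewrite /pt /= pt0.
    exact: disk_supportingN T0 (Df _) (not_eq_sym (@disj _ _)).
have top : \big[addb/false]_(i < n) (((0 <= Y (pt i n)) (+) (0 <= Y (pt i.+1 n))) && (0 < X (pt i n))) = false.
  rewrite (@halfplane_parity (fun i => X (pt i n)) (fun i => Y (pt i n))
     (- ((h 1).1 - o.1) * u1 + - ((h 1).2 - o.2) * u2)
     (u1 * - ((h 1).2 - o.2) - u2 * - ((h 1).1 - o.1))).
  - suff -> : Y (pt 0 n) = Y (pt n n) by rewrite addbb andbF.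
    by rewrite /Y /pt /= pt0 pt1 /u1 /u2; ring.
  - by move=> j jn; apply: (ss j n); rewrite ?eqxx ?orbT // ltnW.
  - move=> j; apply: proj; rewrite /pt /= pt1.
    exact: disk_supportingN T1 (Df _) (not_eq_sym (@disj _ _)).
(* The odd side: the supporting half-plane at [f 0] contains [f 0 - f 1], hence the positive x-axis,
   and [sep] says that [Y] changes sign between the corners. *)
have left : \big[addb/false]_(j < n) (((0 <= Y (pt 0 j)) (+) (0 <= Y (pt 0 j.+1))) && (0 < X (pt 0 j))) = true.
  rewrite (@halfplane_parity (fun j => X (pt 0 j)) (fun j => Y (pt 0 j))
     (((f 0).1 - o.1) * u1 + ((f 0).2 - o.2) * u2)
     (u1 * ((f 0).2 - o.2) - u2 * ((f 0).1 - o.1))).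
  - have -> /= : 0 < ((f 0).1 - o.1) * u1 + ((f 0).2 - o.2) * u2.
      exact: disk_supporting S0 (Df 1) f01.
    move: sep; rewrite /separates.
    have -> : orient (f 0) (f 1) (h 0) = Y (pt 0 0).
      by rewrite /orient /Y /pt /= pt0 /u1 /u2; ring.
    have -> : orient (f 0) (f 1) (h 1) = Y (pt 0 n).
      by rewrite /orient /Y /pt /= pt0 pt1 /u1 /u2; ring.
    by move/mul_lt0P => -[[y1 y2]|[y1 y2]];
      [rewrite (lt_geF y1) (ltW y2)|rewrite (ltW y1) (lt_geF y2)].
  - by move=> j jn; apply: (ss 0%N j); rewrite ?eqxx ?orbT // ltnW.
  - move=> j; apply: proj; rewrite /pt /= pt0.
    exact: disk_supporting S0 (Dh _) (@disj _ _).
(* The half-plane at [f 1] contains [f 1 - f 0] instead, so it misses the positive x-axis and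
   nothing is counted. *)
have right : \big[addb/false]_(j < n) (((0 <= Y (pt n j)) (+) (0 <= Y (pt n j.+1))) && (0 < X (pt n j))) = false.
  rewrite (@halfplane_parity (fun j => X (pt n j)) (fun j => Y (pt n j))
     (((f 1).1 - o.1) * u1 + ((f 1).2 - o.2) * u2)
     (u1 * ((f 1).2 - o.2) - u2 * ((f 1).1 - o.1))).
  - suff -> : 0 < ((f 1).1 - o.1) * u1 + ((f 1).2 - o.2) * u2 = false by [].
    have := disk_supportingN S1 (Df 0) (not_eq_sym f01).
    by rewrite !mulNr -opprD oppr_gt0 => /lt_gtF.
  - by move=> j jn; apply: (ss n j); rewrite ?eqxx ?orbT // ltnW.
  - move=> j; apply: proj; rewrite /pt /= pt1.
    exact: disk_supporting S1 (Dh _) (@disj _ _).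
rewrite /= bottom top left right => cell.
suff : false (+) false = true (+) false by [].
apply: cell => i j il jl.
have b00 : box m (i%:R / n%:R, j%:R / n%:R) (pt i j) by apply: inbox; rewrite eqxx.
have b10 : box m (i%:R / n%:R, j%:R / n%:R) (pt i.+1 j) by apply: inbox; rewrite eqxx ?orbT.
have b01 : box m (i%:R / n%:R, j%:R / n%:R) (pt i j.+1) by apply: inbox; rewrite eqxx ?orbT.
have b11 : box m (i%:R / n%:R, j%:R / n%:R) (pt i.+1 j.+1) by apply: inbox; rewrite eqxx ?orbT.
case: (hm _ _ (in01 i (ltnW il)) (in01 j (ltnW jl))) => hh.
- rewrite !hh // !andbT.
  by do 4!case: (0 <= Y _).
- by rewrite !(lt_gtF (hh _ _)) // !andbF.
- by rewrite !(ltW (hh _ _)).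
- by rewrite !(lt_geF (hh _ _)).
Qed.

End Crossing.

(** * Circles *)

(* Stereographic projection from [a], rotated so that [a] becomes the point at infinity. *)
Definition stereo (a : R * R) (t : R) : R * R :=
  (a.1 * ((t ^+ 2 - 1) / (1 + t ^+ 2)) - a.2 * (2 * t / (1 + t ^+ 2)),
   a.1 * (2 * t / (1 + t ^+ 2)) + a.2 * ((t ^+ 2 - 1) / (1 + t ^+ 2))).

Lemma S1E p : S1 p <-> p.1 ^+ 2 + p.2 ^+ 2 = 1.
Proof. by rewrite /S1 /sphere /= !subr0 expr1n. Qed.

Lemma one_sqr_gt0 (t : R) : 0 < 1 + t ^+ 2.
Proof. by apply: ltr_pwDl => //; exact: sqr_ge0. Qed.

Lemma stereo_S1 a t : S1 a -> S1 (stereo a t) /\ stereo a t <> a.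
Proof.
move=> /S1E Sa; have t0 := one_sqr_gt0 t; have t0' : 1 + t ^+ 2 != 0 by rewrite gt_eqF.
split.
  apply/S1E => /=; transitivity (a.1 ^+ 2 + a.2 ^+ 2) => //; by field.
move=> e; have e1 := congr1 fst e; have e2 := congr1 snd e; move: e1 e2 => /= e1 e2.
have h : a.1 * a.1 + a.2 * a.2 = (t ^+ 2 - 1) / (1 + t ^+ 2) * (a.1 ^+ 2 + a.2 ^+ 2).
  rewrite -{2}e1 -{3}e2; ring.
move: h; rewrite -!expr2 Sa mulr1 => /esym h.
have : (t ^+ 2 - 1) / (1 + t ^+ 2) * (1 + t ^+ 2) = 1 + t ^+ 2 by rewrite h mul1r.
by rewrite divfK // => ?; lra.
Qed.

Lemma stereo_surj a b : S1 a -> S1 b -> a <> b -> exists t, b = stereo a t.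
Proof.
move=> /S1E Sa /S1E Sb ab.
pose c := a.1 * b.1 + a.2 * b.2; pose s := a.1 * b.2 - a.2 * b.1.
have cs : s ^+ 2 = (1 - c) * (1 + c).
  transitivity ((a.1 ^+ 2 + a.2 ^+ 2) * (b.1 ^+ 2 + b.2 ^+ 2) - c ^+ 2).
    by rewrite /s /c; ring.
  by rewrite Sa Sb; ring.
have c1 : 1 - c != 0.
  apply/negP => /eqP c0; have := sqdist_gt0 ab; rewrite /sqdist.
  have -> : (b.1 - a.1) ^+ 2 + (b.2 - a.2) ^+ 2 =
     (a.1 ^+ 2 + a.2 ^+ 2) + (b.1 ^+ 2 + b.2 ^+ 2) - 2 + 2 * (1 - c) by rewrite /c; ring.
  by rewrite Sa Sb c0; lra.
exists (s / (1 - c)).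
have e0 : (s / (1 - c)) ^+ 2 = (1 + c) / (1 - c).
  by rewrite expr_div_n cs; field.
have e1 : ((s / (1 - c)) ^+ 2 - 1) / (1 + (s / (1 - c)) ^+ 2) = c.
  rewrite e0; field; rewrite c1 /=.
  by have -> : 1 - c + (1 + c) = 2 by ring.
have e2 : 2 * (s / (1 - c)) / (1 + (s / (1 - c)) ^+ 2) = s.
  rewrite e0; field; rewrite c1 /=.
  by have -> : 1 - c + (1 + c) = 2 by ring.
rewrite /stereo e1 e2 /c /s [b]surjective_pairing /=; congr pair.
- by transitivity (b.1 * (a.1 ^+ 2 + a.2 ^+ 2)); [rewrite Sa mulr1|ring].
- by transitivity (b.2 * (a.1 ^+ 2 + a.2 ^+ 2)); [rewrite Sa mulr1|ring].
Qed.

Lemma stereo_inj a : S1 a -> injective (stereo a).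
Proof.
move=> /S1E Sa; pose inv (x : R * R) :=
  (a.1 * x.2 - a.2 * x.1) / (1 - (a.1 * x.1 + a.2 * x.2)).
suff invK : cancel (stereo a) inv by exact: can_inj invK.
move=> t; rewrite /inv /=; have t0 : 1 + t ^+ 2 != 0 by rewrite gt_eqF // one_sqr_gt0.
set c := (t ^+ 2 - 1) / _; set s := 2 * t / _.
have -> : a.1 * (a.1 * s + a.2 * c) - a.2 * (a.1 * c - a.2 * s) = s.
  by transitivity (s * (a.1 ^+ 2 + a.2 ^+ 2)); [ring|rewrite Sa mulr1].
have -> : a.1 * (a.1 * c - a.2 * s) + a.2 * (a.1 * s + a.2 * c) = c.
  by transitivity (c * (a.1 ^+ 2 + a.2 ^+ 2)); [ring|rewrite Sa mulr1].
have -> : 1 - c = 2 / (1 + t ^+ 2) by rewrite /c; field.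
by rewrite /s; field.
Qed.

Lemma stereo_continuous a : continuous (stereo a).
Proof.
have c0 : continuous (fun t : R => t ^+ 2) by exact: exprn_continuous.
have cden : continuous (fun t : R => (1 + t ^+ 2)^-1).
  have c1 : continuous (fun t : R => 1 + t ^+ 2).
    by apply: continuous_funD => //; exact: continuous_const.
  by move=> t; apply: (@cvgV R); [rewrite gt_eqF // one_sqr_gt0|exact: c1].
have c1 : continuous (fun t : R => (t ^+ 2 - 1) / (1 + t ^+ 2)).
  apply: continuous_funM => //; apply: continuous_funB => //; exact: continuous_const.
have c2 : continuous (fun t : R => 2 * t / (1 + t ^+ 2)).
  apply: continuous_funM => //.
  by apply: continuous_funM; [exact: continuous_const|move=> t; exact: cvg_id].
by apply: continuous_pair; [apply: continuous_funB|apply: continuous_funD];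
  apply: continuous_funM => //; exact: continuous_const.
Qed.

Section CircleCut.
Variables (T : topologicalType) (f : R * R -> T).
Hypotheses (cf : {within S1, continuous f}) (fi : set_inj S1 f).
Let C := f @` S1.

Let stereo_comp a : S1 a -> continuous (f \o stereo a).
Proof.
move=> Sa t U nU.
have := (subspace_continuousP _ _).1 cf (stereo a t) (stereo_S1 t Sa).1 U nU.
move=> /(@stereo_continuous a t _) h.
apply: (@filterS _ (nbhs t) _ _ _ _ h) => s hs.
by apply: hs; exact: (stereo_S1 s Sa).1.
Qed.

Lemma circle_minus_point p : C p -> connected (C `\ p).
Proof.
move=> [a Sa <-]; have -> : C `\ f a = (f \o stereo a) @` setT.
  apply/seteqP; split=> q.
    move=> [[b Sb <-] nb]; have ab : a <> b by move=> e; apply: nb; rewrite e.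
    by have [t bt] := stereo_surj Sa Sb ab; exists t => //=; rewrite -bt.
  move=> [t _ <-] /=; have [S1t nt] := stereo_S1 t Sa.
  by split; [exists (stereo a t)|move=> e; apply: nt; apply: fi => //; rewrite inE].
apply: connected_continuous_connected; last exact/continuous_subspaceT/stereo_comp.
by apply/connected_intervalP.
Qed.

Lemma circle_minus_two p q : C p -> C q -> p <> q -> exists J1 J2,
  [/\ connected J1, connected J2 & (C `\ p) `\ q = J1 `|` J2].
Proof.
move=> [a Sa <-] [b Sb <-] pq; have ab : a <> b by move=> e; apply: pq; rewrite e.
have [t0 bt] := stereo_surj Sa Sb ab.
exists ((f \o stereo a) @` [set t | t < t0]), ((f \o stereo a) @` [set t | t0 < t]); split.
- apply: connected_continuous_connected; last exact/continuous_subspaceT/stereo_comp.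
  apply/connected_intervalP => x y /= _ yt z /andP[_ zy]; exact: le_lt_trans yt.
- apply: connected_continuous_connected; last exact/continuous_subspaceT/stereo_comp.
  apply/connected_intervalP => x y /= xt _ z /andP[xz _]; exact: lt_le_trans xz.
have inj t : f (stereo a t) = f b -> stereo a t = b.
  by apply: fi; rewrite inE //; exact: (stereo_S1 t Sa).1.
apply/seteqP; split=> z.
  move=> [[[c Sc <-] na] nb]; have ac : a <> c by move=> e; apply: na; rewrite e.
  have [t ct] := stereo_surj Sa Sc ac.
  case: (ltrgtP t t0) => h; [by left; exists t; rewrite //= -ct|by right; exists t; rewrite //= -ct|].
  by case: nb; rewrite /= ct bt h.
have aux t : t != t0 -> ((C `\ f a) `\ f b) (f (stereo a t)).
  move=> tt0; have [S1t nt] := stereo_S1 t Sa; split; first split.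
  - by exists (stereo a t).
  - by move=> e; apply: nt; apply: fi => //; rewrite inE.
  - by move=> /inj; rewrite bt => /(stereo_inj Sa)/eqP; rewrite (negbTE tt0).
by case=> -[t /= ht <-]; apply: aux; [rewrite lt_eqF|rewrite gt_eqF].
Qed.

Lemma circle_three_points : exists p q r, [/\ C p, C q & C r] /\ [/\ p <> q, q <> r & p <> r].
Proof.
have s1 : S1 (1, 0) by apply/S1E => /=; ring.
have s2 : S1 (-1, 0) by apply/S1E => /=; ring.
have s3 : S1 (0, 1) by apply/S1E => /=; ring.
exists (f (1, 0)), (f (-1, 0)), (f (0, 1)); split; first by split; [exists (1, 0)|exists (-1, 0)|exists (0, 1)].
split=> /fi; rewrite !inE.
- by move=> /(_ s1 s2) [] *; lra.
- by move=> /(_ s2 s3) [] *; lra.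
- by move=> /(_ s1 s3) [] *; lra.
Qed.

End CircleCut.

(** * From a Hamilton circle bounding a disk to forbidden minors *)

Lemma separates_swapl a b c d : separates a c b d -> separates c a b d.
Proof.
rewrite /separates; suff -> : orient c a b * orient c a d = orient a c b * orient a c d by [].
by rewrite /orient; ring.
Qed.

Lemma separates_swapr a b c d : separates a c b d -> separates a c d b.
Proof. by rewrite /separates mulrC. Qed.

(** * Vertices on the boundary of a disk exclude both minors *)

Section Outerplanar.
Variables (G : graph) (g : gpt G -> R * R) (o : R * R) (rho : R).
Hypotheses (gc : continuous g) (gi : injective g).
Hypotheses (gD : forall p, disk o rho (g p)) (gS : forall v, sphere o rho (g (PV v))).
Let P (v : gV G) := g (PV v).

Let Pneq u v : u <> v -> P u <> P v.
Proof. by move=> uv /gi []. Qed.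

Lemma edges_disjoint (x y : gE G) (s t : R) :
  src x <> src y -> src x <> tgt y -> tgt x <> src y -> tgt x <> tgt y ->
  edge_map x s <> edge_map y t.
Proof.
by move=> h1 h2 h3 h4; case: edge_mapP => [_|_|?]; case: edge_mapP => [_|_|?] // [] *; congruence.
Qed.

Lemma edges_dont_cross a b c d : adj a c -> adj b d ->
  a <> b -> a <> d -> c <> b -> c <> d -> ~ separates (P a) (P c) (P b) (P d).
Proof.
have key (x y : gE G) : src x <> src y -> src x <> tgt y -> tgt x <> src y -> tgt x <> tgt y ->
    ~ separates (P (src x)) (P (tgt x)) (P (src y)) (P (tgt y)).
  move=> h1 h2 h3 h4 sep.
  have cont (z : gE G) : continuous (fun t : R => g (edge_map z t)).
    by move=> t; apply: continuous_comp; [exact: edge_map_continuous|exact: gc].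
  apply: (@crossing_paths (fun t => g (edge_map x t)) (fun t => g (edge_map y t)) o rho) => //;
    rewrite ?edge_map0 ?edge_map1 //.
  by move=> s t /gi; exact: edges_disjoint.
move=> [x hx] [y hy]; move: hx hy.
case=> -[<- <-]; case=> -[<- <-] ab ad cb cd.
- exact: key.
- by move=> /separates_swapr; exact: key.
- by move=> /separates_swapl; exact: key.
- by move=> /separates_swapl/separates_swapr; exact: key.
Qed.

Lemma conn_sign_change (A : set (gV G)) (s : gV G -> R) u v :
  (forall w, A w -> s w != 0) -> conn A u v -> s u * s v < 0 ->
  exists w w', [/\ A w, A w', adj w w' & s w * s w' < 0].
Proof.
move=> s0; elim=> [w _|{}u {}v w uv IH Aw vw suw].
  by rewrite -expr2 ltNge sqr_ge0.
have Av := conn_r uv.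
case: (ltrP (s u * s v) 0) => [/IH //|suv].
exists v, w; split=> //; have := s0 v Av; have := s0 u (conn_l uv).
case: (ltrgt0P (s u)) suw suv => // su + + _; case: (ltrgt0P (s v)) => // sv.
- by rewrite !pmulr_rlt0.
- by move=> _; rewrite leNgt pmulr_rlt0 // sv.
- by move=> _; rewrite leNgt nmulr_rlt0 // sv.
- by rewrite !nmulr_rlt0.
Qed.

(** Walking in [A] across the line [b1 b2] finds an edge of [A] whose ends it separates; by symmetry
    that edge separates [b1] from [b2], and walking in [B] across it finds an edge of [B]. Two
    disjoint edges with alternating ends remain. *)
Lemma connected_sets_dont_cross (A B : set (gV G)) a1 a2 b1 b2 :
  (forall v, A v -> ~ B v) -> conn A a1 a2 -> conn B b1 b2 ->
  ~ separates (P a1) (P a2) (P b1) (P b2).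
Proof.
move=> AB ca cb sep.
have neq u v : A u -> B v -> u <> v by move=> Au Bv e; apply: (AB u) => //; rewrite e.
have sepneq u v w z : separates (P u) (P v) (P w) (P z) -> u <> v /\ w <> z.
  move=> suv; split=> e; move: suv; rewrite /separates e.
    by rewrite /orient !subrr !mul0r subrr mul0r ltxx.
  by rewrite -expr2 ltNge sqr_ge0.
have [Aa1 Aa2] : A a1 /\ A a2 by split; [exact: conn_l ca|exact: conn_r ca].
have [Bb1 Bb2] : B b1 /\ B b2 by split; [exact: conn_l cb|exact: conn_r cb].
have [a12 b12] := sepneq _ _ _ _ sep.
have sep' : separates (P b1) (P b2) (P a1) (P a2).
  apply: (@separates_sym o rho _ _ _ _ (gS a1) (gS b1) (gS a2) (gS b2)) => //;
  by apply: Pneq; first [done|exact: neq|apply: not_eq_sym; exact: neq].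
have s0 w : A w -> orient (P b1) (P b2) (P w) != 0.
  move=> Aw; apply: (@orient_neq0 o rho _ _ _ (gS b1) (gS b2) (gS w));
  by apply: Pneq; first [done|apply: not_eq_sym; exact: neq].
have [a [a' [Aa Aa' adja sepa]]] := conn_sign_change s0 ca sep'.
have [_ aa'] := sepneq b1 b2 a a' sepa.
have sep'' : separates (P a) (P a') (P b1) (P b2).
  apply: (@separates_sym o rho _ _ _ _ (gS b1) (gS a) (gS b2) (gS a')) => //;
  by apply: Pneq; first [done|exact: neq|apply: not_eq_sym; exact: neq].
have s0' w : B w -> orient (P a) (P a') (P w) != 0.
  move=> Bw; apply: (@orient_neq0 o rho _ _ _ (gS a) (gS a') (gS w));
  by apply: Pneq; first [done|exact: neq].
have [b [b' [Bb Bb' adjb sepb]]] := conn_sign_change s0' cb sep''.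
by apply: (edges_dont_cross adja adjb) sepb; exact: neq.
Qed.

Section Minor.
Variables (n : nat) (H : 'I_n -> 'I_n -> bool) (B : 'I_n -> set (gV G)) (b : 'I_n -> gV G).
Hypotheses (Bb : forall i, B i (b i))
  (Bd : forall i j, i != j -> B i `&` B j = set0)
  (Bc : forall i u v, B i u -> B i v -> conn (B i) u v)
  (BH : forall i j, H i j -> exists u v, B i u /\ B j v /\ adj u v).

Lemma branch_disjoint i j v : i != j -> B i v -> ~ B j v.
Proof. by move=> ij Bi Bj; have : (B i `&` B j) v by []; rewrite Bd. Qed.

Lemma branch_neq i j : i != j -> P (b i) <> P (b j).
Proof. by move=> ij; apply: Pneq => e; apply: (branch_disjoint ij (Bb i)); rewrite e. Qed.

Lemma minor_dont_cross i j k l : H i j -> H k l -> i != k -> i != l -> j != k -> j != l ->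
  ~ separates (P (b i)) (P (b j)) (P (b k)) (P (b l)).
Proof.
have cU i' j' : H i' j' -> conn (B i' `|` B j') (b i') (b j').
  move=> /BH [u [v [Bu [Bv uv]]]].
  apply: (@conn_trans _ _ _ v).
    apply: (@conn_step _ _ _ u) uv; last by right.
    by apply: conn_sub (Bc (Bb i') Bu); left.
  by apply: conn_sub (Bc Bv (Bb j')); right.
move=> Hij Hkl ik il jk jl; apply: connected_sets_dont_cross (cU _ _ Hij) (cU _ _ Hkl).
by move=> v [Bv|Bv] [Bv'|Bv']; [move: ik|move: il|move: jk|move: jl] => /branch_disjoint; apply; eauto.
Qed.

End Minor.

(** Some pairing of four boundary points alternates, and every pairing of the vertices of K4
    consists of two disjoint edges. *)
Lemma outerplanar_no_K4 : ~ has_minor G K4.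
Proof.
move=> [B [Bne [Bd [Bc BH]]]].
have [b Bb] := choice Bne.
have nc := minor_dont_cross Bb Bd Bc BH.
have nq := branch_neq Bb Bd.
pose i0 : 'I_4 := @Ordinal 4 0 isT; pose i1 : 'I_4 := @Ordinal 4 1 isT.
pose i2 : 'I_4 := @Ordinal 4 2 isT; pose i3 : 'I_4 := @Ordinal 4 3 isT.
have [] := @separates_exists o rho (P (b i0)) (P (b i1)) (P (b i2)) (P (b i3));
  try exact: gS; try exact: nq; exact: nc.
Qed.

(** For two vertices of the class of three, both pairings along edges are excluded, so the line
    through the representatives of the class of two separates theirs. Three points cannot lie
    pairwise on different sides of a line. *)
Lemma outerplanar_no_K23 : ~ has_minor G K23.
Proof.
move=> [B [Bne [Bd [Bc BH]]]].
have [b Bb] := choice Bne.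
have nc := minor_dont_cross Bb Bd Bc BH.
have nq := branch_neq Bb Bd.
pose i0 : 'I_5 := @Ordinal 5 0 isT; pose i1 : 'I_5 := @Ordinal 5 1 isT.
have key (i j : 'I_5) : (1 < i)%N -> (1 < j)%N -> i != j ->
    separates (P (b i0)) (P (b i1)) (P (b i)) (P (b j)).
  move=> hi hj ij.
  have ne (k k' : 'I_5) : (k < 2)%N -> (1 < k')%N -> k != k'.
    by move=> h h'; apply/eqP => e; move: h; rewrite e ltnNge h'.
  have K0 (k k' : 'I_5) : (k < 2)%N -> (1 < k')%N -> K23 k k'.
    by case: k k' => [[|[|k]] ?] [[|[|k']] ?].
  have [] // := @separates_exists o rho (P (b i0)) (P (b i1)) (P (b i)) (P (b j));
    try exact: gS; try (apply: nq => //; exact: ne).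
  - move=> h; exfalso; apply: nc h => //; first [exact: K0|exact: ne|by rewrite eq_sym; exact: ne].
  - move=> h; exfalso; apply: nc h => //;
      first [exact: K0|exact: ne|by rewrite eq_sym; exact: ne|by rewrite eq_sym].
pose i2 : 'I_5 := @Ordinal 5 2 isT; pose i3 : 'I_5 := @Ordinal 5 3 isT.
pose i4 : 'I_5 := @Ordinal 5 4 isT.
have := key i2 i3 isT isT isT; have := key i2 i4 isT isT isT; have := key i3 i4 isT isT isT.
rewrite /separates => /mul_lt0P h1 /mul_lt0P h2 /mul_lt0P h3.
by case: h1 => -[h11 h12]; case: h2 => -[h21 h22]; case: h3 => -[h31 h32]; lra.
Qed.

End Outerplanar.

(** * 2-connectedness from a Hamilton circle *)

Section HamiltonCircle.
Variable G : graph.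
Hypothesis sG : simple G.
Variable f : R * R -> gpt G.
Hypotheses (cf : {within S1, continuous f}) (fi : set_inj S1 f).
Hypothesis fV : forall v, (f @` S1) (PV v).

Lemma hamilton_minus_vertex (v a b : gV G) : a <> v -> b <> v -> conn [set x | x <> v] a b.
Proof.
move=> av bv; pose D : set (gV G) := [set x | conn [set x | x <> v] a x].
have DS : component_union [set v] D.
  by split=> [x /conn_r //|x y Dx yv xy]; exact: conn_step Dx yv xy.
have fS : finite_set [set v] by exact: finite_set1.
have cC := circle_minus_point cf fi (fV v).
have sub : f @` S1 `\ PV v `<=` side [set v] D.
  apply: (connected_split cC (side_open fS DS) (side_open fS (component_unionC DS))).
  - move=> p [_ pv]; case: (side_cover p fS DS); [by left|by right| |].
      by move=> [u /= -> /pv].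
    by move=> [x [t [_ /= sx tx]]]; case: (sG.1 x); rewrite sx tx.
  - by move=> p _; exact: side_disjoint.
  - by exists (PV a); [split=> // -[]|apply: conn_refl].
by apply: (sub (PV b)); split=> // -[].
Qed.

(** With at most two vertices there are no ends and, by simplicity, at most one edge. The circle has
    more than two points, so it contains an inner point of that edge; removing it leaves the two
    ends of the edge in different parts. *)
Lemma hamilton_three_vertices : connected_graph G ->
  exists a b c : gV G, a <> b /\ b <> c /\ a <> c.
Proof.
move=> [[a _] cG]; apply: contrapT => no3.
have [p [q [r [[Cp Cq Cr] [pq qr pr]]]]] := circle_three_points fi.
have [b hV] : exists b, forall v, v = a \/ v = b.
  have [[b ab]|nb] := pselect (exists b, a <> b); last first.
    by exists a => v; left; apply: contrapT => va; apply: nb; exists v => e; apply: va.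
  exists b => v; have [?|va] := pselect (v = a); first by left.
  right; apply: contrapT => vb; apply: no3; exists a, b, v.
  by split=> //; split=> e; [apply: vb|apply: va].
have noend (w : gend G) : False.
  have [r0 [[ri _] _ _]] := end_rays w.
  have n01 : r0 0%N <> r0 1%N by move/ri.
  have n12 : r0 1%N <> r0 2%N by move/ri.
  have n02 : r0 0%N <> r0 2%N by move/ri.
  by case: (hV (r0 0%N)) (hV (r0 1%N)) (hV (r0 2%N)) => e1 [] e2 [] e3; congruence.
have [x [t Cx]] : exists x t, (f @` S1) (PE x t).
  have vs s : (f @` S1) s -> s <> PV a -> s <> PV b -> exists x t, (f @` S1) (PE x t).
    case: s => [v|x t|w]; [|by move=> *; exists x, t|by case: (noend w)].
    by case: (hV v) => -> _ h1 h2; [case: h1|case: h2].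
  have [ea|na] := pselect (p = PV a); have [eb|nb] := pselect (p = PV b).
  - by apply: (vs q Cq); congruence.
  - have [qb|qb] := pselect (q = PV b); first by apply: (vs r Cr); congruence.
    by apply: (vs q Cq) => //; congruence.
  - have [qa|qa] := pselect (q = PV a); first by apply: (vs r Cr); congruence.
    by apply: (vs q Cq) => //; congruence.
  - exact: (vs p Cp).
have xE y : y = x.
  apply: sG.2; have := sG.1 x; have := sG.1 y.
  case: (hV (src x)) (hV (tgt x)) (hV (src y)) (hV (tgt y)) => h1 [] h2 [] h3 [] h4;
    rewrite h1 h2 h3 h4 => *; first [by left|by right|congruence].
(* The coordinate along the only edge. Its value 0 at ends is a dummy, as there are none. *)
pose tau (p : gpt G) : R := match p with
  | PV v => if `[< v = src x >] then 0 else 1 | PE _ s => sval s | PEnd _ => 0 end.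
have tauE s : 0 <= s <= 1 -> tau (edge_map x s) = s.
  move=> /andP[s0 s1]; case: edge_mapP => [s0'|s1'|h] //=.
    by rewrite asboolT //; apply/eqP; rewrite eq_le s0 s0'.
  rewrite asboolF; last by move=> e; case: (sG.1 x).
  by apply/eqP; rewrite eq_le s1 s1'.
pose U := [set p | tau p < sval t]; pose V := [set p | sval t < tau p].
have oU : open U.
  apply: complex_open_open; split=> [w|y s s01]; first by case: (noend w).
  rewrite (xE y) /U /= tauE // => st; exists (sval t - s); first by rewrite subr_gt0.
  by move=> s' s01'; rewrite ltr_norml tauE // ltrD2r => /andP[].
have oV : open V.
  apply: complex_open_open; split=> [w|y s s01]; first by case: (noend w).
  rewrite (xE y) /V /= tauE // => st; exists (s - sval t); first by rewrite subr_gt0.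
  by move=> s' s01'; rewrite ltr_norml tauE // opprB ltrD2r => /andP[].
have [t0 t1] : 0 < sval t /\ sval t < 1 by have /andP[] := proj2_sig t.
have sub : f @` S1 `\ PE x t `<=` U.
  apply: (connected_split (circle_minus_point cf fi Cx) oU oV).
  - move=> s [_ st]; rewrite /U /V /=.
    case: (ltrgtP (tau s) (sval t)) => [|| e]; [by left|by right|].
    case: s st e => [v|y s|w] /= st; [|move=> e|by case: (noend w)].
      by case: asboolP => _ e; move: t0 t1; rewrite -e ltxx.
    by case: st; rewrite (xE y); congr PE; apply: val_inj.
  - by move=> s _; rewrite /U /V /= => /lt_gtF ->.
  - by exists (PV (src x)); [split|rewrite /U /= asboolT].
have := sub (PV (tgt x)); rewrite /U /= asboolF; last by move=> e; case: (sG.1 x).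
by rewrite (lt_gtF t1) => h; have : false by apply: h; split; [exact: fV|].
Qed.

End HamiltonCircle.

Lemma disk_hamilton_circle_imp (G : graph) : simple G -> connected_graph G ->
  (exists C : set (gpt G), hamilton_circle C /\
      exists (g : gpt G -> R * R) (c : R * R) (r : R),
        0 < r /\ embedding_on setT g /\ range g `<=` disk c r /\
        g @` C = sphere c r) ->
  two_connected G /\ ~ has_minor G K4 /\ ~ has_minor G K23.
Proof.
move=> sG cG [C [[cC CV] [g [c0 [rho [_ [eg [gD gC]]]]]]]].
have [f [[cf [fi _]] eC]] := cC; have [gc [gi _]] := eg.
have gc' : continuous g by exact/continuous_subspace_setT.
have gi' : injective g by move=> p q; apply: gi; rewrite inE.
have gD' p : disk c0 rho (g p) by apply: gD; exists p.
have gS v : sphere c0 rho (g (PV v)) by rewrite -gC; exists (PV v).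
rewrite eC in CV; split; last first.
  by split; [exact: (outerplanar_no_K4 gc' gi' gD' gS)|exact: (outerplanar_no_K23 gc' gi' gD' gS)].
by split; [exact: (hamilton_three_vertices sG cf fi)|exact: hamilton_minus_vertex].
Qed.

(** * Cycles and the outer order *)

Section Minors.
Variable G : graph.
Implicit Types (ss : seq (seq (gV G))).

Lemma flatten_disjoint ss i j x : uniq (flatten ss) -> (i < j)%N ->
  x \in nth [::] ss i -> x \in nth [::] ss j -> False.
Proof.
elim: ss i j => [|s ss IH] i j; first by rewrite nth_nil.
rewrite /= cat_uniq => /and3P[_ dis uss]; case: j => // j; case: i => [_ /= xs xj|i ij].
  move/hasPn: dis => /(_ x) h; suff xf : x \in flatten ss by move: (h xf); rewrite /= xs.
  apply/flattenP; exists (nth [::] ss j) => //; apply: mem_nth.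
  by rewrite ltnNge; apply/negP => h2; move: xj; rewrite nth_default.
exact: (IH i j uss ij).
Qed.

(** With paths as branch sets, connectedness is [sorted] and disjointness is [uniq] of the
    concatenation, so both can be read off a cycle cut into segments. *)
Lemma minor_of_paths n (H : 'I_n -> 'I_n -> bool) ss : symmetric H ->
  (forall i : 'I_n, ~~ H i i) ->
  (forall i, (i < n)%N -> nth [::] ss i != [::]) ->
  (forall i, (i < n)%N -> sorted (@adjb G) (nth [::] ss i)) ->
  uniq (flatten ss) ->
  (forall i j : 'I_n, (i < j)%N -> H i j ->
     exists u v, [/\ u \in nth [::] ss i, v \in nth [::] ss j & adj u v]) ->
  has_minor G H.
Proof.
move=> Hs Hi ne so un ad; exists (fun i : 'I_n => [set` nth [::] ss i]); split; [|split; [|split]].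
- move=> i; have := ne i (ltn_ord i); case: (nth _ _ _) => // v s _.
  by exists v; rewrite /= mem_head.
- move=> i j ij; apply/seteqP; split=> // x [/= xi xj].
  have : (i < j)%N || (j < i)%N by rewrite -neq_ltn.
  by case/orP => h; [exact: flatten_disjoint un h xi xj|exact: flatten_disjoint un h xj xi].
- move=> i u v /=; have := so i (ltn_ord i).
  by case: (nth _ _ _) => // z s /= pz; exact: path_conn2.
- move=> i j Hij; case: (ltngtP i j) => ij.
  + by have [u [v [ui vj uv]]] := ad i j ij Hij; exists u, v.
  + rewrite Hs in Hij; have [u [v [ui vj uv]]] := ad j i ij Hij.
    by exists v, u; split=> //; split=> //; exact: adj_sym.
  + by move: Hij; rewrite (val_inj ij) (negbTE (Hi _)).
Qed.

End Minors.

Section Cycles.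
Variable G : graph.
Hypotheses (sG : simple G) (tc : two_connected G) (noK4 : ~ has_minor G K4) (noK23 : ~ has_minor G K23).
Implicit Types (c s : seq (gV G)).
Local Notation e := (@adjb G).

(** Length two is allowed: an edge traversed back and forth starts the extension process. *)
Definition gcycle c := [&& uniq c, cycle e c & (1 < size c)%N].

Lemma cycle_adj_last x s y : cycle e (x :: s) -> s != [::] -> adj (last y s) x.
Proof.
case/lastP: s => // s z; rewrite /= -cats1 -cats1 -catA cat_path => /andP[_] /=.
by rewrite last_cat /= andbT => /andP[_ /asboolP].
Qed.

Lemma gcycle_rev a s : gcycle (a :: s) -> gcycle (a :: rev s).
Proof.
rewrite /gcycle /= !size_rev rev_uniq mem_rev => /and3P[-> cy ->].
rewrite andbT /=; have := rev_path e a (rcons s a).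
rewrite last_rcons belast_rcons rev_cons => ->; rewrite (eq_path (e' := e)) //.
by move=> x y; rewrite adjb_sym.
Qed.

Lemma cycle_insert a b s2 w p1 : gcycle [:: a, b & s2] -> adj a w ->
  path e w (rcons p1 b) -> uniq (w :: p1) -> ~~ has (mem [:: a, b & s2]) (w :: p1) ->
  gcycle (a :: (w :: p1) ++ b :: s2).
Proof.
move=> /and3P[un cy _] aw pw upw dis; apply/and3P; split=> //.
- move: un; rewrite cons_uniq => /andP[anb ub].
  rewrite -cat_cons cat_uniq ub andbT; apply/andP; split.
    rewrite cons_uniq upw andbT.
    by apply/negP => aw'; move/hasPn: dis => /(_ a aw'); rewrite /= mem_head.
  apply/hasPn => x xb /=; rewrite inE negb_or; apply/andP; split.
    by apply/negP => /eqP xa; move/negP: anb; apply; rewrite -xa.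
  apply/negP => xw; move/hasPn: dis => /(_ x xw); rewrite /= inE.
  by rewrite [x \in b :: s2]xb orbT.
- rewrite /= rcons_cat /= cat_path; move: pw; rewrite rcons_path => /andP[-> lb] /=.
  by rewrite lb /=; apply/andP; split; [exact/asboolP|move: cy => /= /andP[_ ->]].
Qed.

(** Since [a] is no cutvertex, a path from [w] avoiding [a] reaches the cycle; let [b] be its first
    vertex there. If [b] is next to [a] on the cycle, the path replaces that cycle edge; otherwise
    [a] and [b] are joined by three disjoint nonempty paths. *)
Lemma cycle_extend c a w : gcycle c -> a \in c -> w \notin c -> adj a w ->
  exists c', [/\ gcycle c', {subset c <= c'} & w \in c'].
Proof.
move=> gc ac wc aw; have [k s rc] := rot_to ac.
have gs : gcycle (a :: s).
  by move: gc; rewrite /gcycle -(rot_uniq k) -(rot_cycle k) -(size_rot k) rc.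
have memc x : (x \in c) = (x \in a :: s) by rewrite -rc mem_rot.
suff [c' [gc' sub wc']] : exists c', [/\ gcycle c', {subset a :: s <= c'} & w \in c'].
  by exists c'; split=> // x; rewrite memc => /sub.
move: wc; rewrite memc inE negb_or => /andP[wa ws].
have [h [t es]] : exists h t, s = h :: t.
  by move: gs; case: (s) => [|h t]; [rewrite /gcycle /= ltnn !andbF|exists h, t].
have ha : h <> a by move=> e1; move/and3P: gs => [+ _ _]; rewrite es e1 /= inE eqxx.
have [p [pp lp up pa]] := conn_path (tc.2 a w h (elimN eqP wa) ha).
have hp : has (mem s) p.
  apply/hasP; exists h; last by rewrite /= es mem_head.
  have := mem_last w p; rewrite lp inE => /predU1P[hw|//].
  by move: ws; rewrite -hw es mem_head.
move: pp up pa {lp}; case: (split_find hp) => b p1 p2 /= bs np1.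
rewrite cat_path => /andP[pb _] /andP[wp up] pa.
have upw : uniq (w :: p1).
  move: wp up; rewrite /= cat_uniq rcons_uniq mem_cat mem_rcons inE !negb_or.
  by move=> /andP[/andP[_ ->] _] /and3P[/andP[_ ->] _ _].
have npw : ~~ has (mem (a :: s)) (w :: p1).
  apply/hasPn => x xp; rewrite /= inE negb_or; apply/andP; split.
    apply/eqP; apply: pa; move: xp; rewrite !inE => /predU1P[->|xp]; first by rewrite eqxx.
    by rewrite mem_cat mem_rcons inE xp !orbT.
  by move: xp; rewrite inE => /predU1P[->//|xp]; move/hasPn: np1 => /(_ x xp).
have mem_sub s' : {subset s <= s'} ->
   gcycle (a :: (w :: p1) ++ s') -> exists c', [/\ gcycle c', {subset a :: s <= c'} & w \in c'].
  move=> sub gcyc; exists (a :: (w :: p1) ++ s'); split=> // [x|].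
    by rewrite !inE mem_cat => /predU1P[->|/sub ->]; rewrite ?eqxx ?orbT.
  by rewrite inE mem_cat mem_head orbT.
case: (splitPr bs) gs npw mem_sub => s1 s2 {hp np1 es ws memc rc bs} gs npw mem_sub.
case: s1 gs npw mem_sub => [|x1 s1] gs npw mem_sub.
  by apply: (mem_sub (b :: s2)) => //; exact: cycle_insert.
(* If nothing follows [b], it precedes [a] on the cycle, and the reversed cycle has [b] right after
   [a]. *)
case: s2 gs npw mem_sub => [|x2 s2] gs npw mem_sub.
  have gr : gcycle [:: a, b & rev (x1 :: s1)] by have := gcycle_rev gs; rewrite rev_cat.
  apply: (mem_sub (b :: rev (x1 :: s1))).
  - move=> x; rewrite mem_cat mem_seq1 => /orP[h'|/eqP->]; last exact: mem_head.
    by rewrite in_cons mem_rev h' orbT.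
  - apply: cycle_insert => //; apply: contra npw => /hasP[x xw xin]; apply/hasP; exists x => //.
    by move: xin; rewrite /= !(in_cons, mem_rev, mem_cat) => /or4P[] ->; rewrite ?orbT.
(* [a] and [b] form the class of two; the two open arcs of the cycle and the path outside it form
   the class of three. *)
exfalso; apply: noK23.
move: gs npw => /and3P[un cy _] npw.
apply: (@minor_of_paths G 5 K23 [:: [:: a]; [:: b]; x1 :: s1; x2 :: s2; w :: p1]).
- by move=> i j; rewrite /K23 eq_sym.
- by move=> i; rewrite /K23 eqxx.
- by case=> [|[|[|[|[|]]]]].
- move: cy => /=; rewrite rcons_cat /= cat_path /= rcons_path.
  move=> /and3P[_ ps1 /and3P[_ _ /andP[ps2 _]]].
  by case=> [|[|[|[|[|]]]]] //= _; move: pb; rewrite rcons_path => /andP[].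
- have -> : flatten [:: [:: a]; [:: b]; x1 :: s1; x2 :: s2; w :: p1] =
     (a :: b :: (x1 :: s1) ++ (x2 :: s2)) ++ (w :: p1) by rewrite /= -catA /= cats0.
  have pe : perm_eq (a :: (x1 :: s1) ++ b :: x2 :: s2) (a :: b :: (x1 :: s1) ++ x2 :: s2).
    by rewrite perm_cons perm_sym -cat1s -[b :: x2 :: s2]cat1s perm_catCA.
  rewrite cat_uniq upw andbT -(perm_uniq pe) un andTb.
  apply: contra npw => /hasP[x xw xin]; apply/hasP; exists x => //.
  by move: xin; rewrite /= -(perm_mem pe).
- move: cy => /=; rewrite rcons_cat /= cat_path /= rcons_path.
  move=> /and3P[/asboolP ax1 _ /and3P[/asboolP l1b /asboolP bx2 /andP[_ /asboolP l2a]]].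
  have /asboolP lwb : e (last w p1) b by move: pb; rewrite rcons_path => /andP[].
  case=> [[|[|[|[|[|i]]]]] hi] [[|[|[|[|[|j]]]]] hj] //= _ _.
  + by exists a, x1; rewrite !mem_head.
  + by exists a, (last x2 s2); rewrite mem_head mem_last; split=> //; exact: adj_sym.
  + by exists a, w; rewrite !mem_head.
  + by exists b, (last x1 s1); rewrite mem_head mem_last; split=> //; exact: adj_sym.
  + by exists b, x2; rewrite !mem_head.
  + by exists b, (last w p1); rewrite mem_head mem_last; split=> //; exact: adj_sym.
Qed.

Lemma split_index x c : x \in c -> exists s t, c = s ++ x :: t /\
  forall z, z \in c -> (index x c < index z c)%N ->
    z \in t /\ index z c = ((size s).+1 + index z t)%N.
Proof.
move=> xc; exists (take (index x c) c), (drop (index x c).+1 c).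
have ce : c = take (index x c) c ++ x :: drop (index x c).+1 c.
  by rewrite -{2}(nth_index x xc) -drop_nth ?index_mem // cat_take_drop.
split=> // z zc lt; have sz : size (take (index x c) c) = index x c.
  by rewrite size_takel // ltnW // index_mem.
have znt : z \notin take (index x c) c.
  by apply/negP => zt; move: lt; rewrite {2}ce index_cat zt ltnNge -{2}sz ltnW // index_mem.
have zx : z != x by apply/eqP => e1; move: lt; rewrite e1 ltnn.
split.
  by move: zc; rewrite {1}ce mem_cat (negbTE znt) inE (negbTE zx).
by rewrite {1}ce index_cat (negbTE znt) /= eq_sym (negbTE zx) addnS.
Qed.

Lemma chords_dont_cross c x1 x2 x3 x4 : gcycle c ->
  x1 \in c -> x2 \in c -> x3 \in c -> x4 \in c ->
  (index x1 c < index x2 c)%N -> (index x2 c < index x3 c)%N -> (index x3 c < index x4 c)%N ->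
  adj x1 x3 -> adj x2 x4 -> False.
Proof.
move=> gc m1 m2 m3 m4 i12 i23 i34 a13 a24; apply: noK4.
have [s0 [t1 [ec h1]]] := split_index m1.
have [n2 e2] := h1 _ m2 i12; have [n3 e3] := h1 _ m3 (ltn_trans i12 i23).
have [n4 e4] := h1 _ m4 (ltn_trans (ltn_trans i12 i23) i34).
rewrite e2 e3 ltn_add2l in i23; rewrite e3 e4 ltn_add2l in i34.
have [s1 [t2 [et1 h2]]] := split_index n2.
have [k3 f3] := h2 _ n3 i23; have [k4 f4] := h2 _ n4 (ltn_trans i23 i34).
rewrite f3 f4 ltn_add2l in i34.
have [s2 [t3 [et2 h3]]] := split_index k3.
have [l4 _] := h3 _ k4 i34.
have [s3 [s4 [et3 _]]] := split_index l4.
(* Rotated to start at [x1], the cycle falls into four arcs, one for each [xi]. Cyclically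
   consecutive arcs are adjacent, and the chords join the opposite ones: a K4. *)
have er : rot (size s0) c = (x1 :: s1) ++ (x2 :: s2) ++ (x3 :: s3) ++ (x4 :: s4 ++ s0).
  by rewrite ec rot_size_cat et1 et2 et3 /= -!catA /= -!catA /= -catA.
move: gc => /and3P[un cy _].
have : uniq ((x1 :: s1) ++ (x2 :: s2) ++ (x3 :: s3) ++ (x4 :: s4 ++ s0)) by rewrite -er rot_uniq.
have : cycle e ((x1 :: s1) ++ (x2 :: s2) ++ (x3 :: s3) ++ (x4 :: s4 ++ s0)) by rewrite -er rot_cycle.
move: (s4 ++ s0) => s5 {un cy er et3 l4 ec h1 h2 h3}.
rewrite /= rcons_cat /= rcons_cat /= rcons_cat /= !cat_path /= !cat_path /= cat_path /= rcons_path.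
move=> /and3P[p1 /asboolP a12 /and3P[p2 /asboolP a23 /and3P[p3 /asboolP a34 /andP[p4 /asboolP a41]]]] un.
apply: (@minor_of_paths G 4 K4 [:: x1 :: s1; x2 :: s2; x3 :: s3; x4 :: s5]).
- by move=> i j; rewrite /K4 eq_sym.
- by move=> i; rewrite /K4 eqxx.
- by case=> [|[|[|[|]]]].
- by case=> [|[|[|[|]]]].
- by rewrite /= cats0.
- case=> [[|[|[|[|i]]]] hi] [[|[|[|[|j]]]] hj] //= _ _.
  + by exists (last x1 s1), x2; rewrite mem_head mem_last.
  + by exists x1, x3; rewrite !mem_head.
  + by exists x1, (last x4 s5); rewrite mem_head mem_last; split=> //; exact: adj_sym.
  + by exists (last x2 s2), x3; rewrite mem_head mem_last.
  + by exists x2, x4; rewrite !mem_head.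
  + by exists (last x3 s3), x4; rewrite mem_head mem_last.
Qed.

Lemma cycle_reach c u v : conn setT u v -> gcycle c -> u \in c ->
  exists c', [/\ gcycle c', {subset c <= c'} & v \in c'].
Proof.
move=> uv gc; elim: uv => [w _ wc|{}u {}v w _ IH _ vw uc]; first by exists c; split.
have [c' [gc' sub vc']] := IH uc.
have [wc'|wc'] := boolP (w \in c'); first by exists c'; split.
have [c'' [gc'' sub' wc'']] := cycle_extend gc' vc' wc' vw.
by exists c''; split=> // x /sub /sub'.
Qed.

Lemma adj_neq (u v : gV G) : adj u v -> u <> v.
Proof. by move=> [x [[<- <-]|[<- <-]]] e1; apply: (sG.1 x). Qed.

Lemma cycles_cofinal (m : gV G) (W : seq (gV G)) : (forall v, conn setT m v) ->
  exists s, gcycle (m :: s) /\ {subset W <= m :: s}.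
Proof.
move=> cG.
have [w mw] : exists w, adj m w.
  have [b mb] : exists b, b <> m.
    have [[a [b [_ [ab _]]]] _] := tc.
    by have [am|] := pselect (a = m); [exists b => e1; apply: ab; rewrite am e1|exists a].
  have [p [pp lp _ _]] := conn_path (cG b).
  by case: p pp lp => [_ /= e1|w p /= /andP[/asboolP mw _] _]; [case: mb|exists w].
suff [c [gc mc sub]] : exists c, [/\ gcycle c, m \in c & {subset W <= c}].
  have [i s rc] := rot_to mc; exists s; split.
    by move: gc; rewrite /gcycle -(rot_uniq i) -(rot_cycle i) -(size_rot i) rc.
  by move=> x /sub; rewrite -rc mem_rot.
elim: W => [|v W [c [gc mc sub]]].
  have wm : m != w by exact/eqP/adj_neq.
  exists [:: m; w]; rewrite mem_head /gcycle /= inE wm /= !andbT; split=> //.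
  by apply/andP; split; apply/asboolP => //; exact: adj_sym.
have [c' [gc' sub' vc']] := cycle_reach (cG v) gc mc.
exists c'; split=> //; first exact: sub'.
by move=> x; rewrite inE => /predU1P[->//|/sub/sub'].
Qed.

End Cycles.

(** The vertex order along a Hamilton circle cut open between [M] and [m]. Neighbours in the order
    exist and are adjacent in [G], yet the order may have gaps, which is where the ends will sit. *)
Record outer_order (G : graph) (lt : gV G -> gV G -> Prop) (m M : gV G) : Prop := OuterOrder {
  oo_irr : forall x, ~ lt x x;
  oo_trans : forall x y z, lt x y -> lt y z -> lt x z;
  oo_total : forall x y, x <> y -> lt x y \/ lt y x;
  oo_min : forall x, x <> m -> lt m x;
  oo_max : forall x, x <> M -> lt x M;
  oo_adj : adj m M;
  oo_cross : forall a b c d, lt a b -> lt b c -> lt c d -> adj a c -> adj b d -> False;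
  oo_succ : forall x, x <> M -> exists u,
    [/\ lt x u, adj x u & forall y, lt x y -> y = u \/ lt u y];
  oo_pred : forall x, x <> m -> exists u,
    [/\ lt u x, adj x u & forall y, lt y x -> y = u \/ lt y u] }.

Lemma outer_order_rev (G : graph) (lt : gV G -> gV G -> Prop) m M :
  outer_order lt m M -> outer_order (fun x y => lt y x) M m.
Proof.
case=> h1 h2 h3 h4 h5 h6 h7 h8 h9; split=> //.
- by move=> x y z xy yz; exact: h2 yz xy.
- by move=> x y xy; case: (h3 _ _ xy); [right|left].
- exact: adj_sym.
- by move=> a b c d ba cb dc ac bd; apply: (h7 d c b a) => //; exact: adj_sym.
Qed.

(** * The limit of the cycle orders *)

Section OuterOrder.
Variable G : graph.
Hypotheses (sG : simple G) (lfG : locally_finite G) (cG : connected_graph G).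
Hypotheses (tc : two_connected G) (noK4 : ~ has_minor G K4) (noK23 : ~ has_minor G K23).
Variable m : gV G.

Let good (c : seq (gV G)) := gcycle c /\ exists s, c = m :: s.

(** The tail filter of the cycles directed by the vertex sets they cover. Listing each cycle from
    [m] on turns its cyclic order into a linear one, read off by [index]. *)
Let F : set_system (seq (gV G)) :=
  [set D | exists W : seq (gV G), forall c, good c -> {subset W <= c} -> D c].

Let F_proper : ProperFilter F.
Proof.
split.
  move=> [W hW]; have [s [gs sub]] := cycles_cofinal sG tc noK23 W (cG.2 m).
  by apply: (hW (m :: s)) => //; split=> //; exists s.
split; first by exists [::].
- move=> A B [W1 h1] [W2 h2]; exists (W1 ++ W2) => c gc sub.
  by split; [apply: h1|apply: h2] => // x xW; apply: sub; rewrite mem_cat xW ?orbT.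
- by move=> A B AB [W h]; exists W => c gc /(h c gc)/AB.
Qed.

Section Ultra.
Variable U : set_system (seq (gV G)).
Hypotheses (UU : UltraFilter U) (FU : F `<=` U).
Let lt (x y : gV G) := U [set c | (index x c < index y c)%N].

Let evt (W : seq (gV G)) (P : set (seq (gV G))) :
  (forall c, good c -> {subset W <= c} -> P c) -> U P.
Proof. by move=> h; apply: FU; exists W. Qed.

Let evt_and (A B : set (seq (gV G))) (W : seq (gV G)) (P : set (seq (gV G))) : U A -> U B ->
  (forall c, good c -> {subset W <= c} -> A c -> B c -> P c) -> U P.
Proof.
move=> UA UB h; have UG : U [set c | good c /\ {subset W <= c}] by exact: (evt (W := W)).
by apply: filterS (filterI UG (filterI UA UB)) => c [[gc sub] [Ac Bc]]; exact: h.
Qed.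

Let evt_ex (A : set (seq (gV G))) (W : seq (gV G)) : U A ->
  exists c, [/\ good c, {subset W <= c} & A c].
Proof.
move=> UA; have UG : U [set c | good c /\ {subset W <= c}] by exact: (evt (W := W)).
by have [c [[gc sub] Ac]] := filter_ex (filterI UG UA); exists c.
Qed.

(** An ultrafilter makes a function with finitely many values constant. Together with local
    finiteness this fixes the last vertex of the cycles and the neighbours of a vertex on them. *)
Let pick (s : seq (gV G)) (P : seq (gV G) -> gV G) :
  U [set c | P c \in s] -> exists u, U [set c | P c = u].
Proof.
elim: s => [|u s IH] h; first by have [c [_ _]] := evt_ex [::] h; rewrite /= in_nil.
have [Uu|Uu] := in_ultra_setVsetC [set c | P c = u] UU; first by exists u.
apply: IH; apply: filterS (filterI h Uu) => c [/=].
by rewrite inE => /predU1P[|].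
Qed.

Let index_inj (x y : gV G) (c : seq (gV G)) : x \in c -> index x c = index y c -> x = y.
Proof.
move=> xc e1; have yc : y \in c by rewrite -index_mem -e1 index_mem.
by rewrite -(nth_index m xc) -(nth_index m yc) e1.
Qed.

Let lt_of (x y : gV G) (A : set (seq (gV G))) : U A -> (forall c, good c -> x \in c -> y \in c ->
   A c -> (index x c < index y c)%N) -> lt x y.
Proof.
move=> UA h; apply: (evt_and (W := [:: x; y]) UA UA) => c gc sub Ac _.
by apply: h => //; apply: sub; rewrite !inE eqxx ?orbT.
Qed.

Let last_adj c : good c -> adj m (last m c) /\ (index (last m c) c).+1 = size c.
Proof.
move=> [/and3P[un cy sz] [s ec]]; subst c.
have sn : s != [::] by move: sz; case: (s).
split; first by apply: adj_sym; rewrite /=; exact: cycle_adj_last.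
by rewrite [last m (m :: s)]/= index_last.
Qed.

Lemma ultra_outer_order : exists M, outer_order lt m M.
Proof.
have UT : U setT by exact: filterT.
have [Nm hNm] := neighbours_seq lfG m.
(* The last vertex of a cycle listed from [m] is a neighbour of [m], hence one of finitely many. *)
have [M UM] : exists M, U [set c | last m c = M].
  by apply: (pick (s := Nm)); apply: (evt (W := [::])) => c gc _; apply: hNm; exact: (last_adj gc).1.
have ltM x : x <> M -> lt x M.
  move=> xM; apply: (lt_of UM) => c gc xc Mc /= lM.
  have [_ sz] := last_adj gc; rewrite lM in sz.
  have : (index x c < size c)%N by rewrite index_mem.
  rewrite -sz ltnS leq_eqVlt => /predU1P[e1|//].
  by case: xM; exact: index_inj xc e1.
have tot x y : x <> y -> lt x y \/ lt y x.
  move=> xy; have [h|h] := in_ultra_setVsetC [set c | (index x c < index y c)%N] UU; first by left.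
  right; apply: (lt_of h) => c gc xc yc /= /negP; rewrite -leqNgt leq_eqVlt => /predU1P[e1|//].
  by case: xy; symmetry; exact: index_inj e1.
exists M; split=> //.
- by move=> x h; have [c [_ _ /=]] := evt_ex [::] h; rewrite ltnn.
- by move=> x y z xy yz; apply: (evt_and (W := [::]) xy yz) => c _ _ /=; exact: ltn_trans.
- move=> x xm; apply: (lt_of UT) => c [gc [s ->]] xc _ _ /=.
  by rewrite eqxx; case: eqP => // e1; case: xm.
- by have [c [gc _ /= <-]] := evt_ex [::] UM; exact: (last_adj gc).1.
- move=> a b c d ab bc cd ac bd.
  have [l [[gl _] sub [h1 [h2 h3]]]] := evt_ex [:: a; b; c; d] (filterI ab (filterI bc cd)).
  by apply: (chords_dont_cross noK4 gl _ _ _ _ h1 h2 h3) => //; apply: sub; rewrite !inE eqxx ?orbT.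
- move=> v vM; have [Nv hNv] := neighbours_seq lfG v.
  (* As [v] differs from [M], it is not last on almost all cycles, so [nth] does not fall back on
     its default. *)
  have Unext : U [set c : seq (gV G) | [/\ v \in c, ((index v c).+1 < size c)%N
       & adj v (nth m c (index v c).+1)]].
    apply: (evt_and (W := [:: v]) UM UM) => c gc sub lM _.
    have vc : v \in c by apply: sub; rewrite inE.
    have [_ sz] := last_adj gc; rewrite lM in sz.
    have lt1 : ((index v c).+1 < size c)%N.
      have : (index v c < size c)%N by rewrite index_mem.
      rewrite -sz !ltnS leq_eqVlt => /predU1P[e1|//].
      by case: vM; exact: index_inj vc e1.
    split=> //; case: gc => /and3P[un cy _] [s ec].
    have ps : path (@adjb G) m s by move: cy; rewrite ec /= rcons_path => /andP[].
    have lt2 : (index v c < size s)%N by rewrite -ltnS -[(size s).+1]/(size (m :: s)) -ec.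
    move/(pathP m): ps => /(_ _ lt2) /asboolP; rewrite -ec nth_index //.
    by rewrite -[nth m s _]/(nth m (m :: s) (index v c).+1) -ec.
  have [u Uu] : exists u, U [set c | nth m c (index v c).+1 = u].
    by apply: (pick (s := Nv)); apply: filterS Unext => c [_ _ /hNv].
  have Ui : U [set c | index u c = (index v c).+1].
    apply: (evt_and (W := [::]) Unext Uu) => c [/and3P[un _ _] _] _ [_ sz _] /= <-.
    by rewrite index_uniq.
  exists u; split.
  + by apply: filterS Ui => c /= ->.
  + by have [c [_ _ [[_ _ +] /= e1]]] := evt_ex [::] (filterI Unext Uu); rewrite e1.
  + move=> y vy; have [->|yu] := pselect (y = u); [by left|right].
    apply: (lt_of (filterI Ui vy)) => c gc uc yc [/= e1 e2].
    by rewrite ltn_neqAle e1 e2 andbT -e1; apply/eqP => e3; apply: yu; symmetry; exact: index_inj e3.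
- move=> v vm; have [Nv hNv] := neighbours_seq lfG v.
  have Unext : U [set c : seq (gV G) | [/\ v \in c, (0 < index v c)%N
       & adj v (nth m c (index v c).-1)]].
    apply: (evt_and (W := [:: v]) UT UT) => c gc sub _ _.
    have vc : v \in c by apply: sub; rewrite inE.
    case: gc => /and3P[un cy _] [s ec].
    have i0 : (0 < index v c)%N by rewrite ec /=; case: eqP => // e1; case: vm.
    split=> //.
    have ps : path (@adjb G) m s by move: cy; rewrite ec /= rcons_path => /andP[].
    have lt1 : ((index v c).-1 < size s)%N.
      by rewrite -ltnS prednK // -[(size s).+1]/(size (m :: s)) -ec index_mem.
    move/(pathP m): ps => /(_ _ lt1) /asboolP; rewrite -ec => /adj_sym.
    suff -> : nth m s (index v c).-1 = v by [].
    by rewrite -[nth m s _]/(nth m (m :: s) (index v c).-1.+1) prednK // -ec nth_index.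
  have [u Uu] : exists u, U [set c | nth m c (index v c).-1 = u].
    by apply: (pick (s := Nv)); apply: filterS Unext => c [_ _ /hNv].
  have Ui : U [set c | (index u c).+1 = index v c].
    apply: (evt_and (W := [::]) Unext Uu) => c [/and3P[un _ _] _] _ [vc i0 _] /= <-.
    by rewrite index_uniq ?prednK // (leq_trans _ (index_size v c)) // prednK.
  exists u; split.
  + by apply: filterS Ui => c /= <-.
  + by have [c [_ _ [[_ _ +] /= e1]]] := evt_ex [::] (filterI Unext Uu); rewrite e1.
  + move=> y yv; have [->|yu] := pselect (y = u); [by left|right].
    apply: (lt_of (filterI Ui yv)) => c gc yc uc [/= e1 e2].
    by rewrite ltn_neqAle -ltnS e1 e2 andbT; apply/eqP => e3; apply: yu; exact: index_inj e3.
Qed.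

End Ultra.

Lemma outer_order_exists : exists lt M, outer_order lt m M.
Proof.
have [U [UU FU]] := ultraFilterLemma F_proper.
by have [M h] := ultra_outer_order UU FU; exists (fun x y => U [set c | (index x c < index y c)%N]), M.
Qed.

End OuterOrder.

(** * Ends as gaps of the outer order *)

(** A proper Dedekind cut whose lower part has no greatest and whose upper part has no least
    element. *)
Definition gap (G : graph) (lt : gV G -> gV G -> Prop) (m M : gV G) (A : set (gV G)) : Prop :=
  [/\ A m, ~ A M, forall u v, lt u v -> A v -> A u,
      forall a, A a -> exists2 b, A b & lt a b
    & forall b, ~ A b -> exists2 c, ~ A c & lt c b].

Section OrderGaps.
Variables (G : graph) (lt : gV G -> gV G -> Prop) (m M : gV G).
Hypotheses (oo : outer_order lt m M) (lfG : locally_finite G).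
Hypothesis cG : forall u v : gV G, conn setT u v.
Hypothesis tc : forall v a b : gV G, a <> v -> b <> v -> conn [set x | x <> v] a b.
Implicit Types (A : set (gV G)) (p q u v x : gV G).

Lemma oo_asym u v : lt u v -> ~ lt v u.
Proof. by move=> uv vu; apply: (oo_irr oo (x := u)); exact: oo_trans oo _ _ _ uv vu. Qed.

Lemma oo_trich u v : [\/ lt u v, u = v | lt v u].
Proof.
have [->|uv] := pselect (u = v); first exact: Or32.
by case: (oo_total oo uv); [exact: Or31|exact: Or33].
Qed.

Lemma oo_neq u v : lt u v -> u <> v.
Proof. by move=> uv e; apply: (oo_irr oo (x := u)); rewrite {2}e. Qed.

Definition between p q : set (gV G) := [set x | lt p x /\ lt x q].

Lemma between_closed p q a b : adj p q -> between p q a -> b <> p -> b <> q -> adj a b ->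
  between p q b.
Proof.
move=> pq [pa aq] bp bq ab; split.
  case: (oo_trich p b) => // [e|bp']; first by case: bp.
  by case: (oo_cross oo bp' pa aq (adj_sym ab) pq).
case: (oo_trich b q) => // qb.
by case: (oo_cross oo pa aq qb pq ab).
Qed.

Lemma between_component p q : adj p q -> component_union [set p; q] (between p q).
Proof.
move=> pq; split=> [a [pa aq] [] /= e|a b Da nb]; first by case: (oo_irr oo (x := a)); rewrite {1}e.
  by case: (oo_irr oo (x := a)); rewrite {2}e.
by apply: between_closed => // e; apply: nb; [left|right].
Qed.

(** Take for [Q] a path from [v] to [m]. An edge spanning [v] with both ends off the path would,
    edges not crossing, trap the path strictly under itself, but [m] lies under no edge. *)
Lemma over_edges v : exists Q : seq (gV G), v \in Q /\
  forall p q, adj p q -> lt p v -> lt v q -> p \in Q \/ q \in Q.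
Proof.
have [s [ps ls _ _]] := conn_path (cG v m).
exists (v :: s); split=> [|p q pq pv vq]; first exact: mem_head.
apply: contrapT => nQ; have mQ : m \in v :: s by rewrite -ls mem_last.
suff [pm _] : between p q m by have := oo_min oo (x := p); apply: contrapT => h;
  apply: (oo_asym pm); apply: oo_min oo _ _; exact: oo_neq.
apply: (conn_closed _ (path_conn ps mQ)) => // a b Da /= bQ ab.
by apply: between_closed pq Da _ _ ab => e; apply: nQ; rewrite -e; [left|right].
Qed.

Lemma over_component v : exists Q : seq (gV G), v \in Q /\
  component_union [set` Q] [set x | lt v x /\ x \notin Q].
Proof.
have [Q [vQ h]] := over_edges v; exists Q; split=> //; split=> [a [_ /negP]//|a b [va aQ] bQ ab].
split; last exact/negP.
case: (oo_trich v b) => // [e|bv]; first by case: bQ; rewrite /= -e.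
by case: (h b a (adj_sym ab) bv va) => // aQ'; move: aQ; rewrite aQ'.
Qed.

Definition cut (w : gend G) : set (gV G) :=
  [set v | exists r N, sval w r /\ forall k, (N <= k)%N -> lt v (r k)].

(** Deleting the finite set [Q] of [over_component] separates the vertices before [v] from those
    after it. All rays of [w] have tails in one component, hence on the same side of [v]. *)
Lemma cut_dich w v r : sval w r ->
  (cut w v /\ exists N, forall k, (N <= k)%N -> lt v (r k)) \/
  (~ cut w v /\ exists N, forall k, (N <= k)%N -> lt (r k) v).
Proof.
move=> wr; have [Q [vQ cu]] := over_component v.
have fQ : finite_set [set` Q] by exact: finite_seq.
have [u Cu] := comp_of_nonempty w fQ.
have sub D : component_union [set` Q] D -> D u -> comp_of [set` Q] w `<=` D.
  by move=> cuD Du z Cz; exact: component_union_conn cuD (comp_of_conn fQ Cu Cz) Du.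
have [Du|nDu] := pselect ([set x | lt v x /\ x \notin Q] u).
  have evt : exists N, forall k, (N <= k)%N -> lt v (r k).
    have [N hN] := comp_of_evt fQ wr; exists N => k /hN Ck.
    by have [] := sub _ cu Du _ Ck.
  by left; split=> //; have [N hN] := evt; exists r, N.
have evt r' : sval w r' -> exists N, forall k, (N <= k)%N -> lt (r' k) v.
  move=> wr'; have [N hN] := comp_of_evt fQ wr'; exists N => k /hN Ck.
  have Du : [set a | ~ [set` Q] a /\ ~ (lt v a /\ a \notin Q)] u.
    by split=> //; exact: comp_of_notS Cu.
  have [nQ nv] := sub _ (component_unionC cu) Du _ Ck.
  case: (oo_trich (r' k) v) => // [e|vr]; first by case: nQ; rewrite e.
  by case: nv; split=> //; exact/negP.
right; split; last exact: evt.
move=> [r' [N [wr' hN]]]; have [N' hN'] := evt r' wr'.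
by apply: (@oo_asym (r' (maxn N N')) v); [apply: hN'; exact: leq_maxr|apply: hN; exact: leq_maxl].
Qed.

(** Each ray of [w] eventually exceeds any given vertex of the cut and stays below any given other
    vertex. A greatest element of the cut, or a least one of its complement, would force the ray
    between two consecutive vertices. *)
Lemma cut_gap w : gap lt m M (cut w).
Proof.
have [r0 [_ wr0 _]] := end_rays w.
split.
- case: (cut_dich m wr0) => [[]//|[_ [N hN]]].
  have rm := hN N (leqnn N); case: (@oo_asym _ _ rm); apply: oo_min oo _ _.
  exact: oo_neq rm.
- move=> [r [N [_ hN]]]; have Mr := hN N (leqnn N).
  by apply: (oo_asym Mr); apply: oo_max oo _ _; apply: not_eq_sym; exact: oo_neq.
- by move=> u v uv [r [N [wr hN]]]; exists r, N; split=> // k /hN; exact: oo_trans oo _ _ _ uv.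
- move=> a ca; have aM : a <> M.
    move=> e; move: ca; rewrite e => -[r [N [_ hN]]]; have Mr := hN N (leqnn N).
    by apply: (oo_asym Mr); apply: oo_max oo _ _; apply: not_eq_sym; exact: oo_neq.
  have [u [au _ hu]] := oo_succ oo aM; exists u => //.
  case: (cut_dich u wr0) => [[]//|[_ [N hN]]].
  case: (cut_dich a wr0) => [[_ [N' hN']]|[]//].
  have h1 := hN _ (leq_maxl N N'); have h2 := hN' _ (leq_maxr N N').
  by case: (hu _ h2) => [e|/(@oo_asym _ _ h1)//]; move: h1; rewrite e => /(oo_irr oo).
- move=> b cb; case: (cut_dich b wr0) => [[]//|[_ [N hN]]].
  have bm : b <> m.
    move=> e; have h := hN N (leqnn N); rewrite e in h.
    by apply: (oo_asym h); apply: oo_min oo _ _; exact: oo_neq.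
  have [u [ub _ hu]] := oo_pred oo bm; exists u => // cu.
  case: (cut_dich u wr0) => [[_ [N' hN']]|[]//].
  have h1 := hN _ (leq_maxl N N'); have h2 := hN' _ (leq_maxr N N').
  by case: (hu _ h1) => [e|/(@oo_asym _ _ h2)//]; move: h2; rewrite e => /(oo_irr oo).
Qed.

Definition crosses A p q := [/\ adj p q, A p & ~ A q].

Lemma gap_lt A a b : gap lt m M A -> A a -> ~ A b -> lt a b.
Proof.
move=> [_ _ low _ _] Aa Ab; case: (oo_trich a b) => // [e|ba]; first by case: Ab; rewrite -e.
by case: Ab; exact: low ba Aa.
Qed.

(** Otherwise the vertices of [A] beyond [p] have no way out but [p]: edges to the far side of the
    gap are excluded by assumption, edges to vertices before [p] would cross [pq]. Then [p] is a
    cutvertex. *)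
Lemma gap_next A p q : gap lt m M A -> crosses A p q ->
  exists p' q', crosses A p' q' /\ lt p p'.
Proof.
move=> gA [pq Ap Aq]; apply: contrapT => no.
have [_ _ low nomax _] := gA; have [x0 Ax0 px0] := nomax p Ap.
suff [_ //] : lt p q /\ A q.
apply: (@conn_closed _ [set x | x <> p] (fun x => lt p x /\ A x) x0 q) => //; last first.
  by apply: tc; [apply: not_eq_sym; exact: oo_neq|apply: not_eq_sym; apply: oo_neq; exact: gap_lt gA _ _].
move=> a b [pa Aa] bp ab.
have Ab : A b by apply: contrapT => Ab; apply: no; exists a, b.
split=> //; case: (oo_trich p b) => // [e|bp']; first by case: bp.
by case: (oo_cross oo bp' pa (gap_lt gA Aa Aq) (adj_sym ab) pq).
Qed.

Lemma seq_max (P : set (gV G)) (L : seq (gV G)) : (exists2 p, P p & p \in L) ->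
  exists2 p, P p & forall p', P p' -> p' \in L -> ~ lt p p'.
Proof.
elim: L => [[p _]//|x L IH hex].
have [/IH [p Pp hp]|no] := pselect (exists2 p, P p & p \in L); last first.
  have [Px|nPx] := pselect (P x).
    exists x => // p' Pp'; rewrite inE => /predU1P[->|p'L]; first exact: oo_irr oo _.
    by case: no; exists p'.
  case: hex => p Pp; rewrite inE => /predU1P[e|pL]; first by case: nPx; rewrite -e.
  by case: no; exists p.
have [[Px px]|nx] := pselect (P x /\ lt p x).
  exists x => // p' Pp'; rewrite inE => /predU1P[->|p'L]; first exact: oo_irr oo _.
  by move=> xp'; apply: (hp p') => //; exact: oo_trans oo _ _ _ px xp'.
by exists p => // p' Pp'; rewrite inE => /predU1P[e|]; [by move=> px; apply: nx; rewrite -e|exact: hp].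
Qed.

(** If no left end lies beyond [a], all edges across the gap span some [b] beyond [a], so they meet
    the finite set of [over_edges]. By local finiteness only finitely many left ends occur, and
    [gap_next] contradicts the largest. *)
Lemma gap_left A a : gap lt m M A -> A a -> exists p q, crosses A p q /\ lt a p.
Proof.
move=> gA Aa; apply: contrapT => no.
have [Am AM low nomax _] := gA; have [b Ab ab] := nomax a Aa.
have [Q [bQ hQ]] := over_edges b.
have [N hN] := choice (neighbours_seq lfG).
pose L := Q ++ flatten [seq N q | q <- Q].
have inL p q : crosses A p q -> p \in L.
  move=> [pq Ap Aq]; rewrite mem_cat.
  have pb : lt p b.
    case: (oo_trich p b) => // [e|bp]; case: no; exists p, q; split=> //; first by rewrite e.
    exact: oo_trans oo _ _ _ ab bp.
  case: (hQ p q pq pb (gap_lt gA Ab Aq)) => [->//|qQ].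
  apply/orP; right; apply/flattenP; exists (N q); first exact: map_f.
  by apply: hN; exact: adj_sym.
have mM : crosses A m M by split=> //; exact: oo_adj oo.
have [|p [q cpq] hp] := @seq_max [set p | exists q, crosses A p q] L.
  by exists m; [exists M|exact: inL mM].
have [p' [q' [cpq' pp']]] := gap_next gA cpq.
by apply: (hp p') => //; [exists q'|exact: inL cpq'].
Qed.

Lemma crosses_nested A p1 q1 p2 q2 : gap lt m M A -> crosses A p1 q1 -> crosses A p2 q2 ->
  exists p q, [/\ crosses A p q, p1 = p \/ lt p1 p, p2 = p \/ lt p2 p,
                  q = q1 \/ lt q q1 & q = q2 \/ lt q q2].
Proof.
move=> gA c1 c2; have [e1 A1 B1] := c1; have [e2 A2 B2] := c2.
case: (oo_trich p1 p2) => [h|h|h].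
- exists p2, q2; split=> //; [by right|by left| |by left].
  case: (oo_trich q2 q1) => [|->|h']; [by right|by left|].
  by case: (oo_cross oo h (gap_lt gA A2 B1) h' e1 e2).
- case: (oo_trich q1 q2) => h'.
  + by exists p1, q1; split=> //; [left|left|left|right].
  + by exists p1, q1; split=> //; left.
  + by exists p2, q2; split=> //; [left|left|right|left].
- exists p1, q1; split=> //; [by left|by right|by left|].
  case: (oo_trich q1 q2) => [|->|h']; [by right|by left|].
  by case: (oo_cross oo h (gap_lt gA A1 B2) h' e2 e1).
Qed.

(** The vertices under [pq] that cannot reach [q] without leaving this interval would have no
    outside neighbour except [p], making [p] a cutvertex. *)
Lemma between_conn p q x : adj p q -> between p q x ->
  conn [set z | lt p z /\ (z = q \/ lt z q)] x q.
Proof.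
move=> pq bx; apply: contrapT => nc.
pose Z := [set z | between p q z /\ ~ conn [set z | lt p z /\ (z = q \/ lt z q)] z q].
suff [[_ /(oo_irr oo)//] _] : Z q.
have [px xq] := bx.
apply: (@conn_closed _ [set x | x <> p] Z x q) => //; last first.
  apply: tc; apply: not_eq_sym; first exact: oo_neq.
  by apply: oo_neq; exact: oo_trans oo _ _ _ px xq.
move=> a b [[pa aq] na] bp ab.
have pq' : lt p q by exact: oo_trans oo _ _ _ pa aq.
have nbq : b <> q.
  move=> e; apply: na; apply: conn_adj; [by split=> //; right|by split=> //; left|by rewrite -e].
have [pb bq] := between_closed pq (conj pa aq) bp nbq ab.
split=> // nb; apply: na; apply: conn_trans nb.
by apply: conn_adj => //; split=> //; right.
Qed.

End OrderGaps.

Section EndsGaps.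
Variables (G : graph) (lt : gV G -> gV G -> Prop) (m M : gV G).
Hypotheses (oo : outer_order lt m M) (lfG : locally_finite G).
Hypothesis cG : forall u v : gV G, conn setT u v.
Hypothesis tc : forall v a b : gV G, a <> v -> b <> v -> conn [set x | x <> v] a b.
Implicit Types (A : set (gV G)) (p q u v x : gV G).

Let trans := oo_trans oo.

Lemma gap_rev A : gap lt m M A -> gap (fun x y => lt y x) M m (~` A).
Proof.
case=> Am AM low nomax nomin; split=> //.
- by move=> u v vu nAv Au; apply: nAv; exact: low vu Au.
- by move=> a /contrapT /nomax [b Ab ab]; exists b => // nAb; exact: nAb.
Qed.

Lemma gap_right A b : gap lt m M A -> ~ A b -> exists p q, crosses A p q /\ lt q b.
Proof.
move=> gA Ab.
have [q [p [[qp Aq Ap] qb]]] := gap_left (outer_order_rev oo) lfG cG tc (gap_rev gA) Ab.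
exists p, q; split=> //; split; [exact: adj_sym|exact: contrapT|exact: Aq].
Qed.

(** Edges across a gap are nested and close in on it from both sides, so one of them keeps all of
    [F] outside its closed interval. These intervals serve as neighbourhoods of the end at the
    gap. *)
Lemma gap_edge A (F : seq (gV G)) : gap lt m M A -> exists p q,
  crosses A p q /\ forall x, x \in F -> (A x -> lt x p) /\ (~ A x -> lt q x).
Proof.
move=> gA; have [Am AM low nomax nomin] := gA.
elim: F => [|x F [p [q [cpq hF]]]].
  by exists m, M; split=> //; split=> //; exact: oo_adj oo.
have [p' [q' [cpq' hx]]] : exists p' q', crosses A p' q' /\ ((A x -> lt x p') /\ (~ A x -> lt q' x)).
  have [Ax|Ax] := pselect (A x).
    by have [p' [q' [c h]]] := gap_left oo lfG cG tc gA Ax; exists p', q'; split.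
  by have [p' [q' [c h]]] := gap_right gA Ax; exists p', q'; split.
have [p2 [q2 [c2 l1 l2 l3 l4]]] := crosses_nested oo gA cpq cpq'.
exists p2, q2; split=> // y; rewrite inE => /predU1P[->|yF].
  split=> Ax; first by case: l2 => [<-|]; [exact: hx.1|exact: trans (hx.1 Ax)].
  by case: l4 => [->|l]; [exact: hx.2|exact: trans l (hx.2 Ax)].
split=> Ay; first by case: l1 => [<-|]; [exact: (hF y yF).1|exact: trans ((hF y yF).1 Ay)].
by case: l3 => [->|l]; [exact: (hF y yF).2|exact: trans l ((hF y yF).2 Ay)].
Qed.

(** For a finite separator choose [pq] across the common gap with the separator outside its
    interval. Rays of both ends finally run under [pq] and reach [q] inside the interval by
    [between_conn], so they are equivalent. *)
Lemma cut_inj (w1 w2 : gend G) : cut lt w1 = cut lt w2 -> w1 = w2.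
Proof.
move=> ecut.
have equiv (w w' : gend G) r r' : cut lt w = cut lt w' -> sval w r -> sval w' r' -> ray_equiv r r'.
  move=> ew wr wr' S /finite_seqP [F ->].
  have gA := cut_gap oo cG w.
  have [p [q [[pq Ap Aq] hF]]] := gap_edge F gA.
  have evt w0 r0 : cut lt w0 = cut lt w -> sval w0 r0 -> exists N, tail_avoids [set` F] r0 N /\
      conn (~` [set` F]) (r0 N) q.
    move=> ew0 wr0; rewrite -ew0 in gA Ap Aq hF.
    case: (cut_dich oo cG p wr0) => [[_ [N1 h1]]|[]//].
    case: (cut_dich oo cG q wr0) => [[]//|[_ [N2 h2]]].
    have av x : lt p x -> x = q \/ lt x q -> ~ x \in F.
      move=> px xq xF; have [h3 h4] := hF x xF.
      have [Ax|Ax] := pselect (cut lt w0 x); first exact: (oo_asym oo px (h3 Ax)).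
      by case: xq => [e|xq]; [apply: (oo_irr oo (x := x)); rewrite {1}e; exact: h4
         |exact: (oo_asym oo xq (h4 Ax))].
    exists (maxn N1 N2); split.
      by move=> k; rewrite geq_max => /andP[k1 k2]; apply: av; [exact: h1|right; exact: h2].
    apply: conn_sub (between_conn oo tc pq _); first by move=> z [pz zq]; exact: av.
    by split; [apply: h1; exact: leq_maxl|apply: h2; exact: leq_maxr].
  have [N [aN cN]] := evt w r erefl wr; have [N' [aN' cN']] := evt w' r' (esym ew) wr'.
  by exists N, N'; split=> //; split=> //; apply: conn_trans cN (conn_sym cN').
have sub (w w' : gend G) : cut lt w = cut lt w' -> sval w `<=` sval w'.
  move=> ew r wr; have [r0 [_ _ hw]] := end_rays w; have [r0' [_ wr0' hw']] := end_rays w'.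
  by apply/hw'; split; [have [] := (hw r).1 wr|exact: equiv (esym ew) wr0' wr].
have es : sval w1 = sval w2 by apply/seteqP; split; apply: sub.
by case: w1 w2 es {ecut} => E1 h1 [E2 h2] /= es; subst E2; congr exist; exact: Prop_irrelevance.
Qed.

Lemma gap_end A : gap lt m M A -> exists w : gend G, cut lt w = A.
Proof.
move=> gA; have [Am AM low nomax nomin] := gA.
(* The greedy ray: from [a] go to its last neighbour within [A]. The successor of [a] is a neighbour
   in [A], since [A] has no greatest element, so the ray always advances. *)
have [nx hnx] : exists nx : gV G -> gV G, forall a, A a ->
    [/\ A (nx a), lt a (nx a), adj a (nx a) & forall c, A c -> adj a c -> ~ lt (nx a) c].
  suff /choice [nx h] : forall a, exists b, A a ->
    [/\ A b, lt a b, adj a b & forall c, A c -> adj a c -> ~ lt b c] by exists nx.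
  move=> a; have [Aa|nAa] := pselect (A a); last by exists a.
  have aM : a <> M by move=> e; apply: AM; rewrite -e.
  have [u [au adu hu]] := oo_succ oo aM.
  have Au : A u.
    by have [b Ab ab] := nomax a Aa; case: (hu b ab) => [<-//|ub]; exact: low ub Ab.
  have [N hN] := neighbours_seq lfG a.
  have [|b [Ab ab adb] hb] := @seq_max _ _ _ _ oo [set c | [/\ A c, lt a c & adj a c]] N.
    by exists u; [split|exact: hN].
  exists b => _; split=> // c Ac ac bc; apply: (hb c) => //; last exact: hN.
  by split=> //; exact: trans ab bc.
pose r k := iter k nx m.
have Ar k : A (r k) by elim: k => //= k /hnx [].
have rS k : [/\ lt (r k) (r k.+1), adj (r k) (r k.+1)
    & forall c, A c -> adj (r k) c -> ~ lt (r k.+1) c] by have [] := hnx _ (Ar k); split.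
have rmono i j : (i < j)%N -> lt (r i) (r j).
  elim: j => // j IH; rewrite ltnS leq_eqVlt => /predU1P[->|/IH h]; first by have [] := rS j.
  by apply: trans h _; have [] := rS j.
have rr : ray r.
  split=> [i j e|k]; last by have [] := rS k.
  by case: (ltngtP i j) => // /rmono; rewrite e => /(oo_irr oo).
have [w wr] : exists w : gend G, sval w r.
  have h : exists r0, ray r0 /\ [set r' | ray r' /\ ray_equiv r r'] =
     [set r' | ray r' /\ ray_equiv r0 r'] by exists r.
  exists (exist (fun E : set (nat -> gV G) => exists r0, ray r0 /\
     E = [set r' | ray r' /\ ray_equiv r0 r']) _ h).
  by split=> //; exact: ray_equiv_refl.
have conv v : A v -> exists k, lt v (r k).
  move=> Av; apply: contrapT => no.
  pose A' := [set v | exists k, lt v (r k)].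
  have rA' k : A' (r k) by exists k.+1; exact: rmono.
  have gA' : gap lt m M A'.
    split.
    - exact: (rA' 0%N).
    - by move=> [k Mr]; apply: AM; exact: low Mr (Ar k).
    - by move=> a b ab [k bk]; exists k; exact: trans ab bk.
    - by move=> a [k ak]; exists (r k).
    - move=> b nb; have bm : b <> m by move=> e; apply: nb; rewrite e; exact: (rA' 0%N).
      have [u [ub _ hu]] := oo_pred oo bm; exists u => // -[k uk].
      case: (oo_trich oo (r k) b) => [rb|e|br]; last by apply: nb; exists k.
      + by case: (hu _ rb) => [e|h]; [move: uk; rewrite e => /(oo_irr oo)|exact: (oo_asym oo uk h)].
      + by apply: nb; rewrite -e; exact: rA'.
  (* If the ray stayed below [v], its initial segment [A'] would be an earlier gap. Take an edge
     [st] across it with [t] before [v], hence in [A]: the ray either visits [s] and should have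
     gone on at least to [t], or jumps over [s] and crosses [st]. *)
  have [s [t [[st [k sk] At] hF]]] := gap_edge [:: v] gA'.
  have [_ /(_ no) tv] := hF v (mem_head _ _).
  have rt j : lt (r j) t by apply: gap_lt gA' (rA' j) At.
  elim: k sk => [sk|k IH sk].
    by apply: (oo_asym oo sk); apply: oo_min oo _ _; exact: (oo_neq oo sk).
  have [rk1 adk mk] := rS k.
  case: (oo_trich oo s (r k)) => [//|e|h].
    by apply: (mk t) (rt _); [exact: low tv Av|rewrite -e].
  exact: (oo_cross oo h sk (rt _) adk st).
exists w; apply/seteqP; split=> v.
  move=> cv; apply: contrapT => nAv.
  case: (cut_dich oo cG v wr) => [[_ [N hN]]|[]//].
  exact: (oo_asym oo (hN N (leqnn N)) (gap_lt oo gA (Ar N) nAv)).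
move=> Av; have [k vk] := conv v Av; exists r, k; split=> // j.
by rewrite leq_eqVlt => /predU1P[<-//|/rmono]; exact: trans vk.
Qed.

Lemma comp_between w p q : crosses (cut lt w) p q -> comp_of [set p; q] w `<=` between lt p q.
Proof.
move=> [pq Ap Aq]; have cu := between_component oo pq.
have fS : finite_set [set p; q] by exact: finite_set2.
have [r0 [_ wr0 _]] := end_rays w.
have [N hN] := comp_of_evt fS wr0.
case: (cut_dich oo cG p wr0) => [[_ [N1 h1]]|[]//].
case: (cut_dich oo cG q wr0) => [[]//|[_ [N2 h2]]].
pose k := maxn N (maxn N1 N2).
have Ck : comp_of [set p; q] w (r0 k) by apply: hN; exact: leq_maxl.
have Dk : between lt p q (r0 k).
  by split; [apply: h1|apply: h2]; rewrite /k; lia.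
by move=> z Cz; exact: component_union_conn cu (comp_of_conn fS Ck Cz) Dk.
Qed.

Lemma cut_between w p q : crosses (cut lt w) p q <->
  adj p q /\ lt p q /\ comp_of [set p; q] w `<=` between lt p q.
Proof.
split=> [c|[pq [ltpq sub]]].
  have [pq Ap Aq] := c; split=> //; split; last exact: comp_between.
  exact: (gap_lt oo (cut_gap oo cG w) Ap Aq).
have fS : finite_set [set p; q] by exact: finite_set2.
have [r0 [_ wr0 _]] := end_rays w.
have [N hN] := comp_of_evt fS wr0.
have hb k : (N <= k)%N -> between lt p q (r0 k) by move=> /hN /sub.
split=> //; first by exists r0, N; split=> // k /hb [].
move=> cq; case: (cut_dich oo cG q wr0) => [[_ [N2 h2]]|[]//].
have [_ h] := hb _ (leq_maxl N N2).
exact: (oo_asym oo h (h2 _ (leq_maxr N N2))).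
Qed.

End EndsGaps.

(** * A summable weight on the vertices *)

Lemma locally_finite_countable (G : graph) : locally_finite G ->
  (forall u v : gV G, conn setT u v) -> exists nu : gV G -> nat, injective nu.
Proof.
move=> lfG cG; have [[v0]|nV] := pselect (inhabited (gV G)); last first.
  by exists (fun=> 0%N) => x; case: nV; exact: inhabits.
have [N hN] := choice (neighbours_seq lfG).
pose B k := iter k (fun s => flatten [seq N q | q <- s]) [:: v0].
have cov : [set: gV G] `<=` \bigcup_k [set` B k].
  move=> v _; apply: (@conn_closed _ setT _ v0 v) => [a b [k _ ak] _ ab||]; first 1 last.
  - exact: cG.
  - by exists 0%N => //=; rewrite inE.
  exists k.+1 => //=; apply/flattenP; exists (N a); first exact: map_f.
  exact: hN.
have /countable_injP [nu hnu] : countable [set: gV G].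
  apply: sub_countable (subset_card_le cov) _.
  by apply: bigcup_countable => // k _; apply: finite_set_countable; exact: finite_seq.
by exists nu => x y; apply: hnu; rewrite inE.
Qed.

Section Weight.
Variables (V : choiceType) (nu : V -> nat).
Hypothesis nui : injective nu.
Implicit Types A B : set V.

Let term A k : R := if `[< exists2 v, A v & nu v = k >] then 2^-1 ^+ k.+1 else 0.
Let psum A n : R := \sum_(k < n) term A k.

(** The sum of [2^-1 ^+ (nu v).+1] over [v] in [A]; each exponent occurs at most once as [nu] is
    injective. *)
Definition weight A : R := sup (range (psum A)).

Let half_gt0 k : 0 < (2^-1 : R) ^+ k.
Proof. by apply: exprn_gt0; rewrite invr_gt0. Qed.

Let term_ge0 A k : 0 <= term A k.
Proof. by rewrite /term; case: asboolP => // _; exact: ltW. Qed.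

Let term_le A k : term A k <= 2^-1 ^+ k.+1.
Proof. by rewrite /term; case: asboolP => // _; exact: ltW. Qed.

Let psum_mono A n k : psum A n <= psum A (n + k).
Proof.
elim: k => [|k IH]; first by rewrite addn0.
by rewrite addnS /psum big_ord_recr /= ; apply: le_trans IH _; rewrite lerDl.
Qed.

Let psum_tail A n k : psum A (n + k) <= psum A n + 2^-1 ^+ n - 2^-1 ^+ (n + k).
Proof.
elim: k => [|k IH]; first by rewrite addn0 addrK.
rewrite addnS /psum big_ord_recr /=; have := term_le A (n + k).
rewrite exprS; move: IH; rewrite /psum; lra.
Qed.

Let psum_ub A n k : psum A k <= psum A n + 2^-1 ^+ n.
Proof.
have [nk|/ltnW kn] := leqP n k.
  rewrite -(subnKC nk); have := psum_tail A n (k - n); have := half_gt0 (n + (k - n)); lra.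
rewrite -(subnKC kn); have := psum_mono A k (n - k); have := half_gt0 (k + (n - k)); lra.
Qed.

Let psum_has_sup A : has_sup (range (psum A)).
Proof.
split; first by exists (psum A 0), 0%N.
by exists (psum A 0 + 2^-1 ^+ 0) => _ [k _ <-]; exact: psum_ub.
Qed.

Let psum_le A n : psum A n <= weight A.
Proof. by apply: sup_upper_bound (psum_has_sup A) _ _; exists n. Qed.

Let weight_le A n : weight A <= psum A n + 2^-1 ^+ n.
Proof.
apply: ge_sup; first by exists (psum A 0), 0%N.
by move=> _ [k _ <-]; exact: psum_ub.
Qed.

Lemma weight0 : weight set0 = 0.
Proof.
have z n : psum set0 n = 0.
  by apply: big1 => k _; rewrite /term asboolF // => -[].
apply/eqP; rewrite eq_le; apply/andP; split; last by rewrite -(z 0%N).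
by apply: ge_sup; [exists (psum set0 0), 0%N|move=> _ [k _ <-]; rewrite z].
Qed.

Lemma weight_lt A B u : A `<=` B -> B u -> ~ A u -> weight A < weight B.
Proof.
move=> AB Bu Au; pose c : R := 2^-1 ^+ (nu u).+1.
have termAB k : term A k <= term B k.
  rewrite /term; case: asboolP => [[v Av vk]|_]; last by case: asboolP => // _; exact: ltW.
  by rewrite asboolT //; exists v => //; exact: AB.
have key n : (nu u < n)%N -> psum A n + c <= psum B n.
  move=> un; rewrite /psum (bigD1 (Ordinal un)) //= [X in _ <= X](bigD1 (Ordinal un)) //=.
  have -> : term A (nu u) = 0.
    by rewrite /term asboolF // => -[v Av /nui e]; apply: Au; rewrite -e.
  have -> : term B (nu u) = c by rewrite /term asboolT //; exists u.
  by rewrite add0r [X in X <= _]addrC lerD2l; apply: ler_sum.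
suff : weight A <= weight B - c by have := half_gt0 (nu u).+1; rewrite -/c; lra.
apply: ge_sup; first by exists (psum A 0), 0%N.
move=> _ [k _ <-]; have := psum_mono A k (nu u).+1.
have := key (k + (nu u).+1)%N; rewrite addnS ltnS leq_addl => /(_ isT).
have := psum_le B (k + nu u).+1; lra.
Qed.

Lemma weight_continuous (e : R) : 0 < e -> exists F : seq V, forall A B,
  (forall v, v \in F -> A v <-> B v) -> `|weight A - weight B| <= e.
Proof.
move=> e0.
have [n hn] : exists n, 2^-1 ^+ n <= e.
  have ei0 : 0 <= e^-1 by rewrite invr_ge0 ltW.
  have := archi_boundP ei0; set n := Num.bound _ => hn; exists n.
  rewrite exprVn -[e]invrK lef_pV2 ?posrE ?invr_gt0 ?exprn_gt0 //.
  apply: le_trans (ltW hn) _; rewrite -natrX ler_nat; exact/ltnW/ltn_expl.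
have [F hF] : exists F : seq V, forall v, (nu v < n)%N -> v \in F.
  elim: n {hn} => [|n [F hF]]; first by exists [::].
  have [[u un]|no] := pselect (exists u, nu u = n).
    exists (u :: F) => v; rewrite ltnS leq_eqVlt inE => /predU1P[e1|/hF ->]; last by rewrite orbT.
    by apply/orP; left; apply/eqP/nui; rewrite e1.
  exists F => v; rewrite ltnS leq_eqVlt => /predU1P[e1|/hF //].
  by case: no; exists v.
exists F => A B AB.
have ps : psum A n = psum B n.
  apply: eq_bigr => k _; rewrite /term; congr (if _ then _ else _).
  apply/asboolP/asboolP => -[v Av vk]; exists v => //; apply/AB => //; apply: hF; rewrite vk //.
have := psum_le A n; have := psum_le B n; have := weight_le A n; have := weight_le B n.
rewrite ps => h1 h2 h3 h4; rewrite ler_norml; apply/andP; split; lra.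
Qed.

End Weight.

(** * Compactness *)

Section Compactness.
Variables (G : graph) (lt : gV G -> gV G -> Prop) (m M : gV G).
Hypotheses (oo : outer_order lt m M) (lfG : locally_finite G).
Hypothesis cG : forall u v : gV G, conn setT u v.
Hypothesis tc : forall v a b : gV G, a <> v -> b <> v -> conn [set x | x <> v] a b.

Definition right_of (v : gV G) : set (gpt G) := fun p => match p with
  | PV u => lt v u
  | PE x _ => lt v (src x) /\ lt v (tgt x)
  | PEnd w => cut lt w v end.

Definition left_of (v : gV G) : set (gpt G) := fun p => match p with
  | PV u => lt u v
  | PE x _ => lt (src x) v /\ lt (tgt x) v
  | PEnd w => ~ cut lt w v end.

Definition closed_edge (x : gE G) : set (gpt G) := edge_map x @` `[(0 : R), 1]%classic.

Lemma closed_edge_compact x : compact (closed_edge x).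
Proof.
apply: continuous_compact; last exact: segment_compact.
exact/continuous_subspaceT/edge_map_continuous.
Qed.

Lemma closed_edgeV x : closed_edge x (PV (src x)) /\ closed_edge x (PV (tgt x)).
Proof.
split; [exists 0; rewrite ?edge_map0 //=|exists 1; rewrite ?edge_map1 //=]; by rewrite in_itv /= lexx ler01.
Qed.

Lemma closed_edgeE x t : closed_edge x (PE x t).
Proof.
exists (sval t); last exact: edge_map_val.
by have /andP[t0 t1] := proj2_sig t; rewrite /= in_itv /= !ltW.
Qed.

Lemma vertex_edge v : exists x : gE G, src x = v \/ tgt x = v.
Proof.
have [vm|vm] := pselect (v = m).
  by have [x hx] := oo_adj oo; exists x; rewrite vm; case: hx => -[]; [left|right].
have [p [pp lp _ _]] := conn_path (cG v m).
case: p pp lp => [_ /= //|z p /= /andP[/asboolP [x hx] _] _].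
by exists x; case: hx => -[]; [left|right].
Qed.

(** * Ultrafilters that contain no closed edge *)

Section UltraLimit.
Variable F : set_system (gpt G).
Hypothesis UF : UltraFilter F.
Hypothesis noedge : forall x, ~ F (closed_edge x).

Lemma avoid_edges (s : seq (gE G)) : F [set p | forall x, x \in s -> ~ closed_edge x p].
Proof.
elim: s => [|x s IH]; first by apply: filterS filterT => p _ x; rewrite in_nil.
have [/noedge //|Fx] := in_ultra_setVsetC (closed_edge x) UF.
by apply: filterS (filterI Fx IH) => p [nx hs] y; rewrite inE => /predU1P[->|/hs].
Qed.

Lemma avoid_vertices (Q : seq (gV G)) : F [set p | match p with
  | PV u => u \notin Q | PE x _ => src x \notin Q /\ tgt x \notin Q | PEnd _ => True end].
Proof.
have inc v : exists s : seq (gE G), forall x, src x = v \/ tgt x = v -> x \in s.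
  have /finite_seqP [s hs] := lfG v; exists s => x hx.
  by have : [set` s] x by rewrite -hs.
have [I hI] := choice inc.
apply: filterS (avoid_edges (flatten [seq I v | v <- Q])) => p hp.
have bad x v : v \in Q -> src x = v \/ tgt x = v -> ~ closed_edge x p.
  move=> vQ hx; apply: hp; apply/flattenP; exists (I v); [exact: map_f|exact: hI].
case: p hp bad => [u|x t|//] hp bad.
  apply/negP => uQ; have [x hx] := vertex_edge u; apply: (bad x u uQ hx).
  by case: hx => <-; [exact: (closed_edgeV x).1|exact: (closed_edgeV x).2].
split; apply/negP => hQ; apply: (bad x _ hQ); try exact: closed_edgeE; by [left|right].
Qed.

(** The points on neither side are [v] and the edges that span or touch [v]. All these meet the
    finite set of [over_edges], whose vertices and incident edges the ultrafilter avoids. *)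
Lemma ultra_side v : F (right_of v) \/ F (left_of v).
Proof.
have [Q [vQ hQ]] := over_edges oo cG v.
have [|h] := in_ultra_setVsetC (right_of v) UF; first by left.
right; apply: filterS (filterI h (avoid_vertices Q)) => p [/=].
case: p => [u|x t|w] //=.
  move=> nvu uQ; case: (oo_trich oo u v) => // e; by move: uQ; rewrite e vQ.
move=> nr [sQ tQ].
have dich u : u \notin Q -> lt u v \/ lt v u.
  by move=> uQ; apply: oo_total oo _ _ _ => e; move: uQ; rewrite e vQ.
case: (dich _ sQ) (dich _ tQ) => sv [] tv //; [| |by case: nr].
- by case: (hQ _ _ (adj_edge x) sv tv) => h'; [move: sQ|move: tQ]; rewrite h'.
- by case: (hQ _ _ (adj_sym (adj_edge x)) tv sv) => h'; [move: tQ|move: sQ]; rewrite h'.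
Qed.

Lemma right_left_empty u v p : lt u v -> (forall z, lt u z -> ~ lt z v) ->
  right_of u p -> left_of v p -> False.
Proof.
move=> uv con; case: p => [z|x t|w] /=; [exact: con|by move=> [h _] [h' _]; exact: (con _ h h')|].
move=> cu; have [_ _ low nomax _] := cut_gap oo cG w; have [b cb ub] := nomax u cu; apply.
by case: (oo_trich oo v b) => [vb|->//|/(con b ub)//]; exact: low vb cb.
Qed.

(** The vertices that the ultrafilter lies to the right of form an initial segment. No point lies
    between two consecutive vertices in the sense of [right_left_empty], so this segment is a gap,
    and its end is the limit. *)
Lemma ultra_cvg_end : exists w, F --> PEnd w.
Proof.
pose A := [set v | F (right_of v)].
have Fne (B : set (gpt G)) : F B -> (forall p, ~ B p) -> False.
  by move=> FB nB; have [p /nB] := filter_ex FB.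
have cutm w : cut lt w m by have [] := cut_gap oo cG w.
have cutM w : ~ cut lt w M by have [] := cut_gap oo cG w.
have ltm v : ~ lt v m.
  by move=> vm; apply: (oo_asym oo vm); apply: oo_min oo _ _; exact: (oo_neq oo vm).
have ltM v : ~ lt M v.
  move=> Mv; apply: (oo_asym oo Mv); apply: oo_max oo _ _; exact/not_eq_sym/(oo_neq oo Mv).
have nA v : ~ A v -> F (left_of v) by move=> nv; case: (ultra_side v).
have step u v : lt u v -> (forall z, lt u z -> ~ lt z v) -> A u -> ~ A v -> False.
  move=> uv con Au /nA Lv; apply: (Fne _ (filterI Au Lv)) => p [h1 h2].
  exact: (right_left_empty uv con h1 h2).
have gA : gap lt m M A.
  split.
  - apply: contrapT => /nA /Fne; apply; case=> [u /ltm //|x t [/ltm //]|w /=]; apply; exact: cutm.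
  - by move/Fne; apply; case=> [u /ltM //|x t [/ltM //]|w /cutM].
  - move=> u v uv; apply: filterS; case=> [z|x t [h1 h2]|w] /=; first exact: oo_trans oo _ _ _ uv.
      by split; exact: oo_trans oo _ _ _ uv _.
    by have [_ _ low _ _] := cut_gap oo cG w; exact: low.
  - move=> a Aa; have aM : a <> M.
      move=> e; apply: (Fne _ Aa); rewrite e.
      by case=> [u /ltM //|x t [/ltM //]|w /cutM].
    have [u [au _ hu]] := oo_succ oo aM; exists u => //; apply: contrapT => nAu.
    apply: (step a u) => // z az zu; case: (hu z az) => [e|uz].
      by move: zu; rewrite e => /(oo_irr oo).
    exact: (oo_asym oo zu uz).
  - move=> b nb; have bm : b <> m.
      move=> e; apply: (Fne _ (nA _ nb)); rewrite e.
      by case=> [u /ltm //|x t [/ltm //]|w /=]; apply; exact: cutm.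
    have [u [ub _ hu]] := oo_pred oo bm; exists u => // Au.
    apply: (step u b) => // z uz zb; case: (hu z zb) => [e|zu].
      by move: uz; rewrite e => /(oo_irr oo).
    exact: (oo_asym oo zu uz).
have [w cw] := gap_end oo lfG cG tc gA.
exists w; apply: cvg_subbasic => B [[nend _] /nend //|[S [w0 [fS ->]]] Cw].
have /finite_seqP [Fs eS] := fS.
(* With [S] outside the interval of [pq], everything right of [p] and left of [q] lies in the given
   neighbourhood, because the vertices under [pq] are joined through [q] off [S]. *)
have [p [q [[pq Ap Aq] hF]]] := gap_edge oo lfG cG tc Fs gA.
apply: filterS (filterI Ap (nA _ Aq)) => z.
pose I := [set z | lt p z /\ (z = q \/ lt z q)].
have IS : I `<=` ~` S.
  move=> x [px xq]; rewrite eS /= => xF; have [h1 h2] := hF x xF.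
  have [Ax|Ax] := pselect (A x); first exact: (oo_asym oo px (h1 Ax)).
  by case: xq => [e|xq]; [apply: (oo_irr oo (x := x)); rewrite {1}e; exact: h2
     |exact: (oo_asym oo xq (h2 Ax))].
have evt w' r : cut lt w' p -> ~ cut lt w' q -> sval w' r -> exists N, forall k, (N <= k)%N ->
    between lt p q (r k).
  move=> cp cq wr.
  case: (cut_dich oo cG p wr) => [[_ [N1 h1]]|[]//].
  case: (cut_dich oo cG q wr) => [[]//|[_ [N2 h2]]].
  by exists (maxn N1 N2) => k; rewrite geq_max => /andP[k1 k2]; split; [exact: h1|exact: h2].
have bC x : between lt p q x -> comp_of S w0 x.
  move=> bx; have [r0 [_ wr0 _]] := end_rays w.
  have [N1 h1] := Cw r0 wr0; have [|| N2 h2] := @evt w r0 _ _ wr0; try by rewrite cw.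
  have Ck := h1 _ (leq_maxl N1 N2); have bk := h2 _ (leq_maxr N1 N2).
  apply: (@conn_closed _ (~` S) (comp_of S w0) _ x _ _ Ck).
    by move=> a b Ca Sb ab; exact: comp_of_closed Ca Sb ab.
  apply: (conn_sub IS); apply: conn_trans (between_conn oo tc pq bk) _.
  exact/conn_sym/(between_conn oo tc pq bx).
case: z => [z|x t|w'] /= [h1 h2].
- exact: bC.
- have bs : comp_of S w0 (src x) by apply: bC; split; [exact: h1.1|exact: h2.1].
  have bt : comp_of S w0 (tgt x) by apply: bC; split; [exact: h1.2|exact: h2.2].
  by split; [left|split; left].
- by move=> r wr; have [N hN] := evt w' r h1 h2 wr; exists N => k /hN /bC.
Qed.

End UltraLimit.

Lemma gpt_compact : compact [set: gpt G].
Proof.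
rewrite compact_ultra => F UF _.
have [[x Fx]|no] := pselect (exists x, F (closed_edge x)).
  have : compact (closed_edge x) by exact: closed_edge_compact.
  rewrite compact_ultra => /(_ F UF Fx) [p [_ Fp]].
  by exists p.
have [|w Fw] := ultra_cvg_end UF; last by exists (PEnd w).
by move=> x Fx; apply: no; exists x.
Qed.

End Compactness.

(** * Drawing in a disk *)

Lemma convex_itv (a b u v t : R) : 0 < t < 1 -> a <= u <= b -> a <= v <= b ->
  a <= (1 - t) * u + t * v <= b.
Proof.
move=> /andP[t0 t1] /andP[au ub] /andP[av vb].
have t1' : 0 < 1 - t by rewrite subr_gt0.
have e c : c = (1 - t) * c + t * c by ring.
by apply/andP; split; [rewrite [leLHS](e a)|rewrite [leRHS](e b)]; apply: lerD; rewrite ler_pM2l.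
Qed.

Lemma convex_dist (c u v t e : R) : 0 < t < 1 -> `|u - c| < e -> `|v - c| < e ->
  `|(1 - t) * u + t * v - c| < e.
Proof.
move=> /andP[t0 t1] hu hv; have t1' : 0 < 1 - t by rewrite subr_gt0.
have -> : (1 - t) * u + t * v - c = (1 - t) * (u - c) + t * (v - c) by ring.
have -> : e = (1 - t) * e + t * e by ring.
apply: le_lt_trans (ler_normD _ _) _; rewrite !normrM (gtr0_norm t1') (gtr0_norm t0).
by apply: ltrD; rewrite ltr_pM2l.
Qed.

Lemma itv_dist (a b c u d : R) : c - d <= a -> b <= c + d -> a <= u <= b -> `|u - c| <= d.
Proof.
move=> ha hb /andP[au ub]; have h1 := le_trans ha au; have h2 := le_trans ub hb.
by rewrite ler_norml; apply/andP; split; lra.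
Qed.

(** * Chords of the half circle over the segment from 0 to [T] *)

Section Semicircle.
Variable T : R.
Hypothesis T0 : 0 < T.

(** Height over [a] of the half circle with diameter from 0 to [T]. *)
Definition hgt (a : R) : R := Num.sqrt (a * (T - a)).

Lemma hgt_ge0 a : 0 <= hgt a.
Proof. exact: sqrtr_ge0. Qed.

Lemma sqr_hgt a : 0 <= a <= T -> hgt a ^+ 2 = a * (T - a).
Proof. by move=> /andP[a0 aT]; rewrite sqr_sqrtr // mulr_ge0 // subr_ge0. Qed.

Lemma hgt0 : hgt 0 = 0.
Proof. by rewrite /hgt mul0r sqrtr0. Qed.

Lemma hgtT : hgt T = 0.
Proof. by rewrite /hgt subrr mulr0 sqrtr0. Qed.

Lemma hgt_gt0 a : 0 < a < T -> 0 < hgt a.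
Proof. by move=> /andP[a0 aT]; rewrite sqrtr_gt0 mulr_gt0 // subr_gt0. Qed.

Lemma hgt_continuous : continuous hgt.
Proof.
have id_cont : continuous (fun x : R => x) by move=> x; exact: cvg_id.
have c1 : continuous (fun a : R => a * (T - a)).
  by apply: continuous_funM => //; apply: continuous_funB => //; exact: continuous_const.
exact: (continuous_funcomp c1 (@sqrt_continuous R)).
Qed.

Lemma hgt_concave a b t : 0 <= a <= T -> 0 <= b <= T -> a != b -> 0 < t < 1 ->
  (1 - t) * hgt a + t * hgt b < hgt ((1 - t) * a + t * b).
Proof.
move=> ha hb ab /andP[t0 t1].
have hc : 0 <= (1 - t) * a + t * b <= T.
  by apply: convex_itv => //; rewrite t0.
have l0 : 0 <= (1 - t) * hgt a + t * hgt b.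
  by apply: addr_ge0; apply: mulr_ge0; try exact: hgt_ge0; lra.
rewrite -(ltr_pXn2r (n := 2)) ?nnegrE ?hgt_ge0 // (sqr_hgt hc).
have key : 0 < t * (1 - t) * (b - a) ^+ 2.
  apply: mulr_gt0; first by apply: mulr_gt0; lra.
  by rewrite exprn_even_gt0 //= subr_eq0 eq_sym.
have key2 : 0 <= t * (1 - t) * (hgt a - hgt b) ^+ 2.
  by apply: mulr_ge0; [apply: mulr_ge0; lra|exact: sqr_ge0].
have ea := sqr_hgt ha; have eb := sqr_hgt hb.
have -> : ((1 - t) * a + t * b) * (T - ((1 - t) * a + t * b)) =
  (1 - t) * (a * (T - a)) + t * (b * (T - b)) + t * (1 - t) * (b - a) ^+ 2 by ring.
rewrite -ea -eb.
have -> : ((1 - t) * hgt a + t * hgt b) ^+ 2 = (1 - t) * hgt a ^+ 2 + t * hgt b ^+ 2 -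
  t * (1 - t) * (hgt a - hgt b) ^+ 2 by ring.
lra.
Qed.

(** By concavity the outer chord [L] is at most the half circle at [a'] and [b'], and strictly below
    at one of them, so it stays below the inner chord. *)
Lemma chord_nested a b a' b' t t' : 0 <= a -> a <= a' -> a' < b' -> b' <= b -> b <= T ->
  a < a' \/ b' < b -> 0 < t' < 1 ->
  (1 - t) * a + t * b = (1 - t') * a' + t' * b' ->
  (1 - t) * hgt a + t * hgt b < (1 - t') * hgt a' + t' * hgt b'.
Proof.
move=> a0 aa ab bb bT str /andP[t0 t1] e.
have ab0 : b - a != 0 by rewrite subr_eq0 gt_eqF //; lra.
pose L c := (1 - (c - a) / (b - a)) * hgt a + (c - a) / (b - a) * hgt b.
have Llt c : a < c < b -> L c < hgt c.
  move=> /andP[ac cb].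
  have ec : c = (1 - (c - a) / (b - a)) * a + (c - a) / (b - a) * b by field.
  rewrite {2}ec; apply: hgt_concave.
  - by apply/andP; split; lra.
  - by apply/andP; split; lra.
  - by rewrite lt_eqF //; lra.
  - by rewrite divr_gt0 ?subr_gt0 //=; [rewrite ltr_pdivrMr ?mul1r; lra|lra].
have Lle c : a <= c <= b -> L c <= hgt c.
  move=> /andP[ac cb].
  have [->|ca] := eqVneq c a; first by rewrite /L subrr !mul0r subr0 mul1r addr0.
  have [->|cb'] := eqVneq c b; first by rewrite /L divff // subrr mul0r mul1r add0r.
  by apply/ltW/Llt; rewrite !lt_neqAle eq_sym ca ac cb' cb.
have -> : (1 - t) * hgt a + t * hgt b = (1 - t') * L a' + t' * L b'.
  have -> : t = ((1 - t') * a' + t' * b' - a) / (b - a) by rewrite -e; field.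
  by rewrite /L; field.
have h1 : L a' <= hgt a' by apply: Lle; apply/andP; split; lra.
have h2 : L b' <= hgt b' by apply: Lle; apply/andP; split; lra.
have t1' : 0 < 1 - t' by lra.
case: str => h.
- have h3 : L a' < hgt a' by apply: Llt; apply/andP; split; lra.
  by apply: ltr_leD; [rewrite ltr_pM2l|rewrite ler_pM2l].
- have h3 : L b' < hgt b' by apply: Llt; apply/andP; split; lra.
  by apply: ler_ltD; [rewrite ler_pM2l|rewrite ltr_pM2l].
Qed.

End Semicircle.

(** * Positions, arcs, injectivity and continuity of the drawing *)

Section Drawing.
Variables (G : graph) (lt : gV G -> gV G -> Prop) (m M : gV G).
Hypotheses (sG : simple G) (oo : outer_order lt m M) (lfG : locally_finite G).
Hypothesis cG : forall u v : gV G, conn setT u v.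
Hypothesis tc : forall v a b : gV G, a <> v -> b <> v -> conn [set x | x <> v] a b.
Hypothesis mM2 : exists z, lt m z /\ lt z M.
Variable nu : gV G -> nat.
Hypothesis nui : injective nu.
Implicit Types (u v p q : gV G) (x y : gE G) (w : gend G) (t s : R).

Let trans := oo_trans oo.
(** As only strict predecessors are weighed, [m] sits at 0, and the interval up to the successor of
    [v] has the weight of [v] as its length. *)
Definition vpos v : R := weight nu [set u | lt u v].
Definition epos w : R := weight nu (cut lt w).
Definition width : R := vpos M.
Local Notation T := width.
Local Notation h := (hgt T).

Lemma vpos_lt u v : lt u v -> vpos u < vpos v.
Proof.
move=> uv; apply: (weight_lt nui (u := u)) => //=; last exact: oo_irr oo _.
by move=> z /= zu; exact: trans zu uv.
Qed.

Lemma vpos_inj : injective vpos.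
Proof.
move=> u v e; case: (oo_trich oo u v) => // /vpos_lt; by rewrite e ltxx.
Qed.

Lemma vpos_ltE u v : vpos u < vpos v -> lt u v.
Proof.
move=> uv; case: (oo_trich oo u v) => // [e|/vpos_lt vu]; first by move: uv; rewrite e ltxx.
by move: uv; rewrite ltNge ltW.
Qed.

Lemma vpos_m : vpos m = 0.
Proof.
rewrite /vpos (_ : [set u | lt u m] = set0) ?weight0 //; apply/seteqP; split=> // u /= um.
by apply: (oo_asym oo um); apply: oo_min oo _ _; exact: (oo_neq oo um).
Qed.

Lemma vpos_ge0 v : 0 <= vpos v.
Proof.
rewrite -vpos_m; have [->//|vm] := pselect (v = m).
by apply/ltW/vpos_lt; exact: oo_min oo _ vm.
Qed.

Lemma vpos_leT v : vpos v <= T.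
Proof.
have [->//|vM] := pselect (v = M).
by apply/ltW/vpos_lt; exact: oo_max oo _ vM.
Qed.

Lemma ltmM : lt m M.
Proof. by have [z [mz zM]] := mM2; exact: trans mz zM. Qed.

Lemma T_gt0 : 0 < T.
Proof. by rewrite -vpos_m; exact: vpos_lt ltmM. Qed.

Lemma vpos_in v : 0 <= vpos v <= T.
Proof. by rewrite vpos_ge0 vpos_leT. Qed.

Lemma epos_gt w v : cut lt w v -> vpos v < epos w.
Proof.
move=> cv; have [_ _ low _ _] := cut_gap oo cG w.
by apply: (weight_lt nui (u := v)) => //=; [move=> z /= zv; exact: low zv cv|exact: oo_irr oo _].
Qed.

Lemma epos_lt w v : ~ cut lt w v -> epos w < vpos v.
Proof.
move=> cv; have gA := cut_gap oo cG w; have [_ _ _ _ nomin] := gA.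
have [c cc cv'] := nomin v cv; apply: (weight_lt nui (u := c)) => //= z cz /=.
exact: (gap_lt oo gA cz cv).
Qed.

Lemma epos_in w : 0 < epos w < T.
Proof.
have [cm cM _ _ _] := cut_gap oo cG w.
by apply/andP; split; [rewrite -vpos_m; exact: epos_gt|exact: epos_lt].
Qed.

Lemma epos_inj : injective epos.
Proof.
have sub w w' : epos w = epos w' -> cut lt w `<=` cut lt w'.
  move=> e v cv; apply: contrapT => /epos_lt; rewrite -e => h1.
  by have := epos_gt cv; rewrite ltNge (ltW h1).
move=> w w' e; apply: (cut_inj oo lfG cG tc).
by apply/seteqP; split; apply: sub.
Qed.

(** Choose [F] from [weight_continuous] and [pq] across the gap around which [F] splits as at the
    gap: the initial segments of [p] and [q] agree with the cut on [F]. *)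
Lemma epos_approx w (e : R) : 0 < e -> exists p q,
  [/\ crosses (cut lt w) p q, epos w - e <= vpos p & vpos q <= epos w + e].
Proof.
move=> e0; have [F hF] := weight_continuous nui e0.
have gA := cut_gap oo cG w.
have [p [q [c hpq]]] := gap_edge oo lfG cG tc F gA.
have [pq Ap Aq] := c; have ltpq := gap_lt oo gA Ap Aq.
exists p, q; split=> //.
- have : `|epos w - vpos p| <= e.
    apply: hF => v vF; have [h1 h2] := hpq v vF; split=> [/h1 //|/= vp].
    by apply: contrapT => /h2 qv; apply: (oo_asym oo vp); exact: trans ltpq qv.
  by rewrite ler_norml => /andP[_ h1]; lra.
- have : `|epos w - vpos q| <= e.
    apply: hF => v vF; have [h1 h2] := hpq v vF; split=> [/h1 vp|/= vq]; first exact: trans vp ltpq.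
    by apply: contrapT => /h2 qv; exact: (oo_asym oo vq qv).
  by rewrite ler_norml => /andP[h1 _]; lra.
Qed.

Definition consecutive u v := lt u v /\ forall z, lt u z -> ~ lt z v.

Definition top_edge x := (src x = m /\ tgt x = M) \/ (src x = M /\ tgt x = m).
Definition outer_edge x := consecutive (src x) (tgt x) \/ consecutive (tgt x) (src x).

Lemma edge_neq x : vpos (src x) != vpos (tgt x).
Proof. by apply/eqP => /vpos_inj; exact: sG.1. Qed.

Definition absc x t : R := (1 - t) * vpos (src x) + t * vpos (tgt x).

(** Every edge is a graph over its abscissa, so coinciding points have equal abscissas and heights
    decide. At the ends of an edge the three formulas agree with the vertices, since [h] vanishes at
    the positions of [m] and [M]. *)
Definition arc x t : R * R := (absc x t,
  if `[< top_edge x >] then h (absc x t)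
  else if `[< outer_edge x >] then - h (absc x t)
  else - ((1 - t) * h (vpos (src x)) + t * h (vpos (tgt x)))).

Definition draw (z : gpt G) : R * R := match z with
  | PV v => (vpos v, - h (vpos v))
  | PE x t => arc x (sval t)
  | PEnd w => (epos w, - h (epos w)) end.

Lemma top_edge_m x : top_edge x -> h (vpos (src x)) = 0 /\ h (vpos (tgt x)) = 0.
Proof. by case=> -[-> ->]; rewrite vpos_m hgt0 hgtT. Qed.

Lemma arc0 x : arc x 0 = draw (PV (src x)).
Proof.
rewrite /arc /absc subr0 !mul1r !mul0r !addr0 /=; congr pair.
by case: asboolP => [/top_edge_m [-> _]|_]; rewrite ?oppr0 //; case: asboolP.
Qed.

Lemma arc1 x : arc x 1 = draw (PV (tgt x)).
Proof.
rewrite /arc /absc subrr !mul1r !mul0r !add0r /=; congr pair.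
by case: asboolP => [/top_edge_m [_ ->]|_]; rewrite ?oppr0 //; case: asboolP.
Qed.

Lemma draw_edge x t : 0 <= t <= 1 -> draw (edge_map x t) = arc x t.
Proof.
move=> /andP[t0 t1]; case: edge_mapP => [t0'|t1'|//].
- by have -> : t = 0 by [apply/eqP; rewrite eq_le t0 t0']; rewrite arc0.
- by have -> : t = 1 by [apply/eqP; rewrite eq_le t1 t1']; rewrite arc1.
Qed.

Lemma arc_continuous x : continuous (arc x).
Proof.
have id_cont : continuous (fun t : R => t) by move=> t; exact: cvg_id.
have lin (a b : R) : continuous (fun t : R => (1 - t) * a + t * b).
  apply: continuous_funD; apply: continuous_funM => //; try exact: continuous_const.
  by apply: continuous_funB => //; exact: continuous_const.
have hc : continuous (fun t => h (absc x t)).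
  exact: (continuous_funcomp (lin _ _) (@hgt_continuous T)).
have opp (f : R -> R) : continuous f -> continuous (fun t => - f t).
  move=> cf; under eq_fun do rewrite -sub0r.
  by apply: continuous_funB => //; exact: continuous_const.
apply: continuous_pair; first exact: lin.
by case: asboolP => _ //; case: asboolP => _; apply: opp => //; exact: lin.
Qed.

Definition ends_of x p q := (src x = p /\ tgt x = q) \/ (src x = q /\ tgt x = p).

Lemma ends_of_inj x y p q : ends_of x p q -> ends_of y p q -> x = y.
Proof.
move=> hx hy; apply: sG.2.
by case: hx hy => -[-> ->] [] [-> ->]; [left|right|right|left].
Qed.

Lemma ends_of_adj x p q : ends_of x p q -> adj p q.
Proof. by move=> hx; exists x. Qed.

Lemma adj_ends p q : adj p q -> exists x, ends_of x p q.
Proof. by []. Qed.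

Lemma edge_lo_hi x t : 0 < t < 1 -> exists p q s,
  [/\ ends_of x p q /\ lt p q, 0 < s < 1, absc x t = (1 - s) * vpos p + s * vpos q &
      (1 - t) * h (vpos (src x)) + t * h (vpos (tgt x)) = (1 - s) * h (vpos p) + s * h (vpos q)].
Proof.
move=> t01; case: (oo_total oo (sG.1 x)) => st.
  by exists (src x), (tgt x), t; split=> //; split=> //; left.
exists (tgt x), (src x), (1 - t); split; first by split=> //; right.
- by case/andP: t01 => *; apply/andP; split; lra.
- by rewrite /absc; ring.
- by ring.
Qed.

Lemma absc_between p q s : lt p q -> 0 < s < 1 ->
  vpos p < (1 - s) * vpos p + s * vpos q < vpos q.
Proof.
move=> /vpos_lt pq /andP[s0 s1].
have h1 : 0 < s * (vpos q - vpos p) by apply: mulr_gt0; lra.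
have h2 : 0 < (1 - s) * (vpos q - vpos p) by apply: mulr_gt0; lra.
by apply/andP; split; lra.
Qed.

Lemma absc_in p q s : lt p q -> 0 < s < 1 -> 0 < (1 - s) * vpos p + s * vpos q < T.
Proof.
move=> pq s01; have /andP[h1 h2] := absc_between pq s01.
by rewrite (le_lt_trans (vpos_ge0 p) h1) (lt_le_trans h2 (vpos_leT q)).
Qed.

Lemma top_edgeE x p q : ends_of x p q -> lt p q -> top_edge x -> p = m /\ q = M.
Proof.
move=> e pq tx; have nMm : p = M -> q = m -> False.
  by move=> ep eq; move: pq; rewrite ep eq; exact: (oo_asym oo ltmM).
by case: e => -[e1 e2]; case: tx => -[f1 f2]; first [by split; congruence|by case: nMm; congruence].
Qed.

Lemma outer_edgeE x p q : ends_of x p q -> lt p q -> outer_edge x -> consecutive p q.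
Proof.
move=> e pq; have nqp := oo_asym oo pq.
by case: e => -[e1 e2]; rewrite /outer_edge e1 e2 => -[] // -[].
Qed.

Lemma consecutive_outer x p q : ends_of x p q -> consecutive p q -> outer_edge x.
Proof. by case=> -[<- <-]; [left|right]. Qed.

Lemma consecutive_vertex p q v : consecutive p q -> ~ vpos p < vpos v < vpos q.
Proof. by move=> [_ no] /andP[/vpos_ltE pv /vpos_ltE vq]; exact: no pv vq. Qed.

Lemma consecutive_end p q w : consecutive p q -> ~ vpos p < epos w < vpos q.
Proof.
move=> [_ no] /andP[pw wq]; have [_ _ low nomax _] := cut_gap oo cG w.
have cp : cut lt w p by apply: contrapT => /epos_lt h1; move: pw; rewrite ltNge (ltW h1).
have [b cb pb] := nomax p cp.
have cq : cut lt w q.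
  by case: (oo_trich oo q b) => [qb|->//|/(no b pb)//]; exact: low qb cb.
by have := epos_gt cq; rewrite ltNge (ltW wq).
Qed.

Variant edge_draw_spec x (z : R * R) : Prop :=
| DrawTop of top_edge x & 0 < z.2 & z.2 = h z.1
| DrawOuter of outer_edge x & ~ top_edge x & z.2 = - h z.1 & z.2 < 0
| DrawChord of ~ outer_edge x & ~ top_edge x & - h z.1 < z.2 & z.2 <= 0.

Lemma edge_drawP x t : 0 < t < 1 -> edge_draw_spec x (arc x t).
Proof.
move=> t01; have [p [q [s [[e pq] s01 ea eh]]]] := edge_lo_hi x t01.
have ain := absc_in pq s01; rewrite -ea in ain.
have hpos := hgt_gt0 ain.
rewrite /arc; case: asboolP => ht; first exact: DrawTop.
case: asboolP => ho; first by apply: DrawOuter => //=; rewrite oppr_lt0.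
apply: DrawChord => //=.
  rewrite ltrN2 eh ea; apply: hgt_concave => //; try exact: vpos_in.
  by rewrite lt_eqF // vpos_lt.
rewrite oppr_le0; case/andP: t01 => t0 t1.
by apply: addr_ge0; apply: mulr_ge0; try exact: hgt_ge0; lra.
Qed.

Lemma low_edge x t : 0 < t < 1 -> (arc x t).2 = - h (arc x t).1 -> exists p q,
  [/\ ends_of x p q, consecutive p q & vpos p < (arc x t).1 < vpos q].
Proof.
move=> t01; have [p [q [s [[e pq] s01 ea _]]]] := edge_lo_hi x t01.
case: (edge_drawP x t01) => [ht o0 oh|ho _ _ _|_ _ oh _] ol.
- by move: o0; rewrite oh in ol *; have := hgt_ge0 T (arc x t).1; lra.
- exists p, q; split=> //; first exact: outer_edgeE ho.
  by rewrite /= ea; exact: absc_between.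
- by move: oh; rewrite ol ltxx.
Qed.

(** Edges over a common abscissa do not cross, so they are nested and [chord_nested] compares their
    heights. *)
Lemma chord_overlap p q p' q' s s' : lt p q -> lt p' q' -> adj p q -> adj p' q' ->
  0 < s < 1 -> 0 < s' < 1 -> lt p p' ->
  (1 - s) * vpos p + s * vpos q = (1 - s') * vpos p' + s' * vpos q' ->
  (1 - s) * h (vpos p) + s * h (vpos q) < (1 - s') * h (vpos p') + s' * h (vpos q').
Proof.
move=> pq pq' apq apq' s01 s01' pp' e.
have /andP[h1 h2] := absc_between pq s01; have /andP[h3 h4] := absc_between pq' s01'.
have p'q : lt p' q by apply: vpos_ltE; rewrite (lt_trans h3) // -e.
have q'q : vpos q' <= vpos q.
  case: (oo_trich oo q' q) => [/vpos_lt/ltW //|->//|qq'].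
  by case: (oo_cross oo pp' p'q qq' apq apq').
apply: chord_nested => //; [exact: vpos_ge0|exact/ltW/vpos_lt|exact: vpos_lt|exact: vpos_leT|].
by left; exact: vpos_lt.
Qed.

Lemma chord_overlap_eq p q q' s s' : lt p q -> lt p q' -> lt q q' ->
  0 < s < 1 -> 0 < s' < 1 ->
  (1 - s) * vpos p + s * vpos q = (1 - s') * vpos p + s' * vpos q' ->
  (1 - s') * h (vpos p) + s' * h (vpos q') < (1 - s) * h (vpos p) + s * h (vpos q).
Proof.
move=> pq pq' qq' s01 s01' e.
apply: chord_nested => //; [exact: vpos_ge0|exact: vpos_lt|exact/ltW/vpos_lt|exact: vpos_leT|].
by right; exact: vpos_lt.
Qed.

Lemma arc_inj_edge x y t s : 0 < t < 1 -> 0 < s < 1 -> arc x t = arc y s -> x = y.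
Proof.
move=> t01 s01 e.
have [p [q [t' [[exx pq] t01' ea eh]]]] := edge_lo_hi x t01.
have [p' [q' [s' [[eyy pq'] s01' ea' eh']]]] := edge_lo_hi y s01.
have eabs : (1 - t') * vpos p + t' * vpos q = (1 - s') * vpos p' + s' * vpos q'.
  by rewrite -ea -ea'; exact: (congr1 fst e).
have /andP[h1 h2] := absc_between pq t01'; have /andP[h3 h4] := absc_between pq' s01'.
suff [ep eq] : p = p' /\ q = q' by rewrite ep eq in exx; exact: ends_of_inj exx eyy.
have := edge_drawP y s01; rewrite -e => dy.
(* Arcs of different kinds have different heights, so only two top edges, two outer edges or two
   chords remain. *)
(case: (edge_drawP x t01) => [tx o0 _|ox _ oh o0|nox ntx oh o0];
  case: dy => [ty o0' _|oy _ oh' o0'|noy nty oh' o0']);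
  [|by move: o0; rewrite ltNge ltW|by move: o0; rewrite ltNge o0'|by move: o0'; rewrite ltNge ltW| |
   by move: oh'; rewrite oh ltxx|by move: o0'; rewrite ltNge o0|by move: oh; rewrite oh' ltxx|].
- have [-> ->] := top_edgeE exx pq tx; by have [-> ->] := top_edgeE eyy pq' ty.
- have [_ no] := outer_edgeE exx pq ox; have [_ no'] := outer_edgeE eyy pq' oy.
  have pq1 : lt p q' by apply: vpos_ltE; lra.
  have pq2 : lt p' q by apply: vpos_ltE; lra.
  have pp : p = p'.
    by case: (oo_trich oo p p') => [/no/(_ pq2)//|//|/no'/(_ pq1)//].
  split=> //; case: (oo_trich oo q q') => [qq|//|qq].
    by case: (no' q).
  by case: (no q').
have eo : (1 - t') * h (vpos p) + t' * h (vpos q) = (1 - s') * h (vpos p') + s' * h (vpos q').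
  rewrite -eh -eh'; apply: oppr_inj; have := congr1 snd e.
  by rewrite /arc /= !asboolF.
case: (oo_trich oo p p') => pp.
- have := chord_overlap pq pq' (ends_of_adj exx) (ends_of_adj eyy) t01' s01' pp eabs.
  by rewrite eo ltxx.
- subst p'; split=> //; case: (oo_trich oo q q') => // qq.
  + by have := chord_overlap_eq pq pq' qq t01' s01' eabs; rewrite eo ltxx.
  + by have := chord_overlap_eq pq' pq qq s01' t01' (esym eabs); rewrite eo ltxx.
- have := chord_overlap pq' pq (ends_of_adj eyy) (ends_of_adj exx) s01' t01' pp (esym eabs).
  by rewrite eo ltxx.
Qed.

(** Vertices and ends lie on the lower half circle. An edge meets that only if it is outer, and then
    over an interval between consecutive vertices, which contains no position of a vertex or an
    end. *)
Lemma draw_inj : injective draw.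
Proof.
have PE_low x (t : {t : R | 0 < t < 1}) a : arc x (sval t) = (a, - h a) -> exists p q,
    [/\ ends_of x p q, consecutive p q & vpos p < a < vpos q].
  move=> e; have := @low_edge x (sval t) (proj2_sig t).
  by rewrite e; apply.
have PVE v w : vpos v <> epos w.
  have [cv|cv] := pselect (cut lt w v); first by move=> e; have := epos_gt cv; rewrite e ltxx.
  by move=> e; have := epos_lt cv; rewrite e ltxx.
case=> [v|x t|w] [v'|x' t'|w'] /= e.
- by case: e => /vpos_inj ->.
- have [p [q [_ c pq]]] := PE_low _ _ _ (esym e).
  by case: (consecutive_vertex c pq).
- by case: e => /PVE.
- by have [p [q [_ c pq]]] := PE_low _ _ _ e; case: (consecutive_vertex c pq).
- have ex := arc_inj_edge (proj2_sig t) (proj2_sig t') e; subst x'.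
  congr PE; apply: val_inj => /=; have := congr1 fst e; rewrite /arc /absc /= => ea.
  have ne := edge_neq x.
  have : (sval t - sval t') * (vpos (tgt x) - vpos (src x)) = 0.
    transitivity (((1 - sval t) * vpos (src x) + sval t * vpos (tgt x)) -
      ((1 - sval t') * vpos (src x) + sval t' * vpos (tgt x))); first by ring.
    by rewrite ea subrr.
  move/eqP; rewrite mulf_eq0 !subr_eq0 [_ == vpos (src x)]eq_sym (negbTE ne) orbF => /eqP //.
- by have [p [q [_ c pq]]] := PE_low _ _ _ e; case: (consecutive_end c pq).
- by case: e => /esym/PVE.
- by have [p [q [_ c pq]]] := PE_low _ _ _ (esym e); case: (consecutive_end c pq).
- by case: e => /epos_inj ->.
Qed.

Lemma draw_continuous : continuous draw.
Proof.
move=> z O nO; change (nbhs z (draw @^-1` O)).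
have [V0 [V0open V0z sub]] : exists V0, [/\ open V0, V0 (draw z) & V0 `<=` O].
  by move: nO; rewrite nbhsE => -[V0 [V0open V0z] sub]; exists V0.
have nonend_open : complex_open (nonend (draw @^-1` V0)).
  split=> [w [_ /(_ w)//]|x t t01 [Ot _]].
  rewrite /= draw_edge // in Ot.
  have := @arc_continuous x t V0 (open_nbhs_nbhs (conj V0open Ot)) => /nbhs_ballP [e /= e0 he].
  exists e => // s s01 st; split; last by move=> w; case: edge_mapP.
  by rewrite /= draw_edge //; apply: he; rewrite /ball /= distrC.
have use B : open B -> B z -> B `<=` draw @^-1` V0 -> nbhs z (draw @^-1` O).
  by move=> oB Bz sB; rewrite nbhsE; exists B => // y /sB /sub.
case: z nO V0z use => [v|x t|w] _ V0z use.
- apply: (use (nonend (draw @^-1` V0))); [exact: complex_open_open|by split|by move=> ? []].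
- apply: (use (nonend (draw @^-1` V0))); [exact: complex_open_open|by split|by move=> ? []].
have /nbhs_ballP [e /= e0 he] : nbhs (draw (PEnd w)) V0 by exact: open_nbhs_nbhs.
pose a0 := epos w.
have [d d0 hd] : exists2 d, 0 < d & forall a, `|a - a0| < d -> `|h a - h a0| < e.
  have := @hgt_continuous T a0 (ball (h a0) e) (nbhsx_ballx _ _ e0) => /nbhs_ballP [d /= d0 hd].
  by exists d => // a ad; rewrite distrC; apply: hd; rewrite /ball /= distrC.
(* Halving turns the weak bounds of [epos_approx] into strict ones. *)
pose d' := Num.min d e / 2.
have d'0 : 0 < d' by apply: divr_gt0 => //; rewrite lt_min d0.
have [d'd d'e] : d' < d /\ d' < e.
  by rewrite /d'; case: (lerP d e) => ?; split; lra.
have [p [q [c xp xq]]] := epos_approx w d'0; have [pq Ap Aq] := c.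
have S2 : finite_set [set p; q] by exact: finite_set2.
have sub2 := comp_between oo cG c.
have gA := cut_gap oo cG w; have ltpq := gap_lt oo gA Ap Aq.
have near a : vpos p <= a <= vpos q -> `|a - a0| < d /\ `|a - a0| < e.
  by move=> /(itv_dist xp xq) ad; split; apply: le_lt_trans ad _.
have lowO a : vpos p <= a <= vpos q -> V0 (a, - h a).
  move=> /near [ad ae]; apply: he; split; rewrite /ball /=.
    by rewrite distrC.
  by rewrite opprK addrC; exact: hd.
apply: (use (Chat [set p; q] w)); [exact: Chat_open|exact: Chat_end|].
case=> [v|x t|w'] /=.
- by move=> /sub2 [pv vq]; apply: lowO; rewrite !ltW ?vpos_lt.
- move=> [cs [ct cst]].
  have inI u : comp_of [set p; q] w u \/ [set p; q] u -> vpos p <= vpos u <= vpos q.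
    case=> [/sub2 [pu uq]|[] ->]; first by rewrite !ltW ?vpos_lt.
      by rewrite lexx ltW ?vpos_lt.
    by rewrite lexx ltW ?vpos_lt.
  have sI := inI _ cs; have tI := inI _ ct.
  have aI : vpos p <= absc x (sval t) <= vpos q by exact: (convex_itv (proj2_sig t) sI tI).
  (* The edge has an end strictly between [p] and [q], so it is not the edge [mM], the only one
     drawn far from its ends. *)
  rewrite /arc asboolF; last first.
    have lm u : comp_of [set p; q] w u -> u <> m.
      move=> /sub2 [pu _] e1; rewrite e1 in pu; apply: (oo_asym oo pu).
      by apply: oo_min oo _ _; exact: (oo_neq oo pu).
    have lM u : comp_of [set p; q] w u -> u <> M.
      move=> /sub2 [_ uq] e1; rewrite e1 in uq; apply: (oo_asym oo uq).
      by apply: oo_max oo _ _; exact/not_eq_sym/(oo_neq oo uq).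
    by case=> -[e1 e2]; case: cst => cc; [case: (lm _ cc)|case: (lM _ cc)|case: (lM _ cc)|case: (lm _ cc)].
  case: asboolP => _; first exact: lowO.
  have [ad ae] := near _ aI; apply: he; split; rewrite /ball /=; first by rewrite distrC.
  rewrite opprK addrC; apply: convex_dist (proj2_sig t) _ _.
    exact: hd _ (near _ sI).1.
  exact: hd _ (near _ tI).1.
- move=> hw'.
  (* The rays of [w'] run in the component of [w], hence under [pq]; so [pq] crosses the gap of [w']
     too, which bounds its position. *)
  have c' : crosses (cut lt w') p q.
    apply/(cut_between oo cG); split=> //; split=> // u [r [wr [N [av cn]]]].
    have [N' hN'] := hw' r wr.
    have Dk := sub2 _ (hN' _ (leq_maxr N N')).
    apply: component_union_conn (between_component oo pq) _ Dk.
    apply: conn_trans cn; apply: conn_sym; apply: ray_conn (leq_maxl _ _) => //.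
    have [r0 [_ _ hw]] := end_rays w'.
    by have [[_ ra] _] := (hw r).1 wr.
  by have [_ Ap' Aq'] := c'; apply: lowO; rewrite !ltW ?epos_gt ?epos_lt.
Qed.

End Drawing.

(** * The boundary circle and its uniqueness *)

Lemma compact_embedding (X Y : topologicalType) (g : X -> Y) : hausdorff_space Y ->
  compact [set: X] -> continuous g -> injective g -> embedding_on setT g.
Proof.
move=> hY cX cg gi; split; first exact: continuous_subspaceT.
split=> [p q _ _|U oU]; first exact: gi.
exists (~` (g @` (~` U))); split.
  apply: closed_openC; apply: compact_closed => //; apply: continuous_compact.
    exact: continuous_subspaceT.
  apply: subclosed_compact cX _ => //; exact: open_closedC.
rewrite setTI; apply/seteqP; split=> y.
  move=> [p Up <-]; split; first by exists p.
  by move=> [q nq /gi e]; apply: nq; rewrite e.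
move=> [[p _ <-] ny]; exists p => //; apply: contrapT => nU; apply: ny; by exists p.
Qed.

Lemma plane_hausdorff : hausdorff_space (R * R)%type.
Proof.
move=> p q cl.
have proj (pr : R * R -> R) : continuous pr -> pr p = pr q.
  move=> cpr; apply: (@Rhausdorff R) => A B nA nB.
  have [z [Az Bz]] := cl (pr @^-1` A) (pr @^-1` B) (cpr p A nA) (cpr q B nB).
  by exists (pr z).
rewrite [p]surjective_pairing [q]surjective_pairing.
by congr pair; apply: proj => z; [exact: cvg_fst|exact: cvg_snd].
Qed.

Lemma sphere_affine (c : R * R) (r : R) (p : R * R) : 0 < r ->
  sphere c r (c.1 + r * p.1, c.2 + r * p.2) <-> S1 p.
Proof.
move=> r0; rewrite S1E /sphere /=.
have -> : (c.1 + r * p.1 - c.1) ^+ 2 + (c.2 + r * p.2 - c.2) ^+ 2 =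
  r ^+ 2 * (p.1 ^+ 2 + p.2 ^+ 2) by ring.
split=> [e|->]; last by rewrite mulr1.
have r2 : r ^+ 2 != 0 by rewrite expf_neq0 // gt_eqF.
by apply: (mulfI r2); rewrite mulr1.
Qed.

(** The parametrisation is the inverse of [g] on the sphere after the affine map from the unit
    circle. Its continuity is the open-image clause of [g], its own open-image clause is the
    continuity of [g]. *)
Lemma boundary_circle (G : graph) (g : gpt G -> R * R) (c : R * R) (r : R) : 0 < r ->
  embedding_on setT g -> sphere c r `<=` range g -> circle (g @^-1` sphere c r).
Proof.
move=> r0 [gc [gi go]] surj.
have gc' : continuous g by exact/continuous_subspace_setT.
have gi' : injective g by move=> p q; apply: gi; rewrite inE.
pose aff (p : R * R) : R * R := (c.1 + r * p.1, c.2 + r * p.2).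
have aff_S p : S1 p -> sphere c r (aff p) by move=> Sp; apply/sphere_affine.
have aff_cont : continuous aff.
  by apply: continuous_pair; apply: continuous_funD; try exact: continuous_const;
    apply: continuous_funM; try exact: continuous_const; move=> p; [exact: cvg_fst|exact: cvg_snd].
have aff_inj : injective aff.
  move=> p q e; have := congr1 fst e; have := congr1 snd e => /= /addrI e2 /addrI e1.
  have rn : r != 0 by rewrite gt_eqF.
  by rewrite [p]surjective_pairing [q]surjective_pairing (mulfI rn e1) (mulfI rn e2).
have one_S1 : S1 (1, 0) by apply/S1E => /=; ring.
have [p0 _ _] := surj _ (aff_S _ one_S1).
have [inv hinv] : exists inv : R * R -> gpt G, forall z, sphere c r z -> g (inv z) = z.
  suff /choice [inv h] : forall z, exists p, sphere c r z -> g p = z by exists inv.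
  move=> z; have [Sz|nS] := pselect (sphere c r z); last by exists p0.
  by have [p _ <-] := surj z Sz; exists p.
pose f p := inv (aff p).
have gf p : S1 p -> g (f p) = aff p by move=> Sp; apply: hinv; exact: aff_S.
exists f; split; last first.
  apply/seteqP; split=> [p /= Sp|_ [p Sp <-]]; last by rewrite /= gf //; exact: aff_S.
  pose z : R * R := (((g p).1 - c.1) / r, ((g p).2 - c.2) / r).
  have az : aff z = g p.
    have rn : r != 0 by rewrite gt_eqF.
    by rewrite /aff /z /= [g p]surjective_pairing /=; congr pair; field.
  have Sz : S1 z by apply/(sphere_affine c z r0); rewrite -/(aff z) az.
  by exists z => //; apply: gi'; rewrite gf.
split.
  apply/subspace_continuousP => p Sp U; rewrite nbhsE => -[V [oV Vp] sub].
  have [W [oW eW]] := go V oV; rewrite setTI in eW.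
  have Wp : W (aff p).
    by have : (g @` V) (g (f p)) by [exists (f p)]; rewrite eW gf // => -[].
  have := aff_cont p W (open_nbhs_nbhs (conj oW Wp)).
  apply: (@filterS _ (nbhs p)) => q Wq Sq; apply: sub.
  have : (g @` V) (g (f q)) by rewrite eW gf //; split=> //; exists (f q) => //; exact: gf.
  by move=> [y Vy /gi' e]; rewrite e in Vy.
split.
  move=> p q; rewrite !inE => Sp Sq e; apply: aff_inj; by rewrite -!gf // e.
move=> U oU.
pose W := g @^-1` [set y | U ((y.1 - c.1) / r, (y.2 - c.2) / r)].
exists W; split.
  apply: open_comp; first by move=> z _; exact: gc'.
  apply: (@open_comp _ _ (fun y : R * R => ((y.1 - c.1) / r, (y.2 - c.2) / r)) U) => // y _.
  move: y; apply: continuous_pair; apply: continuous_funM; try exact: continuous_const;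
    apply: continuous_funB; try exact: continuous_const; move=> p; [exact: cvg_fst|exact: cvg_snd].
have back p : S1 p -> (((g (f p)).1 - c.1) / r, ((g (f p)).2 - c.2) / r) = p.
  move=> Sp; have rn : r != 0 by rewrite gt_eqF.
  by rewrite gf // /aff /= [p in RHS]surjective_pairing; congr pair; field.
apply/seteqP; split=> [_ [p [Sp Up] <-]|_ [[p Sp <-] Wp]].
  by split; [exists p|rewrite /W /= back].
by exists p => //; split=> //; move: Wp; rewrite /W /= back.
Qed.

Lemma connected_three (X : topologicalType) (J U1 U2 U3 : set X) a b :
  connected J -> open U1 -> open U2 -> open U3 -> J `<=` U1 `|` (U2 `|` U3) ->
  (forall p, U1 p -> ~ U2 p) -> (forall p, U1 p -> ~ U3 p) ->
  J a -> U1 a -> J b -> ~ U1 b -> False.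
Proof.
move=> cJ o1 o2 o3 cov d12 d13 Ja Ua Jb; apply.
have := connected_split cJ o1 (openU o2 o3) cov; apply => //; last by exists a.
by move=> p _ U1p [/(d12 _ U1p)|/(d13 _ U1p)].
Qed.

Lemma open_edge_open (G : graph) (x : gE G) : open [set z : gpt G | exists t, z = PE x t].
Proof.
apply: complex_open_open; split=> [w [] //|y t _]; case: edge_mapP => [_ []//|_ []//|t01 /= [t' [exy _]]].
have tpos : 0 < Num.min t (1 - t) by rewrite lt_min subr_gt0.
exists (Num.min t (1 - t)) => // s /andP[s0 s1].
rewrite lt_min !ltr_norml => /andP[/andP[h1 h2] /andP[h3 h4]].
case: edge_mapP => [s0'|s1'|h']; [by exfalso; lra|by exfalso; lra|].
by rewrite exy; eexists.
Qed.

Section Boundary.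
Variables (G : graph) (lt : gV G -> gV G -> Prop) (m M : gV G).
Hypotheses (sG : simple G) (oo : outer_order lt m M) (lfG : locally_finite G).
Hypothesis cG : forall u v : gV G, conn setT u v.
Hypothesis tc : forall v a b : gV G, a <> v -> b <> v -> conn [set x | x <> v] a b.
Hypothesis mM2 : exists z, lt m z /\ lt z M.
Variable nu : gV G -> nat.
Hypothesis nui : injective nu.
Implicit Types (u v p q : gV G) (x : gE G) (w : gend G) (t s : R).

Local Notation xv := (vpos lt nu).
Local Notation xe := (epos lt nu).
Local Notation T := (width lt M nu).
Local Notation h := (hgt T).
Local Notation g := (draw lt m M nu).
Let o : R * R := (T / 2, 0).
Let rho : R := T / 2.
Local Notation Sph := (sphere o rho).

Let T0 : 0 < T := T_gt0 oo mM2 nui.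

Lemma radius_gt0 : 0 < rho.
Proof. exact: divr_gt0. Qed.

Lemma boundaryE (z : R * R) : Sph z <-> z.2 ^+ 2 = z.1 * (T - z.1).
Proof.
rewrite /sphere /o /rho /= subr0; split=> e.
  have -> : z.2 ^+ 2 = ((z.1 - T / 2) ^+ 2 + z.2 ^+ 2) - (z.1 - T / 2) ^+ 2 by ring.
  by rewrite e; field.
by rewrite e; field.
Qed.

Lemma low_boundary a : 0 <= a <= T -> Sph (a, - h a).
Proof. by move=> aT; apply/boundaryE; rewrite /= sqrrN sqr_hgt. Qed.

Lemma vertex_boundary v : Sph (g (PV v)).
Proof. by apply: low_boundary; exact: (vpos_in oo nui). Qed.

Lemma end_boundary w : Sph (g (PEnd w)).
Proof.
by apply: low_boundary; have /andP[h1 h2] := epos_in oo cG nui w; rewrite !ltW.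
Qed.

Lemma arc_in x t : 0 < t < 1 -> 0 < (arc lt m M nu x t).1 < T.
Proof.
move=> t01; have [p [q [s [[e pq] s01 ea _]]]] := edge_lo_hi sG oo nu x t01.
by rewrite /= ea; exact: (absc_in oo nui pq s01).
Qed.

Lemma draw_disk z : disk o rho (g z).
Proof.
have sph_disk y : Sph y -> disk o rho y by rewrite /disk /sphere /= => ->.
case: z => [v|x t|w]; [exact/sph_disk/vertex_boundary| |exact/sph_disk/end_boundary].
rewrite /g; move: (proj2_sig t); set t' := sval t => t01.
have ain := arc_in x t01; have ain' : 0 <= (arc lt m M nu x t').1 <= T by case/andP: ain => *; rewrite !ltW.
have hs := sqr_hgt ain'.
suff le2 : (arc lt m M nu x t').2 ^+ 2 <= h (arc lt m M nu x t').1 ^+ 2.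
  rewrite /disk /o /rho /= subr0; move: le2; rewrite hs => le2.
  have -> : ((arc lt m M nu x t').1 - T / 2) ^+ 2 = (T / 2) ^+ 2 -
     (arc lt m M nu x t').1 * (T - (arc lt m M nu x t').1) by field.
  rewrite /= in le2 *; lra.
case: (edge_drawP sG oo nui x t01) => [_ _ -> //|_ _ -> _|_ _ h1 h2].
- by rewrite sqrrN.
- have h0 := hgt_ge0 T (arc lt m M nu x t').1.
  by rewrite -[leLHS]sqrrN ler_pXn2r ?nnegrE //; lra.
Qed.

Lemma edge_at x p q s : ends_of x p q -> 0 < s < 1 -> exists t : {t : R | 0 < t < 1},
  absc lt nu x (sval t) = (1 - s) * xv p + s * xv q.
Proof.
move=> e s01; case: e => -[e1 e2].
  by exists (exist _ s s01); rewrite /absc /= e1 e2.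
have s01' : 0 < 1 - s < 1 by case/andP: s01 => *; apply/andP; split; lra.
by exists (exist _ (1 - s) s01'); rewrite /absc /= e1 e2; ring.
Qed.

(** If [a] is no vertex position, consider the vertices placed before it. If there is a last one,
    the outer edge to its successor passes over [a]; otherwise they form a gap, whose end sits at
    [a]. *)
Lemma low_surj a : 0 <= a <= T -> exists z, g z = (a, - h a).
Proof.
move=> /andP[a0 aT].
have [[v va]|nv] := pselect (exists v, xv v = a); first by exists (PV v); rewrite /= va.
pose A := [set v | xv v < a].
have nA v : ~ A v -> a < xv v.
  move=> /negP; rewrite -leNgt le_eqVlt => /predU1P[e|//].
  by case: nv; exists v.
have Am : A m.
  rewrite /A /= (vpos_m oo nu) lt_neqAle a0 andbT; apply/eqP => e.
  by apply: nv; exists m; rewrite (vpos_m oo nu).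
have AM : ~ A M by rewrite /A /= => /lt_geF; rewrite aT.
have low u v : lt u v -> A v -> A u by move=> uv; exact: lt_trans (vpos_lt oo nui uv).
have [[c Ac cmax]|nomax] := pselect (exists2 c, A c & forall b, A b -> ~ lt c b).
  have cM : c <> M by move=> e; apply: AM; rewrite -e.
  have [u [cu acu hu]] := oo_succ oo cM.
  have au : a < xv u by apply: nA => /cmax /(_ cu).
  have con : consecutive lt c u.
    split=> // z cz zu; case: (hu z cz) => [e|uz]; last exact: (oo_asym oo zu uz).
    by move: zu; rewrite e; exact: (oo_irr oo).
  have [x ex] := adj_ends acu.
  have xuc : 0 < xv u - xv c by rewrite subr_gt0; exact: lt_trans Ac au.
  have s01 : 0 < (a - xv c) / (xv u - xv c) < 1.
    apply/andP; split; first by apply: divr_gt0 => //; rewrite subr_gt0.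
    by rewrite ltr_pdivrMr // mul1r ltrD2r.
  have [t et] := edge_at ex s01.
  have ea : absc lt nu x (sval t) = a.
    by rewrite et; field; rewrite gt_eqF.
  exists (PE x t); rewrite /= /arc ea asboolF ?asboolT //; first exact: consecutive_outer ex con.
  (* The outer edge is not drawn along the top, as [m] and [M] are not consecutive. *)
  move=> tx; have [ec eu] := top_edgeE oo mM2 ex cu tx.
  have [z [mz zM]] := mM2; have [_ no] := con.
  by apply: (no z); rewrite ?ec ?eu.
have gA : gap lt m M A.
  split=> //.
  - move=> c Ac; apply: contrapT => nb; apply: nomax; exists c => // b Ab cb.
    by apply: nb; exists b.
  - move=> b nb; have bm : b <> m by move=> e; apply: nb; rewrite e.
    have [u [ub _ hu]] := oo_pred oo bm; exists u => // Au; apply: nomax; exists u => // z Az uz.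
    apply: nb; case: (oo_trich oo z b) => [zb|<-//|bz]; last exact: low bz Az.
    case: (hu z zb) => [e|zu]; last by case: (oo_asym oo uz zu).
    by move: uz; rewrite e => /(oo_irr oo).
have [w cw] := gap_end oo lfG cG tc gA.
have ew : xe w = a.
  apply/eqP; rewrite eq_le; apply/andP; split; apply/ler_addgt0Pr => e e0;
    have [p [q [[_ Ap Aq] h1 h2]]] := epos_approx oo lfG cG tc nui w e0; rewrite cw in Ap Aq.
  - by rewrite -lerBlDr; apply: le_trans h1 (ltW _).
  - exact: le_trans (ltW (nA _ Aq)) h2.
by exists (PEnd w); rewrite /= ew.
Qed.

Lemma boundary_surj : Sph `<=` range g.
Proof.
move=> [a b] /boundaryE /= e.
have ab0 : 0 <= a * (T - a) by rewrite -e sqr_ge0.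
have aT : 0 <= a <= T.
  case: (lerP 0 a) => a0 /=.
    case: (lerP a T) => // aT; move: ab0.
    by rewrite leNgt pmulr_rlt0 ?subr_lt0 ?aT // (lt_trans T0 aT).
  by move: ab0; rewrite leNgt nmulr_rlt0 // subr_gt0 (lt_trans a0 T0).
have hb : b ^+ 2 = h a ^+ 2 by rewrite sqr_hgt.
case: (lerP b 0) => b0.
  have -> : b = - h a.
    apply: oppr_inj; rewrite opprK; apply/eqP.
    rewrite -(eqrXn2 (n := 2)) ?sqrrN ?hb // ?oppr_ge0 //; exact: hgt_ge0.
  by have [z ez] := low_surj aT; exists z.
have eb : b = h a.
  by apply/eqP; rewrite -(eqrXn2 (n := 2)) ?hb // ?(ltW b0) //; exact: hgt_ge0.
have [x ex] := adj_ends (oo_adj oo).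
have [a0 aT'] : 0 < a /\ a < T.
  case/andP: aT => a0 aT; rewrite !lt_neqAle a0 aT !andbT; split; apply/eqP => e1; move: b0; rewrite eb.
    by rewrite -e1 hgt0 ltxx.
  by rewrite e1 hgtT ltxx.
have s01 : 0 < a / T < 1 by rewrite divr_gt0 //= ltr_pdivrMr // mul1r.
have [t et] := edge_at ex s01.
have ea : absc lt nu x (sval t) = a.
  by rewrite et (vpos_m oo nu) mulr0 add0r -/(width lt M nu) divfK // gt_eqF.
by exists (PE x t) => //=; rewrite /arc ea asboolT ?eb.
Qed.

Lemma draw_embedding : embedding_on setT g.
Proof.
apply: compact_embedding.
- exact: plane_hausdorff.
- exact: (gpt_compact oo lfG cG tc).
- exact: (draw_continuous oo lfG cG tc nui).
- exact: (draw_inj sG oo lfG cG tc mM2 nui).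
Qed.

Let C := g @^-1` Sph.

Lemma boundary_hamilton : hamilton_circle C.
Proof.
split; last exact: vertex_boundary.
apply: boundary_circle; [exact: radius_gt0|exact: draw_embedding|exact: boundary_surj].
Qed.

Lemma boundary_image : g @` C = Sph.
Proof.
apply/seteqP; split=> [_ [p Cp <-]//|z Sz].
by have [p _ e] := boundary_surj Sz; exists p; rewrite /C /= e.
Qed.

Section Unique.
Variable f : R * R -> gpt G.
Hypotheses (cf : {within S1, continuous f}) (fi : set_inj S1 f).
Let C' := f @` S1.
Hypothesis CV : forall v, C' (PV v).

(* A chord would leave three pairwise separated parts of the circle minus the two ends
   of the chord, which is a union of only two connected sets. *)
Lemma circle_sub_boundary : C' `<=` C.
Proof.
move=> z C'z; apply: contrapT => nCz.
case: z C'z nCz => [v|x t|w] C'z nCz; [by apply: nCz; exact: vertex_boundary| |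
  by apply: nCz; exact: end_boundary].
have t01 := proj2_sig t.
have [p [q [s [[e pq] s01 _ _]]]] := edge_lo_hi sG oo nu x t01.
have apq := ends_of_adj e.
have [ntop nout] : ~ top_edge m M x /\ ~ outer_edge lt x.
  rewrite /C /= in nCz.
  case: (edge_drawP sG oo nui x t01) => [_ _ e2|_ _ e2 _|]; last by [].
    case: nCz; apply/boundaryE; rewrite e2 sqr_hgt //.
    by have /andP[h1 h2] := arc_in x t01; rewrite !ltW.
  case: nCz; apply/boundaryE; rewrite e2 sqrrN sqr_hgt //.
  by have /andP[h1 h2] := arc_in x t01; rewrite !ltW.
pose S := [set p; q]; pose D := between lt p q.
have fS : finite_set S by exact: finite_set2.
have cu : component_union S D := between_component oo apq.
have [z1 Dz1] : exists z, D z.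
  apply: contrapT => no; apply: nout; apply: consecutive_outer e _; split=> // z pz zq.
  by apply: no; exists z.
(* The chord is not the edge [mM], so [m] or [M] lies outside its closed interval. *)
have [z2 [nSz2 nDz2]] : exists z, ~ S z /\ ~ D z.
  have [pm|pm] := pselect (p = m).
    have qM : q <> M by move=> qM; apply: ntop; rewrite -pm -qM; exact: e.
    exists M; split=> [[] /= eM|[_ Mq]].
    - by apply: (oo_irr oo (x := q)); apply: oo_trans oo _ _ _ (oo_max oo qM) _; rewrite eM.
    - exact: qM (esym eM).
    - exact: (oo_asym oo Mq (oo_max oo qM)).
  have mp := oo_min oo pm.
  exists m; split=> [[] /= eM|[pm' _]].
  - exact: pm (esym eM).
  - by apply: (oo_asym oo pq); rewrite -eM.
  - exact: (oo_asym oo mp pm').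
pose U1 := side S D; pose U2 := side S [set a | ~ S a /\ ~ D a].
pose U3 := [set z : gpt G | exists t' : {t : R | 0 < t < 1}, z = PE x t'].
have o1 : open U1 by exact: side_open.
have o2 : open U2 by apply: side_open => //; exact: component_unionC.
have o3 : open U3 by exact: open_edge_open.
have Sx : S (src x) /\ S (tgt x) by case: e => -[-> ->]; split; by [left|right].
have d12 z : U1 z -> ~ U2 z by exact: side_disjoint.
have d13 z : U1 z -> ~ U3 z.
  by move=> + [t' ez]; rewrite ez => -[] /cu.1; apply; [exact: Sx.1|exact: Sx.2].
have d23 z : U2 z -> ~ U3 z.
  by move=> + [t' ez]; rewrite ez => -[] [nS _]; apply: nS; [exact: Sx.1|exact: Sx.2].
have cov z : z <> PV p -> z <> PV q -> U1 z \/ U2 z \/ U3 z.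
  move=> zp zq; case: (side_cover z fS cu) => [| |[v [] /= -> //]|[y [t' [ez Ss St]]]].
  - by left.
  - by right; left.
  - right; right; exists t'; rewrite ez; congr PE; apply: (ends_of_inj sG _ e).
    have nl := sG.1 y; case: Ss => /= es; case: St => /= et;
    first [by left|by right|by case: nl; rewrite es et].
have npq : PV p <> PV q by case; exact: (oo_neq oo pq).
have [J1 [J2 [cJ1 cJ2 eJ]]] := circle_minus_two cf fi (CV p) (CV q) npq.
have J1c : J1 `<=` (C' `\ PV p) `\ PV q by rewrite eJ; left.
have J2c : J2 `<=` (C' `\ PV p) `\ PV q by rewrite eJ; right.
have covJ J : J `<=` (C' `\ PV p) `\ PV q -> J `<=` U1 `|` (U2 `|` U3).
  by move=> sub y /sub [[_ yp] yq]; exact: cov.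
have two J a b : connected J -> J `<=` (C' `\ PV p) `\ PV q -> J a -> J b ->
    ~ [\/ U1 a /\ U2 b, U1 a /\ U3 b | U2 a /\ U3 b].
  move=> cJ sub Ja Jb [[Ua Ub]|[Ua Ub]|[Ua Ub]].
  - apply: (connected_three cJ o1 o2 o3 (covJ J sub) d12 d13 Ja Ua Jb) => U1b.
    exact: d12 U1b Ub.
  - apply: (connected_three cJ o1 o2 o3 (covJ J sub) d12 d13 Ja Ua Jb) => U1b.
    exact: d13 U1b Ub.
  - apply: (@connected_three _ J U2 U1 U3 a b cJ o2 o1 o3 _ _ d23 Ja Ua Jb).
    + by move=> y /(covJ J sub) [|[|]]; [right; left|left|right; right].
    + by move=> y Uy /d12; apply.
    + by move=> U2b; exact: d23 U2b Ub.
have inJ y : C' y -> y <> PV p -> y <> PV q -> J1 y \/ J2 y.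
  by move=> Cy yp yq; have : (J1 `|` J2) y by rewrite -eJ.
have j1 : J1 (PV z1) \/ J2 (PV z1).
  by apply: inJ => // -[e1]; apply: (cu.1 _ Dz1); rewrite e1; [left|right].
have j2 : J1 (PV z2) \/ J2 (PV z2).
  by apply: inJ => // -[e1]; apply: nSz2; rewrite e1; [left|right].
have j3 : J1 (PE x t) \/ J2 (PE x t) by apply: inJ.
have u1 : U1 (PV z1) by []. have u2 : U2 (PV z2) by [].
have u3 : U3 (PE x t) by exists t.
(* Three points in different parts, two connected sets: two of the points share a set, which [two]
   forbids. *)
case: j1 => j1; case: j2 => j2; try (by (apply: (two _ _ _ _ _ j1 j2) => //; exact: Or31));
  case: j3 => j3; first [by (apply: (two _ _ _ _ _ j1 j3) => //; exact: Or32)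
                        |by (apply: (two _ _ _ _ _ j2 j3) => //; exact: Or33)].
Qed.

(* If the circle missed a boundary point [z], the line through [z] and a suitable vertex
   would separate it. *)
Lemma circle_eq_boundary : C' = C.
Proof.
apply/seteqP; split; first exact: circle_sub_boundary.
move=> z Cz; apply: contrapT => nC'z.
have gi := draw_inj sG oo lfG cG tc mM2 nui.
have gc := draw_continuous oo lfG cG tc nui.
have c1 : continuous (fun y => (g y).1).
  by move=> y; apply: (@continuous_comp _ _ _ g fst); [exact: gc|exact: cvg_fst].
have c2 : continuous (fun y => (g y).2).
  by move=> y; apply: (@continuous_comp _ _ _ g snd); [exact: gc|exact: cvg_snd].
have zV v : z <> PV v by move=> e; apply: nC'z; rewrite e.
have key a b c : b <> a -> c <> a -> ~ separates (g z) (g (PV a)) (g (PV b)) (g (PV c)).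
  move=> ba ca sep.
  pose F y := orient (g z) (g (PV a)) (g y).
  have cF : continuous F.
    apply: continuous_funB; apply: continuous_funM; try exact: continuous_const;
      by apply: continuous_funB => //; exact: continuous_const.
  have oP : open [set y | 0 < F y].
    by apply: (@open_comp _ _ F [set r | 0 < r]) => [y _|]; [exact: cF|exact: open_gt].
  have oN : open [set y | F y < 0].
    by apply: (@open_comp _ _ F [set r | r < 0]) => [y _|]; [exact: cF|exact: open_lt].
  have cC := circle_minus_point cf fi (CV a).
  have covP y : (C' `\ PV a) y -> 0 < F y \/ F y < 0.
    (* All of [C'] lies on the boundary circle, which the line meets only in [z] and the vertex
       [a]. *)
    move=> [C'y ya]; have Cy := circle_sub_boundary C'y.
    have : F y != 0.
      apply: (@orient_neq0 o rho) => //; try exact: vertex_boundary.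
      - by move=> /gi; exact: zV.
      - by move=> /gi e; apply: ya.
      - by move=> /gi e; apply: nC'z; rewrite e.
    by case: ltrgt0P => // _ _; [left|right].
  have inb : (C' `\ PV a) (PV b) by split=> // -[].
  have inc : (C' `\ PV a) (PV c) by split=> // -[].
  move: sep; rewrite /separates -/(F (PV b)) -/(F (PV c)) => /mul_lt0P [[hb hc]|[hb hc]].
  - have := connected_split cC oP oN covP; have nb : ~ 0 < F (PV b) by rewrite lt_gtF.
    move=> sub; apply: nb; apply: sub inb; last by exists (PV c).
    by move=> y _ /= h1; rewrite lt_gtF.
  - have := connected_split cC oP oN covP; have nc : ~ 0 < F (PV c) by rewrite lt_gtF.
    move=> sub; apply: nc; apply: sub inc; last by exists (PV b).
    by move=> y _ /= h1; rewrite lt_gtF.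
have [b [mb bM]] := mM2; have mM := ltmM oo mM2.
have nmb := oo_neq oo mb; have nbM := oo_neq oo bM; have nmM := oo_neq oo mM.
have P v : Sph (g (PV v)) := vertex_boundary v.
have nP u v : u <> v -> g (PV u) <> g (PV v) by move=> uv /gi [].
have nz v : g z <> g (PV v) by move=> /gi; exact: zV.
(* Whichever pairing of [z] and three vertices alternates, [z] is paired with a vertex, so [key]
   applies. *)
have [] := @separates_exists o rho (g z) (g (PV m)) (g (PV b)) (g (PV M)) Cz (P m) (P b) (P M)
  (nz m) (nz b) (nz M) (nP _ _ nmb) (nP _ _ nmM) (nP _ _ nbM).
- by apply: key => ?; congruence.
- by apply: key => ?; congruence.
- by apply: key => ?; congruence.
Qed.

End Unique.

Lemma hamilton_circle_unique C' : hamilton_circle C' -> C' = C.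
Proof. by case=> -[f [[cf [fi _]] ->]] CV; exact: circle_eq_boundary. Qed.

End Boundary.

Lemma forbidden_minors_drawing (G : graph) : simple G -> locally_finite G -> connected_graph G ->
  two_connected G -> ~ has_minor G K4 -> ~ has_minor G K23 ->
  exists C : set (gpt G), [/\ hamilton_circle C,
      exists (g : gpt G -> R * R) (c : R * R) (r : R),
        0 < r /\ embedding_on setT g /\ range g `<=` disk c r /\ g @` C = sphere c r
    & forall C', hamilton_circle C' -> C' = C].
Proof.
move=> sG lfG cG tc noK4 noK23; have [[m _] conG] := cG.
have [lt [M oo]] := outer_order_exists sG lfG cG tc noK4 noK23 m.
have [nu nui] := locally_finite_countable lfG conG.
have mM2 : exists z, lt m z /\ lt z M.
  have [a [b [c [ab [bc ac]]]]] := tc.1.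
  have [z [zm zM]] : exists z, z <> m /\ z <> M.
    apply: contrapT => no.
    have two v : v = m \/ v = M.
      have [?|vm] := pselect (v = m); [by left|right].
      by apply: contrapT => vM; apply: no; exists v.
    by case: (two a) (two b) (two c) => h1 [] h2 [] h3; congruence.
  by exists z; split; [exact: oo_min oo _ zm|exact: oo_max oo _ zM].
have tc2 := tc.2.
exists (draw lt m M nu @^-1` sphere (width lt M nu / 2, 0) (width lt M nu / 2)); split.
- exact: boundary_hamilton.
- exists (draw lt m M nu), (width lt M nu / 2, 0), (width lt M nu / 2); split; last split; last split.
  + exact: (radius_gt0 oo mM2 nui).
  + exact: draw_embedding.
  + by move=> _ [z _ <-]; exact: draw_disk.
  + exact: boundary_image.
- by move=> C' hC'; exact: (hamilton_circle_unique sG oo lfG conG tc2 mM2 nui hC').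
Qed.

Theorem theorem1p8 (G : graph) :
  simple G -> locally_finite G -> connected_graph G ->
  let cond_i := two_connected G /\ ~ has_minor G K4 /\ ~ has_minor G K23 in
  let cond_ii := exists C : set (gpt G), hamilton_circle C /\
      exists (g : gpt G -> R * R) (c : R * R) (r : R),
        0 < r /\ embedding_on setT g /\ range g `<=` disk c r /\
        g @` C = sphere c r in
  (cond_i <-> cond_ii) /\
  (cond_i -> cond_ii -> exists! C : set (gpt G), hamilton_circle C).
Proof.
move=> sG lfG cG cond_i cond_ii; split; first split.
- move=> [tc [noK4 noK23]].
  by have [C [hC hg _]] := forbidden_minors_drawing sG lfG cG tc noK4 noK23; exists C.
- exact: disk_hamilton_circle_imp.
- move=> [tc [noK4 noK23]] _.
  have [C [hC _ uniq]] := forbidden_minors_drawing sG lfG cG tc noK4 noK23.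
  by exists C; split=> // C' /uniq.
Qed.
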